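(* Let $\mathbf{k}$ be an algebraically closed field and let $u,v\geq 1$ be integers. In $\mathrm{D}^b(N(2u+v,u+v+1))$ consider the following indecomposable complexes of injective modules (concentrated in degrees $-1,0,1$, with $I_u$ in degree $0$, and with all displayed maps between nonzero terms being nonzero): $$E_i'=(I_i\to I_{u}\to 0),\quad 1\leq i\leq u-1;$$ $$F_j'=(0\to I_{u}\to I_j),\quad u+1\leq j\leq u+v+1;$$ $$G_l'=(I_l\to I_{u}\to I_{u+v+1+l}),\quad 1\leq l\leq u-1.$$ Let $${}^{v}T(u)=I_{u}\oplus\Big(\bigoplus_{i=1}^{u-1} E_i'\Big)\oplus\Big(\bigoplus_{j=u+1}^{u+v+1} F_j'\Big)\oplus\Big(\bigoplus_{l=1}^{u-1} G_l'\Big).$$ Then ${}^{v}T(u)$ is a tilting object in $\mathrm{D}^{b}(N(2u+v,u+v+1))$, whose endomorphism algebra is isomorphic to the one-branch extension algebra ${}^{v}A(u)$.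
   Context: $N(n,r)$ is the Nakayama algebra given as the path algebra over $\mathbf{k}$ of the quiver $1\leftarrow 2\leftarrow\cdots\leftarrow n$ modulo the ideal generated by all paths of length $r$ (if $r=n$ it is the path algebra itself). Paths are composed like functions, so that left modules are representations of the quiver; $I_a$ is the indecomposable injective left module at vertex $a$ (so $I_n$ is simple). $\mathrm{D}^b(A)$ is the bounded derived category of finitely generated left $A$-modules, with modules viewed as complexes in degree $0$. For $N(n,r)$, $\mathrm{Hom}(I_a,I_b)$ is one-dimensional if $a\le b<a+r$ and zero otherwise, so the nonzero maps above are unique up to scalar. An object $T$ of $\mathrm{D}^b(A)$ is tilting if $\mathrm{Hom}(T,T[k])=0$ for all $k\neq0$ and $T$ generates $\mathrm{D}^b(A)$ as a thick triangulated subcategory. Endomorphism algebras are taken with usual composition of maps, so (with paths composed like functions) arrows of the quiver of the endomorphism algebra point in the direction of the morphisms between indecomposable summands. ${}^vA(u)$ is the algebra over $\mathbf{k}$ of the following quiver with relations: vertices $t_1,\dots,t_u$, $b_1,\dots,b_u$, $c_1,\dots,c_v$; arrows $t_i\to t_{i+1}$ and $b_i\to b_{i+1}$ ($1\le i\le u-1$), $t_i\to b_i$ ($1\le i\le u$), $c_i\to c_{i+1}$ ($1\le i\le v-1$), and $c_v\to t_1$; relations: each square $t_i,t_{i+1},b_i,b_{i+1}$ commutes. *)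

(* Defs.v *)
From HB Require Import structures.
From mathcomp Require Import all_boot all_order all_algebra.
From mathcomp Require Import generic_quotient finmap ring_quotient.
From mathcomp.classical Require Import boolp.
From mathcomp.multinomials Require Import monalg.

Set Implicit Arguments.
Unset Strict Implicit.
Unset Printing Implicit Defensive.

Import GRing.Theory.
Local Open Scope ring_scope.
Local Open Scope quotient_scope.

Section Paths.

Record quiver := Quiver {
  vert : finType;
  arrow : finType;
  src : arrow -> vert;
  tgt : arrow -> vert }.

Variable Q : quiver.

Fixpoint is_qpath (x : vert Q) (s : seq (arrow Q)) : bool :=
  if s is a :: s' then (src a == x) && is_qpath (tgt a) s' else true.

(* A starting vertex, followed by arrows in the order of traversal. *)
Record qpath := QPath {
  qpath_val : vert Q * seq (arrow Q);
  _ : is_qpath qpath_val.1 qpath_val.2 }.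
HB.instance Definition _ := [isSub for qpath_val].
HB.instance Definition _ := [Choice of qpath by <:].

Definition psrc (p : qpath) : vert Q := (val p).1.
Definition parrows (p : qpath) : seq (arrow Q) := (val p).2.
Definition ptgt (p : qpath) : vert Q := last (psrc p) (map (@tgt Q) (parrows p)).
Definition plen (p : qpath) : nat := size (parrows p).
Definition ptrace (p : qpath) : seq (vert Q) :=
  psrc p :: map (@tgt Q) (parrows p).

Definition ptriv (x : vert Q) : qpath := @QPath (x, [::]) isT.

(* Paths compose like functions: [pcomp p q] is "q, then p". *)
Definition pcomp (p q : qpath) : option qpath :=
  if ptgt q == psrc p then (insub (psrc q, parrows q ++ parrows p) : option qpath) else None.

Lemma is_qpath_cat x s t :
  is_qpath x (s ++ t) = is_qpath x s && is_qpath (last x (map (@tgt Q) s)) t.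
Proof. by elim: s x => //= a s IHs x; rewrite IHs andbA. Qed.

Lemma pcompT p q : ptgt q = psrc p ->
  exists2 r, pcomp p q = Some r & val r = (psrc q, parrows q ++ parrows p).
Proof.
move=> Epq; rewrite /pcomp Epq eqxx; case: insubP => [r _ Er|]; first by exists r.
by rewrite /= is_qpath_cat [last _ _]Epq; move: (valP p) (valP q) => -> ->.
Qed.

Lemma pcompP p q :
  (exists r, [/\ pcomp p q = Some r, ptgt q = psrc p
               & val r = (psrc q, parrows q ++ parrows p)])
  \/ (pcomp p q = None /\ ptgt q <> psrc p).
Proof.
case: (eqVneq (ptgt q) (psrc p)) => [E|N].
  by left; have [r Er Hr] := pcompT E; exists r.
by right; rewrite /pcomp (negPf N); split=> //; apply/eqP.
Qed.

Lemma ptgt_cat r p q : val r = (psrc q, parrows q ++ parrows p) ->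
  ptgt r = last (ptgt q) (map (@tgt Q) (parrows p)).
Proof.
move=> Vr; rewrite /ptgt [psrc r]/psrc [parrows r]/parrows Vr /=.
by rewrite map_cat last_cat.
Qed.

Lemma pcompA p q r :
  obind (pcomp p) (pcomp q r) = obind (fun s => pcomp s r) (pcomp p q).
Proof.
case: (pcompP q r) => [[qr [-> Eqr Vqr]]|[-> Nqr]] /=;
  case: (pcompP p q) => [[pq [-> Epq Vpq]]|[-> Npq]] //=.
- have E1 : ptgt qr = psrc p.
    by rewrite (ptgt_cat Vqr) Eqr.
  have E2 : ptgt r = psrc pq by rewrite /psrc Vpq.
  have [s1 -> V1] := pcompT E1; have [s2 -> V2] := pcompT E2.
  congr Some; apply: val_inj; rewrite V1 V2.
  by rewrite /psrc /parrows Vqr Vpq /= catA.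
- case: (pcompP p qr) => [[s [_ E _]]|[-> _]] //; case: Npq.
  by rewrite -E (ptgt_cat Vqr) Eqr.
- case: (pcompP pq r) => [[s [_ E _]]|[-> _]] //; case: Nqr.
  by rewrite E /psrc Vpq.
Qed.

Lemma pcomp1p x q : pcomp (ptriv x) q = if ptgt q == x then Some q else None.
Proof.
rewrite /pcomp; case: eqP => // _; rewrite cats0 /psrc /parrows.
by rewrite -surjective_pairing valK.
Qed.

Lemma pcompp1 x q : pcomp q (ptriv x) = if psrc q == x then Some q else None.
Proof.
rewrite /pcomp -[ptgt (ptriv x)]/x eq_sym; case: eqP => // <-.
have -> : (psrc (ptriv (psrc q)), parrows (ptriv (psrc q)) ++ parrows q) = val q.
  by rewrite /psrc /parrows /=; case: (val q).
by rewrite valK.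
Qed.

End Paths.

Lemma malgUZ (k : fieldType) (K : choiceType) (c : k) (p : K) :
  << c *g p >> = c *: << p >> :> {malg k[K]}.
Proof.
apply/malgP => q; rewrite mcoeffZ 2!mcoeffU.
by case: (p == q); rewrite ?mulr0 ?mulr1.
Qed.

Definition pathalg (k : fieldType) (Q : quiver) := {malg k[qpath Q]}.
HB.instance Definition _ k Q := GRing.Lmodule.on (pathalg k Q).

(* Locked: unification otherwise unfolds finitely supported functions. *)
HB.lock Definition pelt (k : fieldType) (Q : quiver) (p : qpath Q) : pathalg k Q :=
  << p >>.

HB.lock Definition pcoef (k : fieldType) (Q : quiver) (x : pathalg k Q)
  (p : qpath Q) : k := x@_p.

Definition pbasis (k : fieldType) (Q : quiver) (p q : qpath Q) : pathalg k Q :=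
  if pcomp p q is Some r then pelt k r else 0.

HB.lock Definition pmul (k : fieldType) (Q : quiver) (x y : pathalg k Q) :
    pathalg k Q :=
  \sum_(p <- msupp x) \sum_(q <- msupp y) (pcoef x p * pcoef y q) *: pbasis k p q.

Definition pone (k : fieldType) (Q : quiver) : pathalg k Q :=
  \sum_x pelt k (ptriv x).

Section PathAlgebra.

Variables (k : fieldType) (Q : quiver).
Local Notation pathalg := (pathalg k Q).
Local Notation pbasis := (@pbasis k Q).
Local Notation pone := (pone k Q).
Local Notation pelt := (@pelt k Q).
Local Notation pmul := (@pmul k Q).
Local Notation "x @_ p" := (pcoef x p).

Lemma pcoef_linear p : linear ((@pcoef k Q)^~ p : pathalg -> k^o).
Proof. by move=> c x y; rewrite pcoef.unlock mcoeffD mcoeffZ. Qed.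

Lemma pcoefD p (x y : pathalg) : (x + y)@_p = x@_p + y@_p.
Proof. by rewrite pcoef.unlock mcoeffD. Qed.

Lemma pcoefZ p c (x : pathalg) : (c *: x)@_p = c * x@_p.
Proof. by rewrite pcoef.unlock mcoeffZ. Qed.

Lemma pcoef0 p : (0 : pathalg)@_p = 0.
Proof. by rewrite pcoef.unlock mcoeff0. Qed.

Lemma pcoef_elt p q : (pelt p)@_q = (p == q)%:R.
Proof. by rewrite pcoef.unlock pelt.unlock mcoeffU. Qed.

Lemma pathalgP (x y : pathalg) : (forall p, x@_p = y@_p) -> x = y.
Proof. by rewrite pcoef.unlock => E; apply/malgP. Qed.

Lemma pathalgE (x : pathalg) : x = \sum_(p <- msupp x) x@_p *: pelt p.
Proof.
rewrite [LHS]monalgE pcoef.unlock pelt.unlock.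
by apply: eq_bigr => p _; rewrite malgUZ.
Qed.

Definition psum (M : lmodType k) (F : qpath Q -> M) (x : pathalg) : M :=
  \sum_(p <- msupp x) x@_p *: F p.

Lemma psumw (M : lmodType k) (F : qpath Q -> M) (x : pathalg) (d : {fset qpath Q}) :
  (msupp x `<=` d)%fset -> psum F x = \sum_(p <- d) x@_p *: F p.
Proof.
move=> sd; rewrite /psum (big_fset_incl _ sd) // => p _ Np.
by rewrite pcoef.unlock (mcoeff_outdom Np) scale0r.
Qed.

Lemma psum_linear (M : lmodType k) (F : qpath Q -> M) : linear (psum F).
Proof.
move=> c x y; pose d := (msupp x `|` msupp y)%fset.
rewrite (@psumw _ _ _ d); last first.
  apply: (fsubset_trans (msuppD_le _ _)).
  by apply: fsetUSS => //; apply: msuppZ_le.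
rewrite (@psumw _ _ x d) ?fsubsetUl // (@psumw _ _ y d) ?fsubsetUr //.
rewrite scaler_sumr -big_split; apply: eq_bigr => p _ /=.
by rewrite pcoefD pcoefZ scalerDl scalerA.
Qed.

Lemma psumU (M : lmodType k) (F : qpath Q -> M) p : psum F (pelt p) = F p.
Proof.
rewrite (@psumw _ _ _ [fset p]%fset); last by rewrite pelt.unlock msuppU_le.
by rewrite big_seq_fset1 pcoef_elt eqxx scale1r.
Qed.

Lemma linear_psum (M : lmodType k) (f : pathalg -> M) (x : pathalg) : linear f ->
  f x = \sum_(p <- msupp x) x@_p *: f (pelt p).
Proof.
move=> lf; pose F : {linear pathalg -> M} :=
  HB.pack f (GRing.isLinear.Build k pathalg M *:%R f lf).
rewrite -[f]/(F : _ -> _) {1}(pathalgE x) linear_sum.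
by apply: eq_bigr => p _; rewrite linearZ.
Qed.

Lemma linear_ext (M : lmodType k) (f g : pathalg -> M) : linear f -> linear g ->
  (forall p, f (pelt p) = g (pelt p)) -> f =1 g.
Proof.
move=> lf lg E x; rewrite (linear_psum x lf) (linear_psum x lg).
by apply: eq_bigr => p _; rewrite E.
Qed.

Lemma pmulE (x y : pathalg) : pmul x y = psum (fun p => psum (pbasis p) y) x.
Proof.
rewrite pmul.unlock; apply: eq_bigr => p _; rewrite scaler_sumr; apply: eq_bigr => q _.
by rewrite scalerA.
Qed.

Lemma pmulUU p q : pmul (pelt p) (pelt q) = pbasis p q.
Proof. by rewrite pmulE !psumU. Qed.

Lemma pmul_linearl y : linear (pmul^~ y).
Proof. by move=> c x x'; rewrite !pmulE psum_linear. Qed.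

Lemma pmul_linearr x : linear (pmul x).
Proof.
move=> c y y'; rewrite !pmulE /psum scaler_sumr -big_split /=.
apply: eq_bigr => p _; rewrite -!/(psum _ _) psum_linear scalerDr !scalerA.
by rewrite mulrC.
Qed.

Lemma pmul0 x : pmul x 0 = 0.
Proof. by have := pmul_linearr x (-1) 0 0; rewrite scaler0 addr0 scaleN1r addNr. Qed.

Lemma p0mul x : pmul 0 x = 0.
Proof. by have := pmul_linearl x (-1) 0 0; rewrite scaler0 addr0 scaleN1r addNr. Qed.

Lemma pmulDr x : {morph pmul x : y z / y + z}.
Proof. by move=> y z; rewrite -[y]scale1r pmul_linearr !scale1r. Qed.

Lemma pmulDl z : {morph pmul^~ z : x y / x + y}.
Proof. by move=> x y; rewrite -[x]scale1r /= (pmul_linearl z) !scale1r. Qed.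

Lemma pmulZl c x y : c *: pmul x y = pmul (c *: x) y.
Proof. by rewrite -[in RHS](addr0 (c *: x)) (pmul_linearl y) /= p0mul addr0. Qed.

Lemma pmulZr c x y : c *: pmul x y = pmul x (c *: y).
Proof. by rewrite -[in RHS](addr0 (c *: y)) pmul_linearr pmul0 addr0. Qed.

Lemma pbasis_assoc p q r : pmul (pelt p) (pbasis q r) = pmul (pbasis p q) (pelt r).
Proof.
have := pcompA p q r; rewrite /pbasis.
case: (pcomp q r) => [s|]; case: (pcomp p q) => [t|] /=.
- by rewrite !pmulUU /pbasis => ->.
- by rewrite p0mul pmulUU /pbasis => ->.
- by rewrite pmul0 pmulUU /pbasis => <-.
- by rewrite pmul0 p0mul.
Qed.

Lemma pmulA : associative pmul.
Proof.
move=> x y z.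
apply: (@linear_ext _ (fun x => pmul x (pmul y z)) (fun x => pmul (pmul x y) z))
  => [||p].
- exact: pmul_linearl.
- by move=> c a b; rewrite !pmul_linearl.
apply: (@linear_ext _ (fun y => pmul (pelt p) (pmul y z))
          (fun y => pmul (pmul (pelt p) y) z)) => [||q].
- by move=> c a b; rewrite pmul_linearl pmul_linearr.
- by move=> c a b; rewrite pmul_linearr pmul_linearl.
apply: (@linear_ext _ (fun z => pmul (pelt p) (pmul (pelt q) z))
          (pmul (pmul (pelt p) (pelt q)))) => [||r].
- by move=> c a b; rewrite !pmul_linearr.
- exact: pmul_linearr.
by rewrite !pmulUU pbasis_assoc.
Qed.

Lemma pmul1 : right_id pone pmul.
Proof.
move=> x; apply: (@linear_ext _ (pmul^~ pone) id) => //; first exact: pmul_linearl.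
move=> p; rewrite /pone (big_morph _ (pmulDr _) (pmul0 _)).
rewrite (bigD1 (psrc p)) //= pmulUU /pbasis pcompp1 eqxx big1 ?addr0 // => x' N.
by rewrite pmulUU /pbasis pcompp1 eq_sym (negPf N).
Qed.

Lemma p1mul : left_id pone pmul.
Proof.
move=> x; apply: (@linear_ext _ (pmul pone) id) => //; first exact: pmul_linearr.
move=> p; rewrite /pone (big_morph _ (pmulDl _) (p0mul _)).
rewrite (bigD1 (ptgt p)) //= pmulUU /pbasis pcomp1p eqxx big1 ?addr0 // => x' N.
by rewrite pmulUU /pbasis pcomp1p eq_sym (negPf N).
Qed.

Lemma pmul_coef_triv (x y : pathalg) v :
  (pmul x y)@_(ptriv v) = x@_(ptriv v) * y@_(ptriv v).
Proof.
have aux (p q : qpath Q) :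
    (pbasis p q)@_(ptriv v) = ((p == ptriv v) && (q == ptriv v))%:R.
  rewrite /pbasis; case: (pcompP p q) => [[r [-> E Vr]]|[-> N]].
    rewrite pcoef_elt; congr (_ %:R); congr nat_of_bool.
    apply/eqP/andP => [Er|[/eqP Ep /eqP Eq]].
      move: Vr; rewrite Er => -[Ev /esym/nilP]; 
        rewrite cat_nilp => /andP[/nilP q0 /nilP p0].
      suff Eq : q = ptriv v.
        split; apply/eqP=> //; apply: val_inj.
        by rewrite [val p]surjective_pairing -/(parrows p) p0 -/(psrc p) -E Eq.
      by apply: val_inj; rewrite [val q]surjective_pairing -/(parrows q) q0 -/(psrc q) Ev.
    by apply: val_inj; rewrite Vr Ep Eq.
  rewrite pcoef0; case: eqP => //= Ep; case: eqP => //= Eq; case: N.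
  by rewrite Ep Eq.
apply: (@linear_ext k^o (fun x => (pmul x y)@_(ptriv v))
          (fun x => x@_(ptriv v) * y@_(ptriv v))) => [||p].
- by move=> c a b; rewrite (pmul_linearl y) pcoefD pcoefZ.
- by move=> c a b; rewrite pcoefD pcoefZ mulrDl -mulrA.
apply: (@linear_ext k^o (fun y => (pmul (pelt p) y)@_(ptriv v))
          (fun y => (pelt p)@_(ptriv v) * y@_(ptriv v))) => [||q].
- by move=> c a b; rewrite pmul_linearr pcoefD pcoefZ.
- by move=> c a b; rewrite pcoefD pcoefZ mulrDr mulrCA.
by rewrite pmulUU aux 2!pcoef_elt -natrM mulnb.
Qed.

End PathAlgebra.

HB.instance Definition _ (k : fieldType) (Q : quiver) :=
  GRing.Zmodule_isPzRing.Build (pathalg k Q) (@pmulA k Q) (@p1mul k Q) (@pmul1 k Q)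
    (fun x y z => @pmulDl k Q z x y) (@pmulDr k Q).

Lemma pscaleAl (k : fieldType) (Q : quiver) (c : k) (x y : pathalg k Q) :
  c *: (x * y) = (c *: x) * y.
Proof. exact: pmulZl. Qed.

Lemma pscaleAr (k : fieldType) (Q : quiver) (c : k) (x y : pathalg k Q) :
  c *: (x * y) = x * (c *: y).
Proof. exact: pmulZr. Qed.

Section Ideal.

Variable R : pzRingType.

Definition is_ideal (J : R -> Prop) : Prop :=
  [/\ J 0, (forall x y, J x -> J y -> J (x + y)),
      (forall a x, J x -> J (a * x)) & (forall a x, J x -> J (x * a))].

Definition gen_ideal (S : R -> Prop) (x : R) : Prop :=
  forall J : R -> Prop, is_ideal J -> (forall y, S y -> J y) -> J x.

Lemma gen_idealP (S : R -> Prop) : is_ideal (gen_ideal S).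
Proof.
split.
- by move=> J [].
- by move=> x y Ix Iy J HJ SJ; case: (HJ) => _ JD _ _; apply: JD; [apply: Ix|apply: Iy].
- by move=> a x Ix J HJ SJ; case: (HJ) => _ _ JM _; apply: JM; apply: Ix.
- by move=> a x Ix J HJ SJ; case: (HJ) => _ _ _ JM; apply: JM; apply: Ix.
Qed.

End Ideal.

(* A nonempty quiver with relations; relations are combinations of paths of
   positive length, so that the quotient below is not the zero ring. *)
Record bound_quiver (k : fieldType) := BoundQuiver {
  bq_quiver :> quiver;
  bq_rel : pathalg k bq_quiver -> Prop;
  bq_vertex : vert bq_quiver;
  bq_rel_triv : forall x, bq_rel x -> forall v, pcoef x (ptriv v) = 0 }.

Section BoundQuiverAlgebra.

Variables (k : fieldType) (Q : bound_quiver k).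

Definition bq_ideal : {pred pathalg k Q} := fun x => `[< gen_ideal (@bq_rel k Q) x >].

Lemma bq_idealP x : (x \in bq_ideal) <-> gen_ideal (@bq_rel k Q) x.
Proof. by split=> [/asboolP //|?]; apply/asboolP. Qed.

Lemma bq_ideal_zmod : zmod_closed bq_ideal.
Proof.
have [J0 JD JM _] := gen_idealP (@bq_rel k Q).
split=> [|x y /bq_idealP Ix /bq_idealP Iy]; apply/bq_idealP => //.
by apply: JD => //; rewrite -mulN1r; apply: JM.
Qed.
HB.instance Definition _ := GRing.isZmodClosed.Build (pathalg k Q) bq_ideal
  bq_ideal_zmod.

Lemma bq_idealMl a x : x \in bq_ideal -> a * x \in bq_ideal.
Proof.
have [_ _ JM _] := gen_idealP (@bq_rel k Q).
by move=> /bq_idealP Ix; apply/bq_idealP; exact: JM.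
Qed.

Lemma bq_idealMr a x : x \in bq_ideal -> x * a \in bq_ideal.
Proof.
have [_ _ _ JM] := gen_idealP (@bq_rel k Q).
by move=> /bq_idealP Ix; apply/bq_idealP; exact: JM.
Qed.

Lemma bq_ideal1 : 1 \notin bq_ideal.
Proof.
apply/negP => /bq_idealP I1.
have /(_ (bq_vertex Q)) : forall v, pcoef (1 : pathalg k Q) (ptriv v) = 0.
  apply: (I1 (fun x => forall v, pcoef x (ptriv v) = 0)); last exact: bq_rel_triv.
  split=> [v|x y Hx Hy v|a x Hx v|a x Hx v].
  - exact: pcoef0.
  - by rewrite pcoefD Hx Hy addr0.
  - by rewrite [LHS]pmul_coef_triv Hx mulr0.
  - by rewrite [LHS]pmul_coef_triv Hx mul0r.
set e := pelt k (ptriv (bq_vertex Q)).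
have /eqP := pmul_coef_triv e 1 (bq_vertex Q).
rewrite -[pmul e 1]/(e * 1) mulr1 pcoef_elt eqxx mul1r eq_sym => /eqP-> /eqP.
by rewrite oner_eq0.
Qed.

Definition bqalg := {ideal_quot (bq_ideal : zmodClosed (pathalg k Q))}.
HB.instance Definition _ := GRing.Zmodule.on bqalg.

Definition bqpi (x : pathalg k Q) : bqalg := \pi_bqalg x.

Lemma bqpi_eq x y : bqpi x = bqpi y <-> x - y \in bq_ideal.
Proof. by rewrite Quotient.idealrBE; split=> [/eqP|/eqP]. Qed.

Lemma bqpiK (x : bqalg) : bqpi (repr x) = x.
Proof. exact: reprK. Qed.

Lemma bqpiD x y : bqpi (x + y) = bqpi x + bqpi y.
Proof. exact: (Quotient.pi_add). Qed.

Definition bqone : bqalg := bqpi 1.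
Definition bqmul (x y : bqalg) : bqalg := bqpi (repr x * repr y).
Definition bqscale (c : k) (x : bqalg) : bqalg := bqpi (c *: repr x).

Lemma repr_bqpi x : repr (bqpi x) - x \in bq_ideal.
Proof. by apply/bqpi_eq; rewrite bqpiK. Qed.

Lemma bqpiM x y : bqpi (x * y) = bqmul (bqpi x) (bqpi y).
Proof.
apply/esym/bqpi_eq; set x' := repr _; set y' := repr _.
have -> : x' * y' - x * y = (x' - x) * y' + x * (y' - y).
  by rewrite mulrBl mulrBr addrA subrK.
by apply: rpredD; [apply: bq_idealMr | apply: bq_idealMl]; apply: repr_bqpi.
Qed.

Lemma bq_idealZ c x : x \in bq_ideal -> c *: x \in bq_ideal.
Proof. by move=> Ix; rewrite -[x]mul1r pscaleAl bq_idealMl. Qed.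

Lemma bqpiZ c x : bqpi (c *: x) = bqscale c (bqpi x).
Proof.
apply/esym/bqpi_eq; rewrite -scalerBr.
by apply: bq_idealZ; apply: repr_bqpi.
Qed.

Lemma bqmulA : associative bqmul.
Proof.
by move=> x y z; rewrite -[x]bqpiK -[y]bqpiK -[z]bqpiK -!bqpiM mulrA.
Qed.

Lemma bqmul1r : left_id bqone bqmul.
Proof. by move=> x; rewrite -[x]bqpiK -bqpiM mul1r. Qed.

Lemma bqmulr1 : right_id bqone bqmul.
Proof. by move=> x; rewrite -[x]bqpiK -bqpiM mulr1. Qed.

Lemma bqmulDl : left_distributive bqmul +%R.
Proof.
by move=> x y z; rewrite -[x]bqpiK -[y]bqpiK -[z]bqpiK -bqpiD -!bqpiM mulrDl bqpiD.
Qed.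

Lemma bqmulDr : right_distributive bqmul +%R.
Proof.
by move=> x y z; rewrite -[x]bqpiK -[y]bqpiK -[z]bqpiK -bqpiD -!bqpiM mulrDr bqpiD.
Qed.

Lemma bqone_neq0 : bqone != 0.
Proof.
apply/eqP; rewrite -[0]bqpiK => /bqpi_eq H.
have := repr_bqpi 0; have -> : bqpi 0 = 0 by exact: (raddf0 \pi_bqalg).
rewrite subr0 => H0; have := rpredD H H0; rewrite subrK.
by rewrite (negPf bq_ideal1).
Qed.

HB.instance Definition _ := GRing.Zmodule_isNzRing.Build bqalg
  bqmulA bqmul1r bqmulr1 bqmulDl bqmulDr bqone_neq0.

Lemma bqscaleA a b x : bqscale a (bqscale b x) = bqscale (a * b) x.
Proof. by rewrite -[x]bqpiK -!bqpiZ scalerA. Qed.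

Lemma bqscale1 : left_id 1 bqscale.
Proof. by move=> x; rewrite -[x]bqpiK -!bqpiZ scale1r. Qed.

Lemma bqscaleDr : right_distributive bqscale +%R.
Proof.
by move=> a x y; rewrite -[x]bqpiK -[y]bqpiK -bqpiD -!bqpiZ scalerDr bqpiD.
Qed.

Lemma bqscaleDl x : {morph bqscale^~ x : a b / a + b}.
Proof. by move=> a b; rewrite -[x]bqpiK -!bqpiZ scalerDl bqpiD. Qed.

HB.instance Definition _ := GRing.Zmodule_isLmodule.Build k bqalg
  bqscaleA bqscale1 bqscaleDr bqscaleDl.

Lemma bqscaleAl (a : k) (x y : bqalg) : a *: (x * y) = (a *: x) * y.
Proof.
rewrite -[x]bqpiK -[y]bqpiK -[RHS]/(bqmul (bqscale a _) _) -[LHS]/(bqscale a (bqmul _ _)).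
by rewrite -bqpiM -!bqpiZ -bqpiM pscaleAl.
Qed.
HB.instance Definition _ := GRing.Lmodule_isLalgebra.Build k bqalg bqscaleAl.

Lemma bqscaleAr (a : k) (x y : bqalg) : a *: (x * y) = x * (a *: y).
Proof.
rewrite -[x]bqpiK -[y]bqpiK -[RHS]/(bqmul _ (bqscale a _)) -[LHS]/(bqscale a (bqmul _ _)).
by rewrite -bqpiM -!bqpiZ -bqpiM pscaleAr.
Qed.
HB.instance Definition _ := GRing.Lalgebra_isAlgebra.Build k bqalg bqscaleAr.

End BoundQuiverAlgebra.

Section Modules.

Variables (k : fieldType) (A : algType k).

Definition mk_linear (M N : lmodType A) (f : M -> N) (lf : linear f) :
    {linear M -> N} :=
  HB.pack f (GRing.isLinear.Build A M N *:%R f lf).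

Definition fin_gen (M : lmodType A) : Prop :=
  exists (n : nat) (g : 'I_n -> M),
    forall x, exists c : 'I_n -> A, x = \sum_i c i *: g i.

(* The left module D(eA) = Hom_k(eA, k), with (a f)(y) = f(y a).  For e
   idempotent, A = eA + (1 - e)A, and a functional on eA is encoded as the
   functional f on A extending it by zero on (1 - e)A, i.e. f(e y) = f(y). *)
Definition is_dual (e : A) (f : A -> k) : bool :=
  `[< scalar f /\ forall y, f (e * y) = f y >].

Record dual_mod (e : A) := DualMod { dual_fun :> A -> k; _ : is_dual e dual_fun }.
HB.instance Definition _ e := [isSub for @dual_fun e].
HB.instance Definition _ e := [Choice of dual_mod e by <:].

Section DualMod.
Variable e : A.
Implicit Types f g h : dual_mod e.

Lemma dual_modP f : scalar f /\ forall y, f (e * y) = f y.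
Proof. by case: f => f /= /asboolP. Qed.

Lemma dual_mod_ext f g : (forall y, f y = g y) -> f = g.
Proof. by move=> E; apply: val_inj; apply: funext. Qed.

Lemma dual_funD f x y : f (x + y) = f x + f y.
Proof. by have [lf _] := dual_modP f; have := lf 1 x y; rewrite scale1r mul1r. Qed.

Lemma dual_fun0 f : f 0 = 0.
Proof. by apply: (addrI (f 0)); rewrite -dual_funD !addr0. Qed.

Lemma dual_funZ f c x : f (c *: x) = c * f x.
Proof. by have [lf _] := dual_modP f; have := lf c x 0; rewrite dual_fun0 !addr0. Qed.

Lemma dual_zero_subproof : is_dual e (fun=> 0).
Proof. by apply/asboolP; split=> // c x y; rewrite mulr0 addr0. Qed.

Lemma dual_opp_subproof f : is_dual e (fun y => - f y).
Proof.
have [lf ef] := dual_modP f; apply/asboolP; split=> [c x y|y]; last by rewrite ef.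
by rewrite lf opprD mulrN.
Qed.

Lemma dual_add_subproof f g : is_dual e (fun y => f y + g y).
Proof.
have [[lf ef] [lg eg]] := (dual_modP f, dual_modP g).
apply/asboolP; split=> [c x y|y]; last by rewrite ef eg.
by rewrite lf lg mulrDr addrACA.
Qed.

Lemma dual_scale_subproof (a : A) f : is_dual e (fun y => f (y * a)).
Proof.
have [lf ef] := dual_modP f; apply/asboolP; split=> [c x y|y].
  by rewrite mulrDl -scalerAl lf.
by rewrite -mulrA ef.
Qed.

Definition dual_zero := DualMod dual_zero_subproof.
Definition dual_opp f := DualMod (dual_opp_subproof f).
Definition dual_add f g := DualMod (dual_add_subproof f g).
Definition dual_scale a f := DualMod (dual_scale_subproof a f).

Lemma dual_addA : associative dual_add.
Proof. by move=> f g h; apply: dual_mod_ext => y; apply: addrA. Qed.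
Lemma dual_addC : commutative dual_add.
Proof. by move=> f g; apply: dual_mod_ext => y; apply: addrC. Qed.
Lemma dual_add0 : left_id dual_zero dual_add.
Proof. by move=> f; apply: dual_mod_ext => y; apply: add0r. Qed.
Lemma dual_addN : left_inverse dual_zero dual_opp dual_add.
Proof. by move=> f; apply: dual_mod_ext => y; apply: addNr. Qed.

HB.instance Definition _ :=
  GRing.isZmodule.Build (dual_mod e) dual_addA dual_addC dual_add0 dual_addN.

Lemma dual_scaleA a b f : dual_scale a (dual_scale b f) = dual_scale (a * b) f.
Proof. by apply: dual_mod_ext => y /=; rewrite mulrA. Qed.
Lemma dual_scale1 : left_id 1 dual_scale.
Proof. by move=> f; apply: dual_mod_ext => y /=; rewrite mulr1. Qed.
Lemma dual_scaleDr : right_distributive dual_scale +%R.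
Proof. by move=> a f g; apply: dual_mod_ext. Qed.
Lemma dual_scaleDl f : {morph dual_scale^~ f : a b / a + b}.
Proof. by move=> a b; apply: dual_mod_ext => y /=; rewrite mulrDr dual_funD. Qed.

HB.instance Definition _ := GRing.Zmodule_isLmodule.Build A (dual_mod e)
  dual_scaleA dual_scale1 dual_scaleDr dual_scaleDl.

End DualMod.

Lemma dual_mod_hom_eq0 (e e' : A) (h : {linear dual_mod e -> dual_mod e'}) :
  (forall z, e * z * e' = 0) -> forall f, h f = 0.
Proof.
move=> E f; apply: dual_mod_ext => y; have [_ eh] := dual_modP (h f).
have dval (b : A) : h f b = h (b *: f) 1.
  by rewrite linearZ /= -[b in LHS]mul1r.
rewrite -eh dval; suff -> : (e' * y) *: f = 0 by rewrite raddf0.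
apply: dual_mod_ext => z; have [_ ef] := dual_modP f.
change (f (z * (e' * y)) = 0).
by rewrite -ef !mulrA E mul0r dual_fun0.
Qed.

End Modules.

Section Complexes.

Variables (k : fieldType) (A : algType k).

Record cx := Cx {
  cx_obj :> int -> lmodType A;
  cx_d : forall i : int, {linear cx_obj i -> cx_obj (i + 1)};
  cx_dd : forall (i : int) x, cx_d (i + 1) (cx_d i x) = 0 }.

Record cxmap (X Y : cx) := CxMap {
  cxmap_fun :> forall i : int, {linear X i -> Y i};
  cxmap_d : forall (i : int) x, cxmap_fun (i + 1) (cx_d X i x) = cx_d Y i (cxmap_fun i x) }.

(* The objects of D^b(A). *)
Definition is_Db (X : cx) : Prop :=
  (exists N : nat, forall i : int, (N < `|i|)%N -> forall x : X i, x = 0)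
  /\ (forall i : int, fin_gen (X i)).

Section Maps.
Variables X Y Z : cx.

Lemma cxmap_comp_subproof (g : cxmap Y Z) (f : cxmap X Y) i x :
  (g (i + 1) \o f (i + 1)) (cx_d X i x) = cx_d Z i ((g i \o f i) x).
Proof. by rewrite /= !cxmap_d. Qed.
Definition cxmap_comp (g : cxmap Y Z) (f : cxmap X Y) : cxmap X Z :=
  @CxMap X Z (fun i : int => g i \o f i) (@cxmap_comp_subproof g f).

Lemma cxmap_zero_subproof (i : int) (x : X i) :
  (\0 : {linear X (i + 1) -> Y (i + 1)}) (cx_d X i x)
  = cx_d Y i ((\0 : {linear X i -> Y i}) x).
Proof. by rewrite /= raddf0. Qed.
Definition cxmap_zero : cxmap X Y := CxMap cxmap_zero_subproof.

Lemma cxmap_add_subproof (f g : cxmap X Y) i x :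
  (f (i + 1) \+ g (i + 1)) (cx_d X i x) = cx_d Y i ((f i \+ g i) x).
Proof. by rewrite /= !cxmap_d raddfD. Qed.
Definition cxmap_add (f g : cxmap X Y) : cxmap X Y :=
  @CxMap X Y (fun i : int => f i \+ g i) (@cxmap_add_subproof f g).

Lemma kscale_subproof (c : k) (M N : lmodType A) (f : {linear M -> N}) :
  linear (fun x => (c%:A : A) *: f x).
Proof.
move=> a x y; rewrite linearP scalerDr !scalerA.
by rewrite -scalerAl mul1r -scalerAr mulr1.
Qed.
Lemma cxmap_scale_subproof (c : k) (f : cxmap X Y) i x :
  mk_linear (kscale_subproof c (f (i + 1))) (cx_d X i x)
  = cx_d Y i (mk_linear (kscale_subproof c (f i)) x).
Proof. by rewrite /= cxmap_d linearZ. Qed.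
Definition cxmap_scale (c : k) (f : cxmap X Y) : cxmap X Y := CxMap (@cxmap_scale_subproof c f).

Definition homotopic (f g : cxmap X Y) : Prop :=
  exists h : forall i : int, {linear X (i + 1) -> Y i}, forall (i : int) x,
    f (i + 1) x - g (i + 1) x = cx_d Y i (h i x) + h (i + 1) (cx_d X (i + 1) x).

(* f is injective and surjective on the cohomology in each degree i + 1.  Writing a
   degree as i + 1, here and in [homotopic], avoids casts from i - 1 + 1 to i. *)
Definition quasi_iso (f : cxmap X Y) : Prop := forall i : int,
  (forall x : X (i + 1), cx_d X (i + 1) x = 0 ->
     (exists y, f (i + 1) x = cx_d Y i y) -> exists x', x = cx_d X i x')
  /\ (forall y : Y (i + 1), cx_d Y (i + 1) y = 0 ->
     exists x y', cx_d X (i + 1) x = 0 /\ y = f (i + 1) x + cx_d Y i y').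

End Maps.

Lemma cxmap_id_subproof (X : cx) i (x : X i) :
  (idfun : {linear X (i + 1) -> X (i + 1)}) (cx_d X i x)
  = cx_d X i ((idfun : {linear X i -> X i}) x).
Proof. by []. Qed.
Definition cxmap_id X : cxmap X X := CxMap (@cxmap_id_subproof X).

Definition cx_tr (X : int -> lmodType A) (i j : int) (e : i = j) :
    {linear X i -> X j} :=
  match e in _ = j' return {linear X i -> X j'} with erefl => idfun end.

Lemma cx_tr_d (X : cx) (i j : int) (e : i = j) (x : X i) :
  cx_d X j (cx_tr X e x) = cx_tr X (congr1 (+%R^~ 1) e) (cx_d X i x).
Proof. by case: _ / e. Qed.

Section Shift.
Variables (X : cx) (n : int).

Let shobj (i : int) : lmodType A := X (i + n).
Lemma shift_d_linear (i : int) :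
  linear (fun x : shobj i => cx_tr X (addrAC i n 1)
                               ((-1 : A) ^+ `|n|%N *: cx_d X (i + n) x)).
Proof.
move=> a x y; rewrite linearP scalerDr raddfD /=; congr (_ + _).
by rewrite -[RHS]linearZ /= !scalerA (commr_sign a).
Qed.
Definition shift_d (i : int) := mk_linear (@shift_d_linear i).
Lemma shift_dd (i : int) x : shift_d (i + 1) (shift_d i x) = 0.
Proof.
by rewrite /= cx_tr_d [cx_d X _ (_ *: _)]linearZ /= cx_dd !(scaler0, raddf0).
Qed.
Definition cx_shift : cx := Cx shift_dd.
End Shift.

Section Cone.
Variables (X Y : cx) (f : cxmap X Y).

Let cobj (i : int) : lmodType A := prod (X (i + 1)) (Y i).
Lemma cone_d_linear (i : int) : linear (fun p : cobj i =>
  ((- cx_d X (i + 1) p.1, f (i + 1) p.1 + cx_d Y i p.2) : cobj (i + 1))).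
Proof.
move=> a [x y] [x' y'] /=; congr (_, _).
  by rewrite (linearP (cx_d X (i + 1))) opprD -scalerN.
by rewrite (linearP (f (i + 1))) (linearP (cx_d Y i)) addrACA -scalerDr.
Qed.
Definition cone_d (i : int) := mk_linear (@cone_d_linear i).
Lemma cone_dd (i : int) x : cone_d (i + 1) (cone_d i x) = 0.
Proof.
case: x => x y /=; congr (_, _).
  by rewrite (linearN (cx_d X _)) /= cx_dd !oppr0.
by rewrite (linearN (f _)) (linearD (cx_d Y _)) /= cxmap_d cx_dd addr0 addNr.
Qed.
Definition cx_cone : cx := Cx cone_dd.
End Cone.

Section Biproduct.
Variables X Y : cx.

Let bobj (i : int) : lmodType A := prod (X i) (Y i).
Lemma biprod_d_linear (i : int) :
  linear (fun p : bobj i => ((cx_d X i p.1, cx_d Y i p.2) : bobj (i + 1))).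
Proof. by move=> a [x y] [x' y'] /=; rewrite !linearP. Qed.
Definition biprod_d (i : int) := mk_linear (@biprod_d_linear i).
Lemma biprod_dd (i : int) x : biprod_d (i + 1) (biprod_d i x) = 0.
Proof. by case: x => x y /=; rewrite !cx_dd. Qed.
Definition cx_biprod : cx := Cx biprod_dd.
End Biproduct.

Definition mod0 : lmodType A := 'rV[A]_0.

Section ThreeTerm.
Variables (M N P : lmodType A) (f : {linear M -> N}) (g : {linear N -> P}).
Hypothesis gf0 : forall x, g (f x) = 0.

Definition cx3_obj (i : int) : lmodType A :=
  match i with Negz 0 => M | Posz 0 => N | Posz 1 => P | _ => mod0 end.
Definition cx3_d (i : int) : {linear cx3_obj i -> cx3_obj (i + 1)} :=
  match i return {linear cx3_obj i -> cx3_obj (i + 1)} with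
  | Negz 0 => f | Posz 0 => g | _ => \0
  end.
Lemma cx3_dd (i : int) x : cx3_d (i + 1) (cx3_d i x) = 0.
Proof.
case: i x => [[|[|i]]|[|i]] x //=; rewrite ?raddf0 //.
Qed.
Definition cx3 : cx := Cx cx3_dd.
End ThreeTerm.

Lemma lin0_comp (M N P : lmodType A) (f : {linear M -> N}) x :
  (\0 : {linear N -> P}) (f x) = 0.
Proof. by []. Qed.
Lemma lin_comp0 (M N P : lmodType A) (g : {linear N -> P}) x :
  g ((\0 : {linear M -> N}) x) = 0.
Proof. exact: raddf0. Qed.

Definition cx_stalk (N : lmodType A) : cx :=
  cx3 (@lin0_comp mod0 N mod0 \0).
Definition cx_left (M N : lmodType A) (f : {linear M -> N}) : cx :=
  cx3 (@lin0_comp M N mod0 f).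
Definition cx_right (N P : lmodType A) (g : {linear N -> P}) : cx :=
  cx3 (@lin_comp0 mod0 N P g).

Definition cx_zero : cx := cx_stalk mod0.

End Complexes.

(* D^b(A) is the localisation of the homotopy category of bounded complexes of
   finitely generated modules at the quasi-isomorphisms; its morphisms X -> Y are
   the roofs X <- Z -> Y modulo [roof_eq]. *)
Section Derived.

Variables (k : fieldType) (A : algType k).
Local Notation cx := (cx A).

Record roof (X Y : cx) := Roof {
  apex : cx;
  den : cxmap apex X;
  num : cxmap apex Y;
  apex_Db : is_Db apex;
  den_qi : quasi_iso den }.

Definition roof_eq (X Y : cx) (r r' : roof X Y) : Prop :=
  exists (W : cx) (s : cxmap W (apex r)) (s' : cxmap W (apex r')),
    [/\ is_Db W, quasi_iso (cxmap_comp (den r) s),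
        homotopic (cxmap_comp (den r) s) (cxmap_comp (den r') s') &
        homotopic (cxmap_comp (num r) s) (cxmap_comp (num r') s')].

Definition with_num (X Y Y' : cx) (r : roof X Y) (g : cxmap (apex r) Y') :
  roof X Y' := Roof g (apex_Db r) (den_qi r).

Definition roof_scale (X Y : cx) (c : k) (r : roof X Y) : roof X Y :=
  with_num (cxmap_scale c (num r)).

Definition is_roof_zero (X Y : cx) (r : roof X Y) : Prop :=
  roof_eq r (with_num (cxmap_zero (apex r) Y)).

(* r represents the image in D^b(A) of the chain map f. *)
Definition is_roof_of (X Y : cx) (f : cxmap X Y) (r : roof X Y) : Prop :=
  roof_eq r (with_num (cxmap_comp f (den r))).

(* r represents the sum of the classes of r1 and r2, computed over a common
   denominator. *)
Definition is_roof_sum (X Y : cx) (r1 r2 r : roof X Y) : Prop :=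
  exists (r0 : roof X Y) (g : cxmap (apex r0) Y),
    [/\ roof_eq r1 r0, roof_eq r2 (with_num g) &
        roof_eq r (with_num (cxmap_add (num r0) g))].

(* r represents the composite of the classes of r2 and r1 (r1 first), computed
   over a completion W of the two roofs to a square commuting up to homotopy. *)
Definition is_roof_comp (X Y Z : cx) (r2 : roof Y Z) (r1 : roof X Y)
    (r : roof X Z) : Prop :=
  exists (W : cx) (s : cxmap W (apex r1)) (f : cxmap W (apex r2))
         (WDb : is_Db W) (sqi : quasi_iso (cxmap_comp (den r1) s)),
    homotopic (cxmap_comp (num r1) s) (cxmap_comp (den r2) f)
    /\ roof_eq r (Roof (cxmap_comp (num r2) f) WDb sqi).

(* P is (the class of objects of) a thick triangulated subcategory of D^b(A). *)
Record thick (P : cx -> Prop) : Prop := Thick {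
  thick_Db : forall X, P X -> is_Db X;
  (* isomorphisms in D^b(A) are the roofs with both legs quasi-isomorphisms *)
  thick_qi : forall X Y (f : cxmap X Y), is_Db X -> is_Db Y -> quasi_iso f ->
    (P X <-> P Y);
  thick_zero : P (cx_zero A);
  thick_shift : forall X n, P X -> P (cx_shift X n);
  thick_cone : forall X Y (f : cxmap X Y), P X -> P Y -> P (cx_cone f);
  thick_summand : forall X Y, is_Db X -> is_Db Y -> P (cx_biprod X Y) -> P X }.

Definition tilting (T : cx) : Prop :=
  [/\ is_Db T,
      forall n : int, n != 0 -> forall r : roof T (cx_shift T n), is_roof_zero r
    & forall P, thick P -> P T -> forall X, is_Db X -> P X].

(* The endomorphism algebra of T in D^b(A) is isomorphic to B: phi is a map from
   B to representatives of endomorphisms that is a bijective k-algebra morphism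
   modulo [roof_eq]. *)
Definition End_isomorphic (B : algType k) (T : cx) : Prop :=
  exists phi : B -> roof T T,
    [/\ forall a b, is_roof_sum (phi a) (phi b) (phi (a + b)),
        forall (c : k) a, roof_eq (phi (c *: a)) (roof_scale c (phi a)),
        is_roof_of (cxmap_id T) (phi 1)
      & forall a b, is_roof_comp (phi a) (phi b) (phi (a * b))]
    /\ [/\ forall a b, roof_eq (phi a) (phi b) -> a = b
      & forall r, exists a, roof_eq (phi a) r].

End Derived.

Definition rel_quiver (V : finType) (e : rel V) : quiver :=
  @Quiver V {xy : V * V | e xy.1 xy.2} (fun a => (val a).1) (fun a => (val a).2).

(* Vertex i : 'I_n stands for the vertex i + 1 of 1 <- 2 <- ... <- n. *)
Definition nak_quiver (n : nat) : quiver :=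
  rel_quiver (fun i j : 'I_n => i == j.+1 :> nat).

Section Nakayama.

Variables (k : fieldType) (n r : nat) (n_gt0 : (0 < n)%N) (r_gt0 : (0 < r)%N).

Definition nak_rel (x : pathalg k (nak_quiver n)) : Prop :=
  exists2 p, plen p = r & x = pelt k p.

Lemma nak_rel_triv x : nak_rel x -> forall v, pcoef x (ptriv v) = 0.
Proof.
move=> [p Lp ->] v; rewrite pcoef_elt; case: eqP => // Ep.
by move: r_gt0; rewrite -Lp Ep.
Qed.

Definition nakayama : bound_quiver k :=
  @BoundQuiver k (nak_quiver n) nak_rel (Ordinal n_gt0) nak_rel_triv.

(* The idempotent of the vertex a, for 1 <= a <= n (and 0 for other a). *)
Definition nak_idem (a : nat) : bqalg nakayama :=
  \sum_(i < n | i.+1 == a) bqpi (pelt k (ptriv (i : vert nakayama))).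

Definition nak_inj (a : nat) : lmodType (bqalg nakayama) :=
  dual_mod (nak_idem a).

End Nakayama.

Section NakayamaHom.

Variables (k : fieldType) (n r : nat) (n_gt0 : (0 < n)%N) (r_gt0 : (0 < r)%N).
Local Notation N := (nakayama k n_gt0 r_gt0).

Lemma nak_path_len (p : qpath (nak_quiver n)) : (ptgt p + plen p)%N = psrc p.
Proof.
case: p => [[x s]]; rewrite /ptgt /plen /psrc /parrows /=.
elim: s x => [|a s IHs] x /=; first by rewrite addn0.
by case/andP=> /eqP Ex /IHs IH; rewrite addnS IH -Ex; apply/esym/eqP/(valP a).
Qed.

Lemma nak_sandwich (x : bqalg N) (i j : 'I_n) : (i + r)%N = j ->
  bqpi (pelt k (ptriv (i : vert N))) * x * bqpi (pelt k (ptriv (j : vert N))) = 0.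
Proof.
move=> Eij; rewrite -[x]bqpiK -[LHS]/(bqmul (bqmul _ _) _) -!bqpiM.
set ei := pelt k _; set ej := pelt k _.
apply: (@linear_ext _ _ (bqalg N) (fun x => bqpi (ei * x * ej)) (fun=> 0))
  => [c y z|c y z|p].
- by rewrite mulrDr mulrDl -pscaleAr -pscaleAl bqpiD bqpiZ.
- by rewrite scaler0 addr0.
rewrite -[ei * _]/(pmul ei _) pmulUU /pbasis pcomp1p; case: eqP => [Ei|_]; last first.
  by rewrite mul0r; apply: (raddf0 \pi_(bqalg N)).
rewrite -[_ * ej]/(pmul _ ej) pmulUU /pbasis pcompp1; case: eqP => [Ej|_]; last first.
  exact: (raddf0 \pi_(bqalg N)).
have -> : (0 : bqalg N) = bqpi 0 by apply/esym; apply: (raddf0 \pi_(bqalg N)).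
apply/bqpi_eq; rewrite subr0; apply/bq_idealP => J HJ; apply; exists p => //.
by apply/eqP; have /eqP := nak_path_len p; rewrite Ei Ej -Eij eqn_add2l.
Qed.

(* Hom(I_a, I_(a + r)) = 0 *)
Lemma nak_hom_eq0 (a b : nat) (h : {linear nak_inj k n_gt0 r_gt0 a ->
    nak_inj k n_gt0 r_gt0 b}) : (a + r)%N = b -> forall f, h f = 0.
Proof.
move=> Eab; apply: dual_mod_hom_eq0 => z.
rewrite /nak_idem mulr_suml mulr_suml big1 // => i /eqP Ei.
rewrite mulr_sumr big1 // => j /eqP Ej; apply: nak_sandwich.
by apply: succn_inj; rewrite Ej -Eab -Ei addSn.
Qed.

End NakayamaHom.

(* Vertices t_i, b_i (1 <= i <= u) and c_i (1 <= i <= v), with indices shifted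
   to start at 0. *)
Definition branch_vert (u v : nat) : finType := ('I_u + 'I_u + 'I_v)%type.

Section OneBranch.

Variables (k : fieldType) (u v : nat).

Definition vt (i : 'I_u) : branch_vert u v := inl (inl i).
Definition vb (i : 'I_u) : branch_vert u v := inl (inr i).
Definition vc (i : 'I_v) : branch_vert u v := inr i.

Definition branch_arrow (x y : branch_vert u v) : bool :=
  match x, y with
  | inl (inl i), inl (inl j) => j == i.+1 :> nat
  | inl (inr i), inl (inr j) => j == i.+1 :> nat
  | inl (inl i), inl (inr j) => i == j
  | inr i, inr j => j == i.+1 :> nat
  | inr i, inl (inl j) => (i.+1 == v) && (j == 0%N :> nat)
  | _, _ => false
  end.

Definition branch_quiver : quiver := rel_quiver branch_arrow.

Definition branch_rel (x : pathalg k branch_quiver) : Prop :=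
  exists (i j : 'I_u) (p q : qpath branch_quiver),
    [/\ j = i.+1 :> nat, ptrace p = [:: vt i; vt j; vb j],
        ptrace q = [:: vt i; vb i; vb j] & x = pelt k p - pelt k q].

Lemma branch_rel_triv x : branch_rel x -> forall w, pcoef x (ptriv w) = 0.
Proof.
move=> [i [j [p [q [_ Tp Tq ->]]]]] w; rewrite -scaleN1r pcoefD pcoefZ !pcoef_elt.
case: eqP => [Ep|_]; first by rewrite Ep in Tp.
by case: eqP => [Eq|_]; [rewrite Eq in Tq | rewrite mulr0 addr0].
Qed.

Definition one_branch (u_gt0 : (0 < u)%N) : bound_quiver k :=
  @BoundQuiver k branch_quiver branch_rel (vt (Ordinal u_gt0)) branch_rel_triv.

End OneBranch.

Section TiltingComplex.

Variables (k : fieldType) (u v : nat) (v_gt0 : (0 < v)%N).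

Lemma nak_n_gt0 : (0 < 2 * u + v)%N.
Proof. by rewrite addn_gt0 v_gt0 orbT. Qed.

Lemma nak_r_gt0 : (0 < u + v + 1)%N.
Proof. by rewrite addn1. Qed.

Definition nakB : bound_quiver k := nakayama k nak_n_gt0 nak_r_gt0.
Definition InjI (a : nat) : lmodType (bqalg nakB) := nak_inj k nak_n_gt0 nak_r_gt0 a.

Lemma InjI_comp_eq0 (l : nat) (g : {linear InjI l -> InjI u})
    (h : {linear InjI u -> InjI (u + v + 1 + l)}) x : h (g x) = 0.
Proof. by apply: (@nak_hom_eq0 _ _ _ _ _ l _ (h \o g)); rewrite addnC. Qed.

Variables (e : forall i, {linear InjI i -> InjI u}) (f : forall j, {linear InjI u -> InjI j}).
Variables (g : forall l, {linear InjI l -> InjI u}).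
Variable h : forall l, {linear InjI u -> InjI (u + v + 1 + l)}.

Definition cxE (i : nat) : cx (bqalg nakB) := cx_left (e i).
Definition cxF (j : nat) : cx (bqalg nakB) := cx_right (f j).
Definition cxG (l : nat) : cx (bqalg nakB) := cx3 (@InjI_comp_eq0 l (g l) (h l)).

Definition vT : cx (bqalg nakB) :=
  cx_biprod (cx_stalk (InjI u))
 (cx_biprod (\big[@cx_biprod _ _/cx_zero _]_(1 <= i < u) cxE i)
 (cx_biprod (\big[@cx_biprod _ _/cx_zero _]_(u.+1 <= j < u + v + 2) cxF j)
            (\big[@cx_biprod _ _/cx_zero _]_(1 <= l < u) cxG l))).

End TiltingComplex.

(* Main.v *)
Require Import Defs.
From HB Require Import structures.
From mathcomp Require Import all_boot all_order all_algebra.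
From mathcomp Require Import boolp zify generic_quotient ring_quotient.

Set Implicit Arguments.
Unset Strict Implicit.
Unset Printing Implicit Defensive.

Import Order.TTheory GRing.Theory Num.Theory.
Local Open Scope ring_scope.
Local Open Scope quotient_scope.

(** Every summand of the complex T has the shape C(a, b) = (I_a -> I_u -> I_b),
    with I_u in degree 0, where 0 <= a < u < b <= n + 1 and n = 2u + v; the left
    term is zero for a = 0 and the right term is zero for b = n + 1.  Indeed I_u is
    C(0, n + 1), E'_i is C(i, n + 1), F'_j is C(0, j) and G'_l is
    C(l, u + v + 1 + l).  Everything rests on the maps between the I_a: with
    r = u + v + 1, Hom(I_a, I_b) has dimension one for a <= b < a + r and vanishes
    otherwise, and a composite I_a -> I_b -> I_c of nonzero maps is nonzero when
    c < a + r ([hom_shape], [hom_comp_neq0]).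

    Morphisms.  A chain map C(a, b) -> C(a', b') is determined by the scalar by
    which it acts on I_u, a nonzero scalar occurs exactly for a <= a' and b <= b',
    and there are no homotopies because Hom(I_u, I_a) = Hom(I_b, I_u) = 0.  So the
    chain maps from T to T up to homotopy form the incidence algebra of the poset of
    pairs (a, b).  This poset is the set of vertices of the quiver of the one-branch
    extension, ordered by the existence of paths: t_(i+1) is (i, u + v + 1 + i),
    b_(i+1) is (i, n + 1) and c_(i+1) is (0, u + 1 + i).  Parallel paths of that
    quiver are congruent modulo the commutativity relations ([branch_par]), so its
    algebra is the same incidence algebra ([branch_count_inj],
    [branch_count_surj]).  Chain maps from C(a, b) to a nonzero shift of C(a', b')
    are null-homotopic ([tri_shift_null]); the main case is the shift by 1, see
    [tri_shift1].

    From chain maps to the derived category.  A chain map from an acyclic complex to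
    a bounded below complex of injectives is null-homotopic ([acyclic_null]).  For
    the cone of a quasi-isomorphism this says that roofs into T are homotopy classes
    of chain maps ([roof_map], [map_roof_inj]).

    Generation.  Let P be a thick subcategory that contains T.  It contains the
    summands, and by two-out-of-three in short exact sequences of complexes it
    contains every I_a ([thick_I]).  It then contains the simple modules, by
    downward induction on the vertex: the socle of I_a is the simple module S_a, and
    I_a / S_a is filtered by the S_b with b > a ([thick_zchar]).  Hence it contains
    all finitely generated modules, which are filtered by simple ones, and all
    bounded complexes, by truncation ([thick_all]). *)

(** * Families indexed by degrees *)
Lemma int_succ_ind (Q : int -> Prop) : (forall i, Q (i + 1)) -> forall i, Q i.
Proof. by move=> HQ i; rewrite -[i](subrK 1); apply: HQ. Qed.

(** Homotopies and quasi-isomorphisms are stated in the degrees i + 1.  A family over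
    these degrees gives one over all degrees by transport along i - 1 + 1 = i, done
    here once and for all. *)
Lemma reindex_succ (T : int -> Type) (F : forall i, T (i + 1)) :
  exists F' : forall i, T i, forall i, F' (i + 1) = F i.
Proof.
have E (i : int) : i - 1 + 1 = i by rewrite subrK.
exists (fun i => eq_rect _ T (F (i - 1)) _ (E i)) => i.
suff H j (Ej : j = i) (e : j + 1 = i + 1) : eq_rect _ T (F j) _ e = F i by apply: H;
  rewrite addrK.
by case: _ / Ej e => e; rewrite (eq_irrelevance e erefl).
Qed.

(** Dependent choice upwards from the degree lo, under an invariant; below lo the
    default family is used. *)
Section IntChain.
Variables (T : int -> Type) (Inv : forall i, T i -> Prop).
Variables (R : forall i, T i -> T (i + 1) -> Prop) (lo : int) (z : forall i, T i).
Arguments Inv : clear implicits.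
Arguments R : clear implicits.

Lemma int_chain :
  (forall i, i < lo -> R i (z i) (z (i + 1))) -> Inv lo (z lo) ->
  (forall i t, Inv i t -> exists2 t', R i t t' & Inv (i + 1) t') ->
  exists f : forall i, T i, forall i, R i (f i) (f (i + 1)).
Proof.
move=> Rz Iz step.
have [st stP] : exists st : forall i, T i -> T (i + 1),
    forall i t, Inv i t -> R i t (st i t) /\ Inv (i + 1) (st i t).
  have H i (t : T i) : exists t', Inv i t -> R i t t' /\ Inv (i + 1) t'.
    have [It|nIt] := pselect (Inv i t); first by have [t'] := step i t It; exists t'.
    by exists (z (i + 1)).
  exists (fun i t => sval (cid (H i t))) => i t.
  by case: (cid (H i t)).
(* In the degrees lo + 1 + ... + 1 the successor is definitional, so the recursion
   needs no transport. *)
pose fix lo_ (m : nat) : int := if m is m'.+1 then lo_ m' + 1 else lo.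
pose fix g (m : nat) : T (lo_ m) :=
  match m with 0%N => z lo | m'.+1 => st (lo_ m') (g m') end.
have loE m : lo_ m = lo + m%:Z.
  by elim: m => [|m IH] /=; rewrite ?addr0 // IH -addrA -PoszD addn1.
have gI m : Inv (lo_ m) (g m) by elim: m => //= m /stP[].
have E i : lo <= i -> lo_ `|i - lo|%N = i.
  by move=> le; rewrite loE gez0_abs ?subr_ge0 // addrCA subrr addr0.
pose f i : T i := match pselect (lo <= i) with
  | left le => eq_rect _ T (g `|i - lo|%N) _ (E i le)
  | right _ => z i end.
have fg m : f (lo_ m) = g m.
  rewrite /f; case: pselect => [le|[]]; last by rewrite loE lerDl.
  move: (E _ le) => {le}.
  suff H m' (Em : m' = m) (e : lo_ m' = lo_ m) : eq_rect _ T (g m') _ e = g m.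
    by apply: H; rewrite loE addrAC subrr add0r.
  by case: _ / Em e => e; rewrite (eq_irrelevance e erefl).
have fz i : i < lo -> f i = z i.
  by move=> lt; rewrite /f; case: pselect => // le; move: lt; rewrite ltNge le.
exists f => i; have [lt|le] := ltP i lo; last first.
  rewrite -(E i le); move: `|i - lo|%N => m.
  by rewrite fg -[lo_ m + 1]/(lo_ m.+1) fg /=; case: (stP _ _ (gI m)).
rewrite fz //; have [lt1|le1] := ltP (i + 1) lo; first by rewrite fz //; apply: Rz.
have Elo : i + 1 = lo by apply/eqP; rewrite eq_le le1 andbT lezD1.
suff -> : f (i + 1) = z (i + 1) by apply: Rz.
by rewrite Elo; apply: (fg 0%N).
Qed.
End IntChain.

(** * Scalars, homotopies and injective modules *)
Section Scalars.
Variables (k : fieldType) (A : algType k).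

Lemma kscale_comm (M : lmodType A) (c : k) (a : A) (x : M) :
  a *: ((c%:A : A) *: x) = (c%:A : A) *: (a *: x).
Proof. by rewrite !scalerA -scalerAr mulr1 -scalerAl mul1r. Qed.

Definition khom (c : k) (M N : lmodType A) (f : {linear M -> N}) : {linear M -> N} :=
  mk_linear (kscale_subproof c f).

Lemma khomE (c : k) (M N : lmodType A) (f : {linear M -> N}) x : khom c f x = (c%:A : A) *: f x.
Proof. by []. Qed.

Lemma linear_kscale (M N : lmodType A) (f : {linear M -> N}) (c : k) x :
  f ((c%:A : A) *: x) = (c%:A : A) *: f x.
Proof. by rewrite linearZ. Qed.

Lemma kscaleA (M : lmodType A) (c d : k) (x : M) :
  (c%:A : A) *: ((d%:A : A) *: x) = ((c * d)%:A : A) *: x.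
Proof. by rewrite scalerA -scalerAl mul1r scalerA. Qed.

Lemma kscaleDl (M : lmodType A) (c d : k) (x : M) :
  ((c + d)%:A : A) *: x = (c%:A : A) *: x + (d%:A : A) *: x.
Proof. by rewrite !scalerDl. Qed.

Lemma kscaleNl (M : lmodType A) (c : k) (x : M) :
  ((- c)%:A : A) *: x = - ((c%:A : A) *: x).
Proof. by rewrite !scaleNr. Qed.

Lemma kscale1 (M : lmodType A) (x : M) : ((1%:A) : A) *: x = x.
Proof. by rewrite !scale1r. Qed.

Lemma kscale0 (M : lmodType A) (x : M) : (((0 : k)%:A) : A) *: x = 0.
Proof. by rewrite !scale0r. Qed.

Lemma kscale_eq0 (M : lmodType A) (c : k) (x : M) :
  c != 0 -> (c%:A : A) *: x = 0 -> x = 0.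
Proof.
move=> nc /(congr1 (fun y => ((c^-1)%:A : A) *: y)).
by rewrite scaler0 kscaleA mulVf // kscale1.
Qed.

End Scalars.

Section Homotopies.
Variables (k : fieldType) (A : algType k).
Local Notation cx := (cx A).
Implicit Types X Y Z W : cx.

Definition cxmap_eq X Y (f g : cxmap X Y) := forall i x, f i x = g i x.

Definition null_homotopic X Y (f : cxmap X Y) : Prop :=
  exists h : forall i : int, {linear X (i + 1) -> Y i}, forall (i : int) x,
    f (i + 1) x = cx_d Y i (h i x) + h (i + 1) (cx_d X (i + 1) x).

(** Homotopy is additive, so that only null-homotopies have to be built. *)
Lemma homotopicP X Y (f g : cxmap X Y) :
  homotopic f g <-> null_homotopic (cxmap_add f (cxmap_scale (-1) g)).
Proof.
by split=> -[h H]; exists h => i x; rewrite -H /= kscaleNl kscale1.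
Qed.

Lemma null_eq X Y (f g : cxmap X Y) : cxmap_eq f g -> null_homotopic f -> null_homotopic g.
Proof. by move=> E [h H]; exists h => i x; rewrite -E. Qed.

Lemma null_zero X Y (f : cxmap X Y) : (forall i x, f i x = 0) -> null_homotopic f.
Proof. by move=> E; exists (fun i => \0) => i x; rewrite E /= raddf0 addr0. Qed.

Lemma null_add X Y (f g : cxmap X Y) : null_homotopic f -> null_homotopic g ->
  null_homotopic (cxmap_add f g).
Proof.
move=> [h H] [h' H']; exists (fun i => h i \+ h' i) => i x.
by rewrite /= H H' raddfD addrACA.
Qed.

Lemma null_scale X Y c (f : cxmap X Y) : null_homotopic f -> null_homotopic (cxmap_scale c f).
Proof.
move=> [h H]; exists (fun i => khom c (h i)) => i x.
by rewrite /= H scalerDr linear_kscale.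
Qed.

Lemma null_compl X Y Z (g : cxmap Y Z) (f : cxmap X Y) : null_homotopic f ->
  null_homotopic (cxmap_comp g f).
Proof.
move=> [h H]; exists (fun i => g i \o h i) => i x.
by rewrite /= H raddfD /= cxmap_d.
Qed.

Lemma null_compr X Y Z (g : cxmap Y Z) (f : cxmap X Y) : null_homotopic g ->
  null_homotopic (cxmap_comp g f).
Proof.
move=> [h H]; exists (fun i => h i \o f (i + 1)) => i x.
by rewrite /= H cxmap_d.
Qed.

Lemma homotopic_eq X Y (f g : cxmap X Y) : cxmap_eq f g -> homotopic f g.
Proof.
by move=> E; exists (fun i => \0) => i x; rewrite E subrr /= raddf0 addr0.
Qed.

Lemma homotopic_sym X Y (f g : cxmap X Y) : homotopic f g -> homotopic g f.
Proof.
move=> /homotopicP/(null_scale (-1)) H; apply/homotopicP; apply: null_eq H => i x /=.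
by rewrite !kscaleNl !kscale1 opprD opprK addrC.
Qed.

Lemma homotopic_trans X Y (f g h : cxmap X Y) :
  homotopic f g -> homotopic g h -> homotopic f h.
Proof.
move=> /homotopicP H /homotopicP H'; apply/homotopicP.
by apply: null_eq (null_add H H') => i x /=; rewrite !kscaleNl !kscale1 addrA subrK.
Qed.

End Homotopies.

Section FunctionalExtension.
Variables (k : fieldType) (A : algType k).

Definition kfunctional (M : lmodType A) (p : M -> k) :=
  forall c x y, p ((c%:A : A) *: x + y) = c * p x + p y.

(** A functional on a subspace is encoded by its graph G: extending it by one vector
    of the spanning family then changes G alone.  If the vector is already in the
    domain nothing is done; otherwise it is given the value 0. *)
Lemma extend_functional (W : lmodType A) (I : Type) (v : I -> W) (s : seq I)
    (G : W -> k -> Prop) :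
  (forall c x y a b, G x a -> G y b -> G ((c%:A : A) *: x + y) (c * a + b)) ->
  (forall a, G 0 a -> a = 0) ->
  (forall w, exists w0 d (c : I -> k),
     G w0 d /\ w = w0 + \sum_(i <- s) ((c i)%:A : A) *: v i) ->
  exists2 p : W -> k, kfunctional p & forall w d, G w d -> p w = d.
Proof.
elim: s G => [|i s IH] G lG G0 tG.
  have tot w : exists d, G w d.
    by have [w0 [d [c [H ->]]]] := tG w; exists d; rewrite big_nil addr0.
  have uniG w d d' : G w d -> G w d' -> d = d'.
    move=> H H'; apply/eqP; rewrite -subr_eq0; apply/eqP/G0.
    have := lG (-1) _ _ _ _ H' H.
    by rewrite kscaleNl kscale1 addNr mulN1r addrC.
  exists (fun w => sval (cid (tot w))) => [c x y|w d H].
    case: (cid (tot _)) => /= d H; case: (cid (tot x)) => /= a Ha.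
    case: (cid (tot y)) => /= b Hb; apply: uniG H _; exact: lG.
  by case: (cid (tot w)) => /= d' H'; apply: uniG H' H.
have [[d Hd]|nv] := pselect (exists d, G (v i) d).
  apply: IH => // w; have [w0 [a [c [H ->]]]] := tG w.
  exists (((c i)%:A : A) *: v i + w0), (c i * d + a), c; split; first exact: lG.
  by rewrite big_cons addrCA addrA.
pose G' w d := exists c, G (w - (c%:A : A) *: v i) d.
have [c x y a b|a [c H]|w|p lp Hp] := IH G'.
- move=> [e H] [e' H']; exists (c * e + e').
  have := lG c _ _ _ _ H H'; congr (G _ _).
  by rewrite scalerBr kscaleA kscaleDl opprD addrACA.
- have [c0|nc] := eqVneq c 0; first by apply: G0; rewrite c0 kscale0 subr0 in H.
  case: nv; exists (- c^-1 * a + (-1) * (- c^-1 * a) + - c^-1 * a).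
  have H0 : G 0 0.
    by have := lG (-1) _ _ _ _ H H; rewrite kscaleNl kscale1 mulN1r !addNr.
  have := lG (- c^-1) _ _ _ _ H H0; rewrite sub0r -kscaleNl kscaleA mulrNN mulVf // kscale1.
  by rewrite !addr0 mulN1r addrN add0r.
- have [w0 [d [c [H ->]]]] := tG w.
  exists (w0 + ((c i)%:A : A) *: v i), d, c; split; last by rewrite big_cons addrA.
  by exists (c i); rewrite addrK.
exists p => // w d H; apply: Hp; exists 0; by rewrite kscale0 subr0.
Qed.

Definition k_spanned (M : lmodType A) := exists (I : finType) (v : I -> M),
  forall x, exists c : I -> k, x = \sum_i ((c i)%:A : A) *: v i.

Definition fin_dim := exists (I : finType) (v : I -> A),
  forall x, exists c : I -> k, x = \sum_i c i *: v i.

Lemma fin_gen_k_spanned (M : lmodType A) : fin_dim -> fin_gen M -> k_spanned M.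
Proof.
move=> [I [v Hv]] [n [g Hg]]; exists ('I_n * I)%type, (fun p => v p.2 *: g p.1) => x.
have [a ->] := Hg x; have /choice[c Hc] : forall j, exists c : I -> k, a j = \sum_i c i *: v i.
  by move=> j; apply: Hv.
exists (fun p => c p.1 p.2);
  rewrite -(pair_bigA _ (fun j i => ((c j i)%:A : A) *: (v i *: g j))) /=.
apply: eq_bigr => j _; rewrite {1}Hc scaler_suml; apply: eq_bigr => i _.
by rewrite scalerA -scalerAl mul1r.
Qed.

(** Only finitely generated W are considered: these are the modules of bounded derived
    categories, and for them functionals extend without a maximality argument. *)
Definition injective_mod (Y : lmodType A) := forall (V W : lmodType A) (f : {linear V -> W})
  (g : {linear V -> Y}), fin_gen W -> (forall x, f x = 0 -> g x = 0) ->
  exists h : {linear W -> Y}, forall x, h (f x) = g x.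

(** A map into D(eA) amounts to a k-linear functional, its value at 1.  So extending
    maps into D(eA) amounts to extending functionals. *)
Lemma dual_injective (e : A) : fin_dim -> e * e = e -> injective_mod (dual_mod e).
Proof.
move=> Afd ee V W f g /(fin_gen_k_spanned Afd)[I [v Hv]] fg.
(* The functional induced by g on the image of f. *)
pose G w (d : k) := exists2 x, w = f x & d = g x 1.
have [c x y a b|a|w|p lp Hp] := @extend_functional W I v (index_enum I) G.
- move=> [x' -> ->] [y' -> ->]; exists ((c%:A : A) *: x' + y'); first by rewrite linearP.
  rewrite linearP -[RHS]/(g x' (1 * c%:A) + g y' 1) mul1r.
  by rewrite dual_funZ.
- by move=> [x /esym/fg -> ->].
- have [c E] := Hv w; exists 0, 0, c; split; last by rewrite add0r.
  by exists 0; rewrite raddf0.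
have p0 : p 0 = 0 by have := lp (-1) 0 0; rewrite scaler0 add0r mulN1r addNr.
have pZ c x : p ((c%:A : A) *: x) = c * p x by rewrite -[_ *: x]addr0 lp p0 addr0.
have pD x y : p (x + y) = p x + p y by rewrite -[x in LHS]kscale1 lp mul1r.
have dualw w : is_dual e (fun y => p ((e * y) *: w)).
  apply/asboolP; split=> [c x y|y]; last by rewrite mulrA ee.
  by rewrite mulrDr scalerDl pD -scalerAr -pZ scalerA -scalerAl mul1r.
have lh : linear (fun w => DualMod (dualw w)).
  move=> a x y; apply: dual_mod_ext => b.
  change (p ((e * b) *: (a *: x + y)) = p ((e * (b * a)) *: x) + p ((e * b) *: y)).
  by rewrite scalerDr pD scalerA mulrA.
exists (mk_linear lh) => x; apply: dual_mod_ext => y.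
change (p ((e * y) *: f x) = g x y); rewrite -linearZ (Hp _ (g ((e * y) *: x) 1)); last first.
  by exists ((e * y) *: x).
rewrite linearZ -[LHS]/(g x (1 * (e * y))) mul1r.
by have [_ ->] := dual_modP (g x).
Qed.

Lemma zero_injective (Y : lmodType A) : (forall y : Y, y = 0) -> injective_mod Y.
Proof. by move=> Y0 V W f g _ _; exists \0 => x; rewrite [RHS]Y0. Qed.

End FunctionalExtension.

Section Resolution.
Variables (k : fieldType) (A : algType k).
Local Notation cx := (cx A).
Implicit Types X Y Z W : cx.

Definition acyclic W := forall (i : int) (x : W (i + 1)),
  cx_d W (i + 1) x = 0 -> exists x', x = cx_d W i x'.

Definition bdd_below_inj Y :=
  (forall i, injective_mod (Y i)) /\ exists lo : int, forall i, i <= lo -> forall y : Y i, y = 0.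

(** The null-homotopy is built degree by degree: once h is known, f - d h vanishes on
    cycles, which are boundaries, so it factors through the differential, and by
    injectivity the factor extends to the next degree. *)
Lemma acyclic_null W Y (f : cxmap W Y) :
  acyclic W -> (forall i, fin_gen (W i)) -> bdd_below_inj Y -> null_homotopic f.
Proof.
move=> acW fW [injY [lo Y0]].
have [|x|i h Ih|h Hh] := @int_chain (fun i => {linear W (i + 1) -> Y i})
  (fun i h => forall x, cx_d W (i + 1) x = 0 -> f (i + 1) x - cx_d Y i (h x) = 0)
  (fun i h h' => forall x, f (i + 1) x = cx_d Y i (h x) + h' (cx_d W (i + 1) x))
  (lo - 1) (fun i => \0).
- move=> i lti x; rewrite /= raddf0 addr0; apply: Y0.
  by move: lti; rewrite ltrBrDr => /ltW.
- by move=> _; apply: Y0; rewrite subrK.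
- pose g : {linear W (i + 1) -> Y (i + 1)} := f (i + 1) \- (cx_d Y i \o h).
  have [h' Hh'] := injY (i + 1) _ _ (cx_d W (i + 1)) g (fW _) Ih.
  exists h' => [x|x dx0]; first by rewrite Hh' /= addrCA subrr addr0.
  have [x' ->] := acW _ _ dx0.
  by rewrite cxmap_d -[h' _]/(h' (cx_d W (i + 1) x')) Hh' -raddfB /= opprB addrCA subrr addr0
    cx_dd.
by exists h.
Qed.

End Resolution.

(** * Mapping cones and roofs *)
Section ProductMaps.
Variables (k : fieldType) (A : algType k) (M N : lmodType A).

Lemma lin_inl_subproof : linear (fun x : M => (x, 0) : (M * N)%type).
Proof. by move=> a x y; congr (_, _) => /=; rewrite scaler0 addr0. Qed.
Lemma lin_inr_subproof : linear (fun y : N => (0, y) : (M * N)%type).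
Proof. by move=> a x y; congr (_, _) => /=; rewrite scaler0 addr0. Qed.
Lemma lin_fst_subproof : linear (fun p : (M * N)%type => p.1).
Proof. by []. Qed.
Lemma lin_snd_subproof : linear (fun p : (M * N)%type => p.2).
Proof. by []. Qed.
Definition lin_inl : {linear M -> (M * N)%type} := mk_linear lin_inl_subproof.
Definition lin_inr : {linear N -> (M * N)%type} := mk_linear lin_inr_subproof.
Definition lin_fst : {linear (M * N)%type -> M} := mk_linear lin_fst_subproof.
Definition lin_snd : {linear (M * N)%type -> N} := mk_linear lin_snd_subproof.

Lemma fin_gen_prod : fin_gen M -> fin_gen N -> fin_gen ((M * N)%type : lmodType A).
Proof.
move=> [m [g Hg]] [n [h Hh]].
exists (m + n)%N, (fun i => match split i with inl j => (g j, 0) | inr j => (0, h j) end).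
move=> [x y]; have [a ->] := Hg x; have [b ->] := Hh y.
exists (fun i => match split i with inl j => a j | inr j => b j end).
rewrite big_split_ord /=.
have Sl i : split (lshift n i : 'I_(m + n)) = inl i := unsplitK (inl i).
have Sr i : split (rshift m i : 'I_(m + n)) = inr i := unsplitK (inr i).
transitivity (lin_inl (\sum_(i < m) a i *: g i) + lin_inr (\sum_(i < n) b i *: h i)).
  by congr (_, _) => /=; rewrite ?addr0 ?add0r.
rewrite !raddf_sum; congr (_ + _); apply: eq_bigr => i _.
  by rewrite Sl /=; congr (_, _) => /=; rewrite scaler0.
by rewrite Sr /=; congr (_, _) => /=; rewrite scaler0.
Qed.

Lemma fin_gen_zero : (forall x : M, x = 0) -> fin_gen M.
Proof. by move=> M0; exists 0%N, (fun=> 0) => x; exists (fun=> 0); rewrite big_ord0;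
  apply: M0. Qed.

End ProductMaps.

Section QuasiIsomorphisms.
Variables (k : fieldType) (A : algType k).
Local Notation cx := (cx A).
Implicit Types X Y Z W : cx.

Lemma cx_tr_id X (i : int) (e : i = i) (x : X i) : cx_tr X e x = x.
Proof. by rewrite (eq_irrelevance e erefl). Qed.

Lemma shift1_d X (i : int) (x : cx_shift X 1 i) :
  cx_d (cx_shift X 1) i x = - cx_d X (i + 1) x.
Proof. by rewrite /= cx_tr_id expr1 scaleN1r. Qed.

Lemma cone_acyclic X Y (f : cxmap X Y) : quasi_iso f -> acyclic (cx_cone f).
Proof.
move=> qf i [x y] [/eqP]; rewrite oppr_eq0 => /eqP dx0 fxdy.
have Efx : f (i + 1 + 1) x = cx_d Y (i + 1) (- y).
  by rewrite raddfN; apply/eqP; rewrite -addr_eq0; apply/eqP.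
have [x' Ex] := (qf (i + 1)).1 x dx0 (ex_intro _ (- y) Efx).
have dy0 : cx_d Y (i + 1) (y + f (i + 1) x') = 0.
  by rewrite raddfD /= -cxmap_d -Ex [LHS]addrC.
have [x'' [y'' [dx''0 Ey]]] := (qf i).2 _ dy0.
exists (x'' - x', y''); congr (_, _) => /=.
  by rewrite raddfB /= dx''0 sub0r opprK.
by rewrite raddfB /= addrAC -Ey addrK.
Qed.

Lemma cone_fg X Y (f : cxmap X Y) : (forall i, fin_gen (X i)) -> (forall i, fin_gen (Y i)) ->
  forall i, fin_gen (cx_cone f i).
Proof. by move=> fX fY i; apply: fin_gen_prod. Qed.

Section Along.
Variables (Z X : cx) (s : cxmap Z X).
Hypotheses (qs : quasi_iso s) (fZ : forall i, fin_gen (Z i)) (fX : forall i, fin_gen (X i)).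

(** If h is a null-homotopy of g s, then (z, x) |-> g x + h z is a chain map from the
    cone of s, and a null-homotopy of it restricts to one of g. *)
Lemma qi_cancel Y (g : cxmap X Y) : bdd_below_inj Y -> null_homotopic (cxmap_comp g s) ->
  null_homotopic g.
Proof.
move=> bY [h Hh].
pose w (i : int) : {linear cx_cone s i -> Y i} :=
  (g i \o lin_snd (Z (i + 1)) (X i)) \+ (h i \o lin_fst (Z (i + 1)) (X i)).
have wd i p : w (i + 1) (cx_d (cx_cone s) i p) = cx_d Y i (w i p).
  case: p => z x; rewrite /w /= 2!raddfD /= !raddfN /=.
  have -> : g (i + 1) (s (i + 1) z) = cxmap_comp g s (i + 1) z by [].
  rewrite Hh /= cxmap_d -!addrA [RHS]addrC; congr (_ + _).
  by rewrite addrCA subrr addr0.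
have [H HH] := @acyclic_null k A _ _ (CxMap wd) (cone_acyclic qs) (cone_fg s fZ fX) bY.
exists (fun i => H i \o lin_inr (Z (i + 1 + 1)) (X (i + 1))) => i x.
have := HH i (0, x); rewrite /w /= raddf0 addr0 => ->; congr (_ + H _ _).
by congr (_, _); rewrite !raddf0 ?oppr0 ?add0r.
Qed.

(** The chain map (z, x) |-> f z from the cone of s to Y[1] is null-homotopic.  On the
    second component the null-homotopy is a chain map g, and on the first it is a
    homotopy between g s and f. *)
Lemma qi_factor Y (f : cxmap Z Y) : bdd_below_inj Y ->
  exists g : cxmap X Y, homotopic (cxmap_comp g s) f.
Proof.
move=> [injY [lo Y0]].
pose w (i : int) : {linear cx_cone s i -> cx_shift Y 1 i} :=
  f (i + 1) \o lin_fst (Z (i + 1)) (X i).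
have wd i p : w (i + 1) (cx_d (cx_cone s) i p) = cx_d (cx_shift Y 1) i (w i p).
  by case: p => z x; rewrite shift1_d /w /= raddfN /= cxmap_d.
have bY1 : bdd_below_inj (cx_shift Y 1).
  split=> [i|]; first exact: injY.
  by exists (lo - 1) => i le; apply: Y0; rewrite -lerBrDr.
have [H HH] := @acyclic_null k A _ _ (CxMap wd) (cone_acyclic qs) (cone_fg s fZ fX) bY1.
have E (i : int) z x : f (i + 1 + 1) z =
  H (i + 1) (- cx_d Z (i + 1 + 1) z, s (i + 1 + 1) z + cx_d X (i + 1) x)
    - cx_d Y (i + 1) (H i (z, x)).
  by have := HH i (z, x); rewrite shift1_d => Ei; rewrite [RHS]addrC; apply: Ei.
have [G GE] := @reindex_succ (fun i => {linear X i -> Y i})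
  (fun i => (H i \o lin_inr (Z (i + 1 + 1)) (X (i + 1)) : {linear X (i + 1) -> Y (i + 1)})).
have [K KE] := @reindex_succ (fun i => {linear Z (i + 1) -> Y i})
  (fun i => (H i \o lin_inl (Z (i + 1 + 1)) (X (i + 1)) : {linear Z (i + 1 + 1) -> Y (i + 1)})).
have Gd i x : G (i + 1) (cx_d X i x) = cx_d Y i (G i x).
  move: i x; apply: int_succ_ind => i x; rewrite !GE /=.
  apply/eqP; rewrite -subr_eq0; apply/eqP; have := E i 0 x.
  by rewrite (raddf0 (f _)) (raddf0 (cx_d Z _)) (raddf0 (s _)) oppr0 add0r => <-.
exists (CxMap Gd), K; apply: int_succ_ind => i z /=; rewrite !GE !KE /= (E i z 0).
rewrite raddf0 addr0 opprB addrCA; congr (_ + _).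
rewrite -raddfB; congr (H (i + 1) _); congr (_, _) => /=; first by rewrite sub0r opprK.
by rewrite subrr.
Qed.

End Along.
End QuasiIsomorphisms.

Section Roofs.
Variables (k : fieldType) (A : algType k).
Local Notation cx := (cx A).
Implicit Types X Y Z W : cx.

Lemma iso_quasi_iso X Y (f : cxmap X Y) : (forall i, injective (f i)) ->
  (forall i y, exists x, f i x = y) -> quasi_iso f.
Proof.
move=> injf surf i; split=> [x dx0 [y E]|y dy0].
  have [x' Ex'] := surf _ y; exists x'; apply: (injf (i + 1)).
  by rewrite E cxmap_d Ex'.
have [x Ex] := surf _ y; exists x, 0; split; last by rewrite Ex raddf0 addr0.
by apply: (injf (i + 1 + 1)); rewrite cxmap_d Ex dy0 raddf0.
Qed.

Lemma id_quasi_iso X : quasi_iso (cxmap_id X).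
Proof. by apply: iso_quasi_iso => [i x y //|i y]; exists y. Qed.

Definition map_roof X Y (f : cxmap X Y) (DbX : is_Db X) : roof X Y :=
  Roof f DbX (id_quasi_iso X).

Lemma roof_eq_num X Y (r : roof X Y) (f : cxmap (apex r) Y) :
  homotopic (num r) f -> roof_eq r (with_num f).
Proof.
move=> Hf; exists (apex r), (cxmap_id _), (cxmap_id _); split=> //=.
- exact: apex_Db.
- exact: den_qi.
- exact: homotopic_eq.
Qed.

Lemma map_roof_eq X Y (f g : cxmap X Y) (D D' : is_Db X) :
  homotopic f g -> roof_eq (map_roof f D) (map_roof g D').
Proof.
move=> Hfg; exists X, (cxmap_id _), (cxmap_id _); split=> //=.
- exact: id_quasi_iso.
- exact: homotopic_eq.
Qed.

Section ToInjective.
Variables (X Y : cx) (DX : is_Db X) (iY : bdd_below_inj Y).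

Lemma roof_map (r : roof X Y) : exists2 g : cxmap X Y,
  homotopic (cxmap_comp g (den r)) (num r) & roof_eq (map_roof g DX) r.
Proof.
have [g Hg] := qi_factor (@den_qi _ _ _ _ r) (apex_Db r).2 DX.2 (num r) iY.
exists g => //; exists (apex r), (den r), (cxmap_id _); split=> //=.
- exact: apex_Db.
- exact: den_qi.
- exact: homotopic_eq.
Qed.

Lemma roof_zero : (forall g : cxmap X Y, null_homotopic g) -> forall r : roof X Y, is_roof_zero r.
Proof.
move=> H r; have [g Hg _] := roof_map r; apply: roof_eq_num.
apply: homotopic_trans (homotopic_sym Hg) _; apply/homotopicP.
apply: null_eq (null_compr (den r) (H g)) => i x /=.
by rewrite scaler0 addr0.
Qed.

Lemma map_roof_inj (f g : cxmap X Y) (D D' : is_Db X) :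
  roof_eq (map_roof f D) (map_roof g D') -> null_homotopic (cxmap_add f (cxmap_scale (-1) g)).
Proof.
move=> [W [s [s' [DW qs /homotopicP Hs /homotopicP Hfg]]]].
apply: (qi_cancel qs DW.2 DX.2 iY).
have H := null_scale (-1) (null_compl g Hs).
apply: null_eq (null_add Hfg H) => i x /=.
by rewrite !kscaleNl !kscale1 raddfB /= opprB addrA subrK.
Qed.
End ToInjective.

(** All roofs are represented with the identity as denominator, so that the algebra
    structure of the derived endomorphisms becomes that of chain maps. *)
Lemma End_isomorphicP (B : algType k) (T : cx) (F : B -> cxmap T T) :
  is_Db T -> bdd_below_inj T ->
  (forall a b, cxmap_eq (F (a + b)) (cxmap_add (F a) (F b))) ->
  (forall c a, cxmap_eq (F (c *: a)) (cxmap_scale c (F a))) ->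
  cxmap_eq (F 1) (cxmap_id T) ->
  (forall a b, cxmap_eq (F (a * b)) (cxmap_comp (F a) (F b))) ->
  (forall a b, null_homotopic (cxmap_add (F a) (cxmap_scale (-1) (F b))) -> a = b) ->
  (forall g, exists a, cxmap_eq (F a) g) ->
  End_isomorphic B T.
Proof.
move=> DT iT FD FZ F1 FM Finj Fsurj.
exists (fun a => map_roof (F a) DT); split; split.
- move=> a b; exists (map_roof (F a) DT), (F b); split.
  + exact/map_roof_eq/homotopic_eq.
  + exact/map_roof_eq/homotopic_eq.
  + exact/map_roof_eq/homotopic_eq.
- by move=> c a; apply/map_roof_eq/homotopic_eq.
- by apply/map_roof_eq/homotopic_eq => i x; rewrite F1.
- move=> a b; exists T, (cxmap_id T), (F b), DT, (id_quasi_iso T); split.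
    exact: homotopic_eq.
  by exists T, (cxmap_id T), (cxmap_id T); split=> //;
    [apply: id_quasi_iso | apply: homotopic_eq | apply/homotopic_eq => i x /=; rewrite FM].
- by move=> a b /(map_roof_inj DT iT)/Finj.
move=> r; have [g _ Hg] := roof_map DT iT r; have [a Ha] := Fsurj g; exists a.
move: Hg => [W [s [s' [DW qs H1 H2]]]]; exists W, s, s'; split=> //.
by apply: homotopic_trans H2; apply: homotopic_eq => i x /=; rewrite Ha.
Qed.

End Roofs.

(** * Two-out-of-three in thick subcategories *)
Section Thick.
Variables (k : fieldType) (A : algType k).
Local Notation cx := (cx A).
Implicit Types X Y Z W : cx.

Lemma shift_Db X n : is_Db X -> is_Db (cx_shift X n).
Proof.
move=> [[N HN] fX]; split=> [|i]; last exact: fX.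
exists (N + `|n|)%N => i lti; apply: HN.
have : (`|i| <= `|(i + n)%R| + `|n|)%N.
  by rewrite -lez_nat PoszD !abszE -{1}[i](addrK n) ler_normB.
by rewrite -(ltn_add2r `|n|) => /(leq_trans lti).
Qed.

Lemma cone_Db X Y (f : cxmap X Y) : is_Db X -> is_Db Y -> is_Db (cx_cone f).
Proof.
move=> [[N HN] fX] [[M HM] fY]; split; last exact: cone_fg.
exists (maxn N.+1 M) => i; rewrite gtn_max => /andP[ltN ltM] [x y].
congr (_, _); last exact: HM.
apply: HN; have : (`|i| <= `|(i + 1)%R| + 1)%N.
  by rewrite -lez_nat PoszD !abszE -{1}[i](addrK 1) ler_normB.
by rewrite addn1 => /(leq_trans ltN).
Qed.

Section Ses.
Variables (X Y Z : cx) (f : cxmap X Y) (g : cxmap Y Z).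

Definition short_exact := [/\ forall i, injective (f i), forall i z, exists y, g i y = z,
  forall i x, g i (f i x) = 0 & forall i y, g i y = 0 -> exists x, y = f i x].

Hypothesis fg_exact : short_exact.

Lemma cone_quot_subproof (i : int) p :
  (g (i + 1) \o lin_snd (X (i + 1 + 1)) (Y (i + 1))) (cx_d (cx_cone f) i p)
  = cx_d Z i ((g i \o lin_snd (X (i + 1)) (Y i)) p).
Proof.
have [_ _ gf _] := fg_exact.
by case: p => x y; rewrite /= raddfD /= gf add0r cxmap_d.
Qed.

Definition cone_quot : cxmap (cx_cone f) Z := @CxMap _ _ (cx_cone f) Z _ cone_quot_subproof.

(** The cone of a monomorphism is quasi-isomorphic to its cokernel.  This is how short
    exact sequences of complexes become cones, under which a thick subcategory is
    closed. *)
Lemma cone_quot_qi : quasi_iso cone_quot.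
Proof.
have [injf surg gf kerg] := fg_exact.
move=> i; split=> [[x y] [/eqP]|z dz0].
  rewrite oppr_eq0 => /eqP dx0 E [z /= Ez].
  have [y0 Ey0] := surg _ z.
  have [x' Ex'] : exists x', y - cx_d Y i y0 = f _ x'.
    by apply: kerg; rewrite raddfB /= cxmap_d Ey0 Ez subrr.
  exists (x', y0); congr (_, _) => /=; last by rewrite -Ex' subrK.
  apply: (injf (i + 1 + 1)); rewrite raddfN /= cxmap_d -Ex' raddfB /= cx_dd subr0.
  by apply/eqP; rewrite -addr_eq0; apply/eqP.
have [y Ey] := surg _ z.
have [x Ex] : exists x, cx_d Y (i + 1) y = f _ x.
  by apply: kerg; rewrite cxmap_d Ey dz0.
exists (- x, y), 0; split; last by rewrite raddf0 addr0 /= Ey.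
congr (_, _) => /=; last by rewrite raddfN /= Ex addNr.
apply: (injf (i + 1 + 1 + 1)); rewrite (raddfN (cx_d X _)) opprK cxmap_d -Ex cx_dd.
by rewrite raddf0.
Qed.
End Ses.

Section ConeSes.
Variables (X Y : cx) (f : cxmap X Y).

Definition cone_in : cxmap Y (cx_cone f).
Proof.
refine (@CxMap _ _ Y (cx_cone f) (fun i => lin_inr (X (i + 1)) (Y i)) _).
by move=> i y /=; congr (_, _) => /=; rewrite !raddf0 ?oppr0 ?add0r.
Defined.

Definition cone_out : cxmap (cx_cone f) (cx_shift X 1).
Proof.
refine (@CxMap _ _ (cx_cone f) (cx_shift X 1) (fun i => lin_fst (X (i + 1)) (Y i)) _).
by move=> i p; rewrite shift1_d.
Defined.

(** Together with [cone_quot_qi] this recovers the source of f, up to a shift, from its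
    target and its cone. *)
Lemma cone_short_exact : short_exact cone_in cone_out.
Proof.
split=> [i x y [] //|i x|//|i [x y] /= ->]; first by exists (x, 0).
by exists y.
Qed.
End ConeSes.

Section Unshift.
Variables (X : cx) (n : int).

Lemma cx_tr_tr (i j l : int) (e : i = j) (e' : j = l) (x : X i) :
  cx_tr X e' (cx_tr X e x) = cx_tr X (etrans e e') x.
Proof. by case: _ / e'; case: _ / e. Qed.

Lemma cx_tr_irr (i j : int) (e e' : i = j) (x : X i) : cx_tr X e x = cx_tr X e' x.
Proof. by rewrite (eq_irrelevance e e'). Qed.

(** The two shifts cancel only up to transport along i - n + n = i. *)
Definition unshift : cxmap (cx_shift (cx_shift X n) (- n)) X.
Proof.
refine (@CxMap _ _ (cx_shift (cx_shift X n) (- n)) X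
  (fun i => cx_tr X (subrK n i)) _).
move=> i x; rewrite cx_tr_d /= !linearZ /=.
have E (e : i + - n + 1 = i + 1 + - n) (y : cx_shift X n (i + - n + 1)) :
    cx_tr (fun j => X (j + n)) e y = cx_tr X (congr1 (+%R^~ n) e) y by case: _ / e.
rewrite E !cx_tr_tr scalerA abszN -exprD addnn -mul2n exprM sqrrN !expr1n scale1r.
exact: cx_tr_irr.
Defined.

Lemma unshift_qi : quasi_iso unshift.
Proof.
apply: iso_quasi_iso => [i x y|i y].
  by move=> /(congr1 (cx_tr X (esym (subrK n i)))); rewrite /= !cx_tr_tr !cx_tr_id.
exists (cx_tr X (esym (subrK n i)) y).
by rewrite /= cx_tr_tr cx_tr_id.
Qed.
End Unshift.

Section ThickSubcategory.
Variable P : cx -> Prop.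
Hypothesis thP : thick P.

Lemma thick_unshift X n : is_Db X -> P (cx_shift X n) -> P X.
Proof.
move=> DX PX; apply/(thick_qi thP _ DX (@unshift_qi X n)); last exact: thick_shift.
by do 2 apply: shift_Db.
Qed.

Lemma thick_quot X Y Z (f : cxmap X Y) (g : cxmap Y Z) :
  short_exact f g -> is_Db Z -> P X -> P Y -> P Z.
Proof.
move=> fg DZ PX PY; have PC := thick_cone thP f PX PY.
by apply/(thick_qi thP (thick_Db thP PC) DZ (cone_quot_qi fg)).
Qed.

Lemma thick_sub X Y Z (f : cxmap X Y) (g : cxmap Y Z) :
  short_exact f g -> is_Db X -> P Y -> P Z -> P X.
Proof.
move=> fg DX PY PZ.
have PC : P (cx_cone f).
  by apply/(thick_qi thP (cone_Db f DX (thick_Db thP PY)) (thick_Db thP PZ) (cone_quot_qi fg)).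
apply: (thick_unshift DX (n := 1)).
by apply: thick_quot (cone_short_exact f) _ PY PC; apply: shift_Db.
Qed.

Lemma thick_mid X Y Z (f : cxmap X Y) (g : cxmap Y Z) :
  short_exact f g -> is_Db Y -> P X -> P Z -> P Y.
Proof.
move=> fg DY PX PZ.
have PC : P (cx_cone f).
  by apply/(thick_qi thP (cone_Db f (thick_Db thP PX) DY) (thick_Db thP PZ) (cone_quot_qi fg)).
by apply: thick_sub (cone_short_exact f) DY PC _; apply: thick_shift.
Qed.

Lemma zero_mod_Db X : (forall i (x : X i), x = 0) -> is_Db X.
Proof.
by move=> X0; split=> [|i]; [exists 0%N => i _; apply: X0 | apply: fin_gen_zero].
Qed.

Lemma mod0_zero (x : mod0 A) : x = 0.
Proof. exact: thinmx0. Qed.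

Lemma thick_zero_cx X : (forall i (x : X i), x = 0) -> P X.
Proof.
move=> X0; have DX := zero_mod_Db X0.
apply/(thick_qi thP DX (thick_Db thP (thick_zero thP)) (f := cxmap_zero X (cx_zero A))).
  apply: iso_quasi_iso => [i x y _|i y]; first by rewrite (X0 i x) (X0 i y).
  by exists 0; case: i y => [[|[|i]]|[|i]] y; exact: etrans (mod0_zero _) (esym (mod0_zero _)).
exact: thick_zero.
Qed.

Lemma thick_iso X Y (f : cxmap X Y) : (forall i, injective (f i)) ->
  (forall i y, exists x, f i x = y) -> is_Db X -> is_Db Y -> P X <-> P Y.
Proof. by move=> injf surf DX DY; apply: thick_qi (iso_quasi_iso injf surf). Qed.

End ThickSubcategory.

End Thick.

(** * Quotients, characters and filtrations of modules *)
Section Quotient.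
Variables (k : fieldType) (A : algType k) (M : lmodType A).

Record submodule := Submodule {
  sub_pred : {pred M};
  sub_zmod : zmod_closed sub_pred;
  sub_scale : forall (a : A) x, x \in sub_pred -> a *: x \in sub_pred }.

HB.instance Definition _ (S : submodule) :=
  GRing.isZmodClosed.Build M (sub_pred S) (sub_zmod S).

Variable S : submodule.

Definition quotmod := {ideal_quot (sub_pred S : zmodClosed M)}.
HB.instance Definition _ := GRing.Zmodule.on quotmod.

Definition quot_pi (x : M) : quotmod := \pi_quotmod x.

Lemma quot_pi_eq x y : quot_pi x = quot_pi y <-> x - y \in sub_pred S.
Proof. by rewrite Quotient.idealrBE; split=> [/eqP|/eqP]. Qed.

Lemma quot_piK (x : quotmod) : quot_pi (repr x) = x.
Proof. exact: reprK. Qed.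

Lemma quot_piD x y : quot_pi (x + y) = quot_pi x + quot_pi y.
Proof. exact: Quotient.pi_add. Qed.

Definition quot_scale (a : A) (x : quotmod) : quotmod := quot_pi (a *: repr x).

Lemma quot_piZ a x : quot_pi (a *: x) = quot_scale a (quot_pi x).
Proof.
apply/quot_pi_eq; rewrite -scalerBr; apply: sub_scale.
by apply/quot_pi_eq; rewrite quot_piK.
Qed.

Lemma quot_scaleA a b x : quot_scale a (quot_scale b x) = quot_scale (a * b) x.
Proof. by rewrite -[x]quot_piK -!quot_piZ scalerA. Qed.
Lemma quot_scale1 : left_id 1 quot_scale.
Proof. by move=> x; rewrite -[x]quot_piK -!quot_piZ scale1r. Qed.
Lemma quot_scaleDr : right_distributive quot_scale +%R.
Proof.
by move=> a x y; rewrite -[x]quot_piK -[y]quot_piK -quot_piD -!quot_piZ scalerDr quot_piD.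
Qed.
Lemma quot_scaleDl x : {morph quot_scale^~ x : a b / a + b}.
Proof. by move=> a b; rewrite -[x]quot_piK -!quot_piZ scalerDl quot_piD. Qed.

HB.instance Definition _ := GRing.Zmodule_isLmodule.Build A quotmod
  quot_scaleA quot_scale1 quot_scaleDr quot_scaleDl.

Lemma quot_pi_linear : linear quot_pi.
Proof. by move=> a x y; rewrite quot_piD quot_piZ. Qed.

Definition quot_map : {linear M -> (quotmod : lmodType A)} := mk_linear quot_pi_linear.

Lemma quot_map_eq0 x : quot_map x = 0 <-> x \in sub_pred S.
Proof.
have -> : x \in sub_pred S = (x - 0 \in sub_pred S) by rewrite subr0.
by rewrite -quot_pi_eq; have <- := raddf0 quot_map.
Qed.

Lemma quot_map_surj y : exists x, quot_map x = y.
Proof. by exists (repr y); apply: quot_piK. Qed.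

End Quotient.

Section Characters.
Variables (k : fieldType) (A : algType k).

Record achar := AChar {
  ach :> A -> k;
  ach_lin : forall c x y, ach (c *: x + y) = c * ach x + ach y;
  achM : forall x y, ach (x * y) = ach x * ach y;
  ach1 : ach 1 = 1 }.

(** For the character of a vertex this is the simple module of that vertex. *)
Definition charmod (c : achar) : Type := k.
HB.instance Definition _ (c : achar) := GRing.Zmodule.on (charmod c).

Section Charmod.
Variable c : achar.
Definition char_scale (a : A) (x : charmod c) : charmod c := c a * x.
Lemma char_scaleA a b x : char_scale a (char_scale b x) = char_scale (a * b) x.
Proof. by rewrite /char_scale achM mulrA. Qed.
Lemma char_scale1 : left_id 1 char_scale.
Proof. by move=> x; rewrite /char_scale ach1 mul1r. Qed.
Lemma char_scaleDr : right_distributive char_scale +%R.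
Proof. by move=> a x y; rewrite /char_scale mulrDr. Qed.
Lemma achD x y : c (x + y) = c x + c y.
Proof. by rewrite -[x in LHS]scale1r ach_lin mul1r. Qed.
Lemma char_scaleDl x : {morph char_scale^~ x : a b / a + b}.
Proof. by move=> a b; rewrite /char_scale achD mulrDl. Qed.
HB.instance Definition _ := GRing.Zmodule_isLmodule.Build A (charmod c)
  char_scaleA char_scale1 char_scaleDr char_scaleDl.

Lemma ach0 : c 0 = 0.
Proof. by have := ach_lin c (-1) 0 0; rewrite scaler0 addr0 mulN1r addNr. Qed.
Lemma achZ a x : c (a *: x) = a * c x.
Proof. by rewrite -[_ *: _]addr0 ach_lin ach0 addr0. Qed.

Lemma charmod_fg : fin_gen (charmod c : lmodType A).
Proof.
exists 1%N, (fun=> 1 : k) => x; exists (fun=> (x : k)%:A).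
rewrite big_ord1; change (x = c ((x : k)%:A) * 1 :> k).
by rewrite achZ ach1 !mulr1.
Qed.

Section CharmodMap.
Variables (M : lmodType A) (v : M).
Hypothesis vE : forall y, y *: v = ((c y)%:A : A) *: v.

Lemma charmod_map_subproof : linear (fun x : charmod c => ((x : k)%:A : A) *: v).
Proof.
move=> a x y; rewrite kscaleDl; congr (_ + _).
by rewrite kscale_comm (vE a) kscaleA mulrC.
Qed.
Definition charmod_map : {linear (charmod c : lmodType A) -> M} :=
  mk_linear charmod_map_subproof.

Definition line_pred : {pred M} := fun x => `[< exists d : k, x = (d%:A : A) *: v >].
Lemma line_predP x : (x \in line_pred) <-> exists d : k, x = (d%:A : A) *: v.
Proof. by split=> [/asboolP|/asboolP]. Qed.
Lemma line_zmod : zmod_closed line_pred.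
Proof.
split=> [|x y /line_predP[d ->] /line_predP[d' ->]]; apply/line_predP.
  by exists 0; rewrite kscale0.
by exists (d - d'); rewrite kscaleDl kscaleNl.
Qed.
Lemma line_scale (a : A) x : x \in line_pred -> a *: x \in line_pred.
Proof.
move=> /line_predP[d ->]; apply/line_predP; exists (d * c a).
by rewrite kscale_comm (vE a) kscaleA.
Qed.
Definition line_sub := Submodule line_zmod line_scale.

Lemma quot_line_eq0 x : quot_map line_sub x = 0 <-> exists d : k, x = (d%:A : A) *: v.
Proof. by rewrite quot_map_eq0; apply: line_predP. Qed.
End CharmodMap.
End Charmod.
End Characters.

Section ThreeTermMaps.
Variables (k : fieldType) (A : algType k).
Local Notation cx := (cx A).
Variables (M N P : lmodType A) (f : {linear M -> N}) (g : {linear N -> P}).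
Hypothesis gf0 : forall x, g (f x) = 0.

Lemma cx3_Db : fin_gen M -> fin_gen N -> fin_gen P -> is_Db (cx3 gf0).
Proof.
have f0 : fin_gen (mod0 A) by apply: fin_gen_zero => x; apply: mod0_zero.
move=> fM fN fP; split=> [|[[|[|i]]|[|i]]] //.
by exists 1%N => [[[|[|i]]|[|i]]] //= _ x; apply: mod0_zero.
Qed.

Variables (X : cx) (a : {linear M -> X (Negz 0)}) (b : {linear N -> X (Posz 0)})
  (c : {linear P -> X (Posz 1)}).
Hypotheses (ab : forall x, b (f x) = cx_d X (Negz 0) (a x))
  (bc : forall x, c (g x) = cx_d X (Posz 0) (b x)) (c0 : forall x, cx_d X (Posz 1) (c x) = 0).

(** Matching on the degree avoids transport: i + 1 computes in the three degrees where
    the complex is not zero. *)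
Definition cx3_out_fun (i : int) : {linear cx3 gf0 i -> X i} :=
  match i return {linear cx3_obj M N P i -> X i} with
  | Negz 0 => a | Posz 0 => b | Posz 1 => c | _ => \0 end.

Lemma cx3_out_subproof i x :
  cx3_out_fun (i + 1) (cx_d (cx3 gf0) i x) = cx_d X i (cx3_out_fun i x).
Proof.
case: i x => [[|[|i]]|[|i]] x /=; rewrite ?ab ?bc ?c0 ?raddf0 //.
Qed.
Definition cx3_out : cxmap (cx3 gf0) X := CxMap cx3_out_subproof.
End ThreeTermMaps.

Section Devissage.
Variables (k : fieldType) (A : algType k).
Local Notation cx := (cx A).

Section StalkMap.
Variables (M N : lmodType A) (f : {linear M -> N}).
Definition stalk_map : cxmap (cx_stalk M) (cx_stalk N).
Proof. by refine (@cx3_out _ _ _ _ _ _ _ _ (cx_stalk N) \0 f \0 _ _ _) => x /=;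
  rewrite ?raddf0. Defined.
End StalkMap.

Lemma stalk_Db (M : lmodType A) : fin_gen M -> is_Db (cx_stalk M).
Proof.
have f0 : fin_gen (mod0 A) by apply: fin_gen_zero => x; apply: mod0_zero.
by move=> fM; apply: cx3_Db.
Qed.

Lemma stalk_short_exact (M N P : lmodType A) (f : {linear M -> N}) (g : {linear N -> P}) :
  injective f -> (forall z, exists y, g y = z) -> (forall x, g (f x) = 0) ->
  (forall y, g y = 0 -> exists x, y = f x) -> short_exact (stalk_map f) (stalk_map g).
Proof.
have Z (x y : mod0 A) : x = y by rewrite [x]mod0_zero [y]mod0_zero.
move=> injf surg gf kerg; split=> [] [[|[|i]]|[|i]] //=.
all: by [move=> *; exists 0; apply: Z | move=> *; apply: Z].
Qed.

Lemma surj_fin_gen (M N : lmodType A) (f : {linear M -> N}) :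
  (forall z, exists y, f y = z) -> fin_gen M -> fin_gen N.
Proof.
move=> surf [n [g Hg]]; exists n, (f \o g) => y; have [x <-] := surf y.
by have [c ->] := Hg x; exists c; rewrite linear_sum; apply: eq_bigr => i _; rewrite linearZ.
Qed.

Variables (chr : nat -> achar A).

(** Iterated quotients by lines on which A acts through the characters in the list.
    The vector v may be zero, so that spanning families need not be bases. *)
Inductive filtered : seq nat -> lmodType A -> Prop :=
| filtered_nil (M : lmodType A) : (forall x : M, x = 0) -> filtered [::] M
| filtered_cons a D (M N : lmodType A) (v : M) (p : {linear M -> N}) :
    (forall y, y *: v = ((chr a y)%:A : A) *: v) ->
    (forall z, exists y, p y = z) ->
    (forall x, p x = 0 <-> exists d : k, x = (d%:A : A) *: v) ->
    filtered D N -> filtered (a :: D) M.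

Variables (P : cx -> Prop) (thP : thick P).

Lemma thick_filtered D M : filtered D M -> fin_gen M ->
  (forall a, a \in D -> P (cx_stalk (charmod (chr a)))) -> P (cx_stalk M).
Proof.
elim=> {D M} [M M0 fM _|a D M N v p vE surp kerp _ IH fM PD].
  by apply: (thick_zero_cx thP) => -[[|[|i]]|[|i]] // x; apply: mod0_zero.
have fN := surj_fin_gen surp fM.
have PN : P (cx_stalk N).
  by apply: IH => // b Db; apply: PD; rewrite inE Db orbT.
have [v0|nv] := eqVneq v 0.
  have injp : injective p.
    move=> x y E; apply/eqP; rewrite -subr_eq0; apply/eqP.
    have [] := (kerp (x - y)).1; first by rewrite raddfB /= E subrr.
    by move=> d ->; rewrite v0 scaler0.
  have Z (x y : mod0 A) : x = y by rewrite [x]mod0_zero [y]mod0_zero.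
  apply/(thick_iso thP (f := stalk_map p) _ _ (stalk_Db fM) (stalk_Db fN)) => //.
    by move=> [[|[|i]]|[|i]] // x y _; apply: Z.
  by move=> [[|[|i]]|[|i]] // y; exists 0; apply: Z.
apply: (thick_mid thP (stalk_short_exact (f := charmod_map vE) (g :=
  p) _ surp _ _) (stalk_Db fM)) => //.
- move=> x y /= E; apply/eqP; rewrite -subr_eq0; apply: contraNT nv => nxy.
  apply/eqP; apply: (kscale_eq0 nxy); by rewrite kscaleDl kscaleNl E subrr.
- by move=> x; apply/kerp; exists x.
- by move=> y /kerp[d ->]; exists d.
by apply: PD; rewrite mem_head.
Qed.

Variables (e : nat -> A) (n : nat).
Hypotheses (eM : forall a b, e a * e b = if a == b then e a else 0)
  (e1 : \sum_(a < n) e a = 1)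
  (eAe0 : forall a b y, (b < a)%N -> e a * y * e b = 0)
  (eAe : forall a y, e a * y * e a = chr a y *: e a).

(** A vector v with e_b v = v, of smallest label b in a spanning family, spans a
    submodule: e_c kills the module for c < b, and e_c y e_b = 0 for c > b.  The other
    vectors span the quotient, so the sorted family gives a filtration. *)
Lemma homogeneous_filtered (I : Type) (L : seq I) (lab : I -> nat) (M : lmodType A) (v : I -> M) :
  (forall i, e (lab i) *: v i = v i) ->
  (forall x, exists c : I -> k, x = \sum_(i <- L) ((c i)%:A : A) *: v i) ->
  sorted leq (map lab L) -> filtered (map lab L) M.
Proof.
elim: L M v => [|i L IH] M v hv span srt.
  by apply: filtered_nil => x; have [c ->] := span x; rewrite big_nil.
have lt0 a : (a < lab i)%N -> forall x : M, e a *: x = 0.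
  move=> lta x; have [c ->] := span x; rewrite scaler_sumr.
  have leL : all (leq (lab i)) (map lab (i :: L)).
    by rewrite /= leqnn (order_path_min leq_trans srt).
  elim: (i :: L) leL => [|j s IHs] /=; first by rewrite big_nil.
  case/andP=> lej /IHs E; rewrite big_cons {}E addr0 kscale_comm -hv (scalerA (e a)) eM.
  by case: eqP => [Ea|_]; [move: lej; rewrite -Ea leqNgt lta | rewrite scale0r scaler0].
(* A label that is not a vertex belongs to a zero vector. *)
have [nlab|lab_gt] := ltnP (lab i) n; last first.
  have e0 : e (lab i) = 0.
    rewrite -[LHS]mul1r -e1 mulr_suml big1 // => a _; rewrite eM.
    by rewrite (ltn_eqF (leq_trans (ltn_ord a) lab_gt)).
  have v0 : v i = 0 by rewrite -hv e0 scale0r.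
  apply: (@filtered_cons _ _ M M (v i) idfun); rewrite ?v0.
  - by move=> y; rewrite !scaler0.
  - by move=> z; exists z.
  - by move=> x /=; split=> [->|[d ->]]; [exists 0 | ]; rewrite scaler0.
  apply: (IH M v) => // [x|]; last exact: path_sorted srt.
  by have [c ->] := span x; exists c; rewrite big_cons v0 scaler0 add0r.
have vE y : y *: v i = ((chr (lab i) y)%:A : A) *: v i.
  have Ey : y = \sum_(a < n) e a * y by rewrite -mulr_suml e1 mul1r.
  rewrite {1}Ey scaler_suml (bigD1 (Ordinal nlab)) //= big1.
    rewrite addr0 -[in LHS]hv scalerA eAe -[in RHS]hv.
    by rewrite [in RHS]scalerA -scalerAl mul1r.
  move=> a na; case: (ltngtP a (lab i)) => [lta|gta|Ea]; first by rewrite -scalerA lt0.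
    by rewrite -hv scalerA eAe0 ?scale0r.
  by case/eqP: na; apply: val_inj.
apply: (filtered_cons (v := v i) (p := quot_map (line_sub vE)) vE).
- exact: quot_map_surj.
- by move=> x; apply: quot_line_eq0.
apply: (IH _ (fun j => quot_map (line_sub vE) (v j))) => [j|y|]; last exact: path_sorted srt.
  by rewrite -linearZ hv.
have [x <-] := quot_map_surj y; have [c Ex] := span x; exists c.
rewrite {1}Ex big_cons linearD linear_sum /=.
have -> : quot_pi (line_sub vE) (((c i)%:A : A) *: v i) = 0.
  by apply/quot_line_eq0; exists (c i).
by rewrite add0r; apply: eq_bigr => j _; apply: (linear_kscale (quot_map (line_sub vE))).
Qed.

Hypothesis Afd : fin_dim A.

Lemma fin_gen_filtered (M : lmodType A) : fin_gen M ->
  exists2 D, filtered D M & all (fun a => a < n)%N D.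
Proof.
move=> /(fin_gen_k_spanned Afd)[I [v Hv]].
pose J := ('I_n * I)%type; pose lab (j : J) : nat := j.1.
pose L := sort (relpre lab leq) (index_enum J).
exists (map lab L); last by apply/allP => a /mapP[j _ ->]; apply: ltn_ord.
apply: (@homogeneous_filtered J L lab M (fun j => e j.1 *: v j.2)) => [j|x|].
- by rewrite scalerA eM eqxx.
- have [c Ex] := Hv x; exists (fun j => c j.2).
  rewrite (perm_big (index_enum J)) /=; last by rewrite perm_sort.
  rewrite -(pair_bigA _ (fun a i => ((c i)%:A : A) *: (e (a : 'I_n) *: v i))) /=.
  have {1}-> : x = \sum_(a < n) e a *: x by rewrite -scaler_suml e1 scale1r.
  apply: eq_bigr => a _.
  by rewrite {1}Ex scaler_sumr; apply: eq_bigr => i _; rewrite kscale_comm.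
- rewrite sorted_map; apply: sort_sorted => x y; exact: leq_total.
Qed.

(** The one-dimensional module is the kernel of M -> M / kv between modules whose
    stalks lie in P. *)
Lemma thick_char a (M : lmodType A) (v : M) (vE : forall y, y *: v = ((chr a y)%:A : A) *: v) D :
  v != 0 -> fin_gen M -> P (cx_stalk M) -> filtered D (quotmod (line_sub vE)) ->
  (forall b, b \in D -> P (cx_stalk (charmod (chr b)))) -> P (cx_stalk (charmod (chr a))).
Proof.
move=> nv fM PM fD PD; have surp := @quot_map_surj _ _ _ (line_sub vE).
apply: (thick_sub thP (stalk_short_exact (f := charmod_map vE) (g :=
  quot_map (line_sub vE)) _ surp _ _)
  (stalk_Db (charmod_fg _)) PM).
- move=> x y /= E; apply/eqP; rewrite -subr_eq0; apply: contraNT nv => nxy.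
  apply/eqP; apply: (kscale_eq0 nxy); by rewrite kscaleDl kscaleNl E subrr.
- by move=> x; apply/quot_line_eq0; exists x.
- by move=> y /quot_line_eq0[d ->]; exists d.
exact: thick_filtered fD (surj_fin_gen surp fM) PD.
Qed.

Section Truncation.
Variable X : cx.
Hypothesis X1 : forall x : X (Posz 1), x = 0.

Definition trunc_obj (i : int) : lmodType A :=
  match i with Posz 0 => mod0 A | Posz n.+1 => X (Posz n.+1) | Negz n => X (Negz n) end.
Definition trunc_d (i : int) : {linear trunc_obj i -> trunc_obj (i + 1)} :=
  match i return {linear trunc_obj i -> trunc_obj (i + 1)} with
  | Posz 0 => \0 | Posz n.+1 => cx_d X (Posz n.+1)
  | Negz 0 => \0 | Negz n.+1 => cx_d X (Negz n.+1) end.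
Lemma trunc_dd i x : trunc_d (i + 1) (trunc_d i x) = 0.
Proof.
case: i x => [[|n']|[|[|n']]] x //=; first by rewrite raddf0.
- exact: (cx_dd x).
- exact: (cx_dd x).
Qed.
Definition trunc : cx := Cx trunc_dd.

Definition trunc_map_fun (i : int) : {linear X i -> trunc i} :=
  match i return {linear X i -> trunc_obj i} with
  | Posz 0 => \0 | Posz n.+1 => idfun | Negz n => idfun end.
Lemma trunc_map_subproof i x :
  trunc_map_fun (i + 1) (cx_d X i x) = cx_d trunc i (trunc_map_fun i x).
Proof. by case: i x => [[|n']|[|[|n']]] x //=; apply: X1. Qed.
Definition trunc_map : cxmap X trunc := CxMap trunc_map_subproof.

Definition trunc_ker : cxmap (cx_stalk (X (Posz 0))) X.
Proof.
refine (@cx3_out _ _ _ _ _ _ _ _ X \0 (idfun : {linear X (Posz 0) -> X (Posz 0)}) \0 _ _ _)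
  => x.
- by rewrite /= (raddf0 (cx_d X (Negz 0))).
- exact: esym (X1 _).
- by rewrite /= (raddf0 (cx_d X (Posz 1))).
Defined.

(** When degree 0 is the last nonzero one, the term in degree 0 is a subcomplex. *)
Lemma trunc_short_exact : short_exact trunc_ker trunc_map.
Proof.
have Z (x y : mod0 A) : x = y by rewrite [x]mod0_zero [y]mod0_zero.
split.
- by move=> [[|[|i]]|[|i]] //= x y _; apply: Z.
- by move=> [[|i]|i] //= x; [exists 0; apply: Z | exists x | exists x].
- by move=> [[|[|i]]|[|i]] //= x.
- by move=> [[|[|i]]|[|i]] //= x E; [exists x | exists 0 | exists 0 | exists 0 | exists 0].
Qed.

Lemma trunc_Db : is_Db X -> is_Db trunc.
Proof.
move=> [[N HN] fX]; split=> [|[[|i]|i]] //=; last first.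
  by apply: fin_gen_zero => x; apply: mod0_zero.
exists N => -[[|i]|i] //; last exact: HN.
exact: (HN (Posz i.+1)).
Qed.
End Truncation.

Hypothesis Pchar : forall a, (a < n)%N -> P (cx_stalk (charmod (chr a))).

(** Induction on the length of X: after a shift the last nonzero degree is 0, and
    cutting it off leaves a shorter complex. *)
Lemma thick_all X : is_Db X -> P X.
Proof.
have stalkP (M : lmodType A) : fin_gen M -> P (cx_stalk M).
  move=> fM; have [D fD /allP Dn] := fin_gen_filtered fM.
  by apply: thick_filtered fD fM _ => a /Dn; apply: Pchar.
suff H (w : nat) : forall X, is_Db X -> (forall i, 0 < i -> forall x : X i, x = 0) ->
    (forall i, i <= - w%:Z -> forall x : X i, x = 0) -> P X.
  move=> DX; have [[N HN] fX] := DX.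
  apply: (thick_unshift thP DX (n := N%:Z)); apply: (H (2 * N).+1).
  - exact: shift_Db.
  - by move=> i i_gt0; apply: (HN (i + N%:Z)); lia.
  - by move=> i i_le; apply: (HN (i + N%:Z)); lia.
elim: w => [|w IH] {}X DX X_hi X_lo.
  apply: (thick_zero_cx thP) => i x.
  by have [le0|gt0] := leP i 0; [apply: X_lo; rewrite oppr0 | apply: X_hi].
have X1 : forall x : X (Posz 1), x = 0 by apply: X_hi.
apply: (thick_mid thP (trunc_short_exact X1) DX); first by apply: stalkP; case: DX.
have DT := trunc_Db X1 DX.
apply: (thick_unshift thP DT (n := -1)); apply: IH; first exact: shift_Db.
  move=> i i_gt0; change (forall x : trunc X1 (i - 1), x = 0).
  have : 0 <= i - 1 by lia.
  by case: (i - 1) => [[|m]|m] //= _ x; [apply: mod0_zero | apply: X_hi].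
move=> i i_le; change (forall x : trunc X1 (i - 1), x = 0).
have : i - 1 <= - w.+1%:Z by lia.
by case: (i - 1) => [[|m]|m] //= le x; apply: X_lo.
Qed.
End Devissage.

(** * Path algebras in which parallel paths are congruent *)
Section PathCounting.
Variables (k : fieldType) (Q : quiver).
Local Notation pathalg := (pathalg k Q).

(** The entry (t, s) of the image under the algebra morphism from the path algebra to
    matrices over the vertices that sends a path to an elementary matrix. *)
Definition path_count (s t : vert Q) (x : pathalg) : k :=
  psum (fun p => ((psrc p == s) && (ptgt p == t))%:R : k^o) x.

Lemma path_count_linear s t : linear (path_count s t : pathalg -> k^o).
Proof. exact: psum_linear. Qed.

Lemma path_count_elt s t p : path_count s t (pelt k p) = ((psrc p == s) && (ptgt p == t))%:R.
Proof. by rewrite /path_count psumU. Qed.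

Lemma path_countD s t x y : path_count s t (x + y) = path_count s t x + path_count s t y.
Proof. by have := path_count_linear s t 1 x y; rewrite !scale1r. Qed.

Lemma path_count0 s t : path_count s t 0 = 0.
Proof. by have := path_count_linear s t (-1) 0 0; rewrite scaler0 addr0 scaleN1r addNr. Qed.

Lemma path_countZ s t c x : path_count s t (c *: x) = c * path_count s t x.
Proof. by have := path_count_linear s t c x 0; rewrite addr0 path_count0 addr0. Qed.

Lemma path_countN s t x : path_count s t (- x) = - path_count s t x.
Proof. by rewrite -scaleN1r path_countZ mulN1r. Qed.

Lemma path_count_sum s t (I : Type) (r : seq I) (F : I -> pathalg) :
  path_count s t (\sum_(i <- r) F i) = \sum_(i <- r) path_count s t (F i).
Proof. by apply: (big_morph (path_count s t)) => [x y|];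
  [apply: path_countD | apply: path_count0]. Qed.

Lemma path_countM s t (x y : pathalg) : path_count s t (x * y) =
  \sum_w path_count w t x * path_count s w y.
Proof.
apply: (@linear_ext _ _ k^o (fun x => path_count s t (x * y))
   (fun x => \sum_w path_count w t x * path_count s w y)) => [c a b|c a b|p].
- by rewrite mulrDl -pscaleAl path_countD path_countZ.
- rewrite scaler_sumr -big_split /=; apply: eq_bigr => w _.
  by rewrite path_countD path_countZ mulrDl -mulrA.
apply: (@linear_ext _ _ k^o (fun y => path_count s t (pelt k p * y))
   (fun y => \sum_w path_count w t (pelt k p) * path_count s w y)) => [c a b|c a b|q].
- by rewrite mulrDr -pscaleAr path_countD path_countZ.
- rewrite scaler_sumr -big_split /=; apply: eq_bigr => w _.
  by rewrite path_countD path_countZ mulrDr mulrCA.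
rewrite -[pelt k p * _]/(pmul _ _) pmulUU (bigD1 (psrc p)) //= big1 ?addr0 => [|w nw].
  rewrite !path_count_elt eqxx /= /pbasis; case: (pcompP p q) => [[r [-> E Vr]]|[-> /eqP nE]].
    rewrite path_count_elt (ptgt_cat Vr) E eqxx andbT -natrM mulnb andbC; congr ((_ && _)%:R).
    by rewrite /psrc Vr.
  by rewrite path_count0 (negPf nE) andbF mulr0.
by rewrite path_count_elt eq_sym (negPf nw) mul0r.
Qed.

Lemma path_count1 s t : path_count s t 1 = (s == t)%:R.
Proof.
rewrite -[1]/(pone k Q) /pone path_count_sum (bigD1 s) //= path_count_elt big1 ?addr0 => [|w nw].
  by rewrite -[psrc _]/s -[ptgt _]/s eqxx.
by rewrite path_count_elt -[psrc _]/w (negPf nw).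
Qed.

Definition pathto (s t : vert Q) : Prop := exists p, psrc p = s /\ @ptgt Q p = t.

Lemma pathto_refl s : pathto s s.
Proof. by exists (ptriv s). Qed.

Lemma pathto_trans s w t : pathto s w -> pathto w t -> pathto s t.
Proof.
move=> [q [<- Eq]] [p [Ep <-]]; have [|r _ Vr] := @pcompT Q p q; first by rewrite Ep.
exists r; split; first by rewrite /psrc Vr.
by rewrite (ptgt_cat Vr) Eq -Ep.
Qed.

Lemma pathto_arrow (a : arrow Q) : pathto (src a) (tgt a).
Proof.
have H : is_qpath (src a) [:: a] by rewrite /= eqxx.
by exists (@QPath Q (src a, [:: a]) H).
Qed.

Lemma path_count_nopath s t x : ~ pathto s t -> path_count s t x = 0.
Proof.
move=> H; apply: (@linear_ext _ _ k^o (path_count s t) (fun=> 0)) => [c a b|c a b|p].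
- by rewrite path_countD path_countZ.
- by rewrite scaler0 addr0.
rewrite path_count_elt; case: eqP => //= Es; case: eqP => //= Et; case: H.
by exists p.
Qed.

End PathCounting.

Section ThinAlgebra.
Variables (k : fieldType) (Q : bound_quiver k).
Local Notation B := (bqalg Q).
Local Notation pathalg := (pathalg k Q).

Lemma bqpiMr x y : bqpi (x * y) = bqpi x * bqpi y :> B.
Proof. exact: bqpiM. Qed.
Lemma bqpiZr c x : bqpi (c *: x) = c *: bqpi x :> B.
Proof. exact: bqpiZ. Qed.
Lemma bqpi1 : bqpi 1 = 1 :> B.
Proof. by []. Qed.
Lemma bqpi0 : bqpi 0 = 0 :> B.
Proof. exact: (raddf0 \pi_B). Qed.
Lemma bqpi_sum (I : Type) (r : seq I) (F : I -> pathalg) :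
  bqpi (\sum_(i <- r) F i) = \sum_(i <- r) bqpi (F i) :> B.
Proof. by apply: (big_morph (@bqpi k Q)) => [x y|]; [apply: bqpiD | apply: bqpi0]. Qed.

(** When parallel paths are congruent, the class does not depend on the path chosen, see
    [path_classE]. *)
Definition path_class (s t : vert Q) : B :=
  if pselect (pathto s t) is left H then bqpi (pelt k (sval (cid H))) else 0.

Lemma path_class_nopath s t : ~ pathto s t -> path_class s t = 0.
Proof. by rewrite /path_class; case: pselect. Qed.

Hypothesis par : forall p q : qpath Q, psrc p = psrc q -> ptgt p = ptgt q ->
  bqpi (pelt k p) = bqpi (pelt k q) :> B.

Lemma path_classE p : path_class (psrc p) (ptgt p) = bqpi (pelt k p).
Proof.
rewrite /path_class; case: pselect => [H|[]]; last by exists p.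
by case: (cid H) => q /= [Es Et]; apply: par.
Qed.

Lemma path_class_mul s w t : pathto s w -> pathto w t ->
  path_class w t * path_class s w = path_class s t.
Proof.
move=> [q [<- <-]] [p [Ep <-]]; rewrite (path_classE q) -Ep (path_classE p).
have [r Er Vr] := @pcompT Q p q (esym Ep).
have <- : psrc r = psrc q by rewrite /psrc Vr.
have <- : ptgt r = ptgt p by rewrite (ptgt_cat Vr) -Ep.
by rewrite path_classE -bqpiMr -[pelt k p * _]/(pmul _ _) pmulUU /pbasis Er.
Qed.

Lemma path_class_mul0 s w w' t : w != w' -> path_class w t * path_class s w' = 0.
Proof.
have [[p [<- <-]]|H] := pselect (pathto w t); last by rewrite path_class_nopath ?mul0r.
have [[q [<- <-]]|H] := pselect (pathto s w'); last by rewrite (path_class_nopath H) mulr0.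
move=> /eqP nw; rewrite !path_classE -bqpiMr -[pelt k p * _]/(pmul _ _) pmulUU /pbasis.
case: (pcompP p q) => [[r [_ E _]]|[-> _]]; last exact: bqpi0.
by case: nw.
Qed.

Lemma bqpi_path_class x : bqpi x = \sum_s \sum_t path_count s t x *: path_class s t.
Proof.
apply: (@linear_ext _ _ B (@bqpi k Q) (fun x => \sum_s \sum_t path_count s t x *: path_class s t))
  => [c a b|c a b|p].
- by rewrite bqpiD bqpiZr.
- rewrite scaler_sumr -big_split; apply: eq_bigr => s _ /=.
  rewrite scaler_sumr -big_split; apply: eq_bigr => t _ /=.
  by rewrite path_countD path_countZ scalerDl scalerA.
rewrite (bigD1 (psrc p)) //= [X in _ = _ + X]big1 ?addr0 => [|s ns]; last first.
  by rewrite big1 // => t _; rewrite path_count_elt eq_sym (negPf ns) scale0r.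
rewrite (bigD1 (ptgt p)) //= big1 ?addr0 => [|t nt].
  by rewrite path_count_elt !eqxx scale1r path_classE.
by rewrite path_count_elt andbC eq_sym (negPf nt) scale0r.
Qed.

Lemma path_class_triv s : path_class s s = bqpi (pelt k (ptriv s)).
Proof. exact: (path_classE (ptriv s)). Qed.

Lemma path_class_sum1 : \sum_s path_class s s = 1.
Proof.
rewrite -bqpi1 -[1]/(pone k Q) /pone bqpi_sum.
by apply: eq_bigr => s _; rewrite path_class_triv.
Qed.

Lemma path_class_mulr s t w : path_class s t * path_class w w =
  if w == s then path_class s t else 0.
Proof.
case: eqP => [->|/eqP ns]; last by apply: path_class_mul0; rewrite eq_sym.
have [H|H] := pselect (pathto s t); first by apply: path_class_mul => //; apply: pathto_refl.
by rewrite path_class_nopath ?mul0r.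
Qed.

Lemma path_class_mull s t w : path_class w w * path_class s t =
  if w == t then path_class s t else 0.
Proof.
case: eqP => [->|/eqP ns]; last exact: path_class_mul0.
have [H|H] := pselect (pathto s t); first by apply: path_class_mul => //; apply: pathto_refl.
by rewrite (path_class_nopath H) mulr0.
Qed.

Lemma path_class_sandwich s t x : path_class t t * bqpi x * path_class s s =
  path_count s t x *: path_class s t.
Proof.
rewrite bqpi_path_class mulr_sumr mulr_suml (bigD1 s) //= [X in _ + X]big1 ?addr0 => [|s' ns].
  rewrite mulr_sumr mulr_suml (bigD1 t) //= [X in _ + X]big1 ?addr0 => [|t' nt].
    by rewrite -scalerAr -scalerAl path_class_mull eqxx path_class_mulr eqxx.
  by rewrite -scalerAr -scalerAl path_class_mull eq_sym (negPf nt) mul0r scaler0.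
rewrite mulr_sumr mulr_suml big1 // => t' _.
rewrite -scalerAr -scalerAl path_class_mull; case: eqP => _; rewrite ?mul0r ?scaler0 //.
by rewrite path_class_mulr eq_sym (negPf ns) scaler0.
Qed.

Lemma path_class_fin_dim : fin_dim B.
Proof.
exists (vert Q * vert Q)%type, (fun p => path_class p.1 p.2) => x.
exists (fun p => path_count p.1 p.2 (repr x)).
by rewrite -(pair_bigA _ (fun s t =>
  path_count s t (repr x) *: path_class s t)) -bqpi_path_class bqpiK.
Qed.

Lemma path_count_bqpi s t x y : (forall z, z \in @bq_ideal k Q -> path_count s t z = 0) ->
  bqpi x = bqpi y :> B -> path_count s t x = path_count s t y.
Proof.
move=> K /bqpi_eq/K; rewrite path_countD path_countN => /eqP.
by rewrite subr_eq0 => /eqP.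
Qed.

End ThinAlgebra.

(** * The algebra N(n, r) *)
Section NakayamaPaths.
Variables (k : fieldType) (n r : nat) (n_gt0 : (0 < n)%N) (r_gt0 : (0 < r)%N).
Local Notation N := (nakayama k n_gt0 r_gt0).
Local Notation Q := (nak_quiver n).
Local Notation B := (bqalg N).

(** An arrow is determined by its source, and the length of a path by its ends. *)
Lemma nak_path_uniq (p q : qpath Q) : psrc p = psrc q -> ptgt p = ptgt q -> p = q.
Proof.
move=> Es Et; have : plen p = plen q.
  by apply/eqP; rewrite -(eqn_add2l (ptgt p)) nak_path_len Es Et nak_path_len.
case: p q Es {Et} => [[x s] Hs] [[y t] Ht]; rewrite /psrc /plen /parrows /= => Ey Esz.
apply: val_inj => /=; rewrite -{}Ey /= in Ht *; congr (_, _).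
elim: s t x Hs Ht Esz => [|a s IH] [|b t] x //= /andP[/eqP Ea Hs] /andP[/eqP Eb Ht] [Esz].
have Eab : a = b.
  apply: val_inj; have := valP a; have := valP b.
  case: a b Ea Eb {Hs Ht} => [[a1 a2] Ha] [[b1 b2] Hb] /= -> -> /= /eqP E2 /eqP E1.
  by congr (_, _); apply: val_inj; apply: succn_inj; rewrite -E2 -E1.
by rewrite -Eab in Ht *; rewrite (IH _ _ Hs Ht Esz).
Qed.

Lemma nak_par (p q : qpath N) : psrc p = psrc q -> ptgt p = ptgt q ->
  bqpi (pelt k p) = bqpi (pelt k q) :> B.
Proof. by move=> Es Et; rewrite (nak_path_uniq Es Et). Qed.

Lemma nak_pathto (s t : 'I_n) : @pathto Q s t <-> (t <= s)%N.
Proof.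
split=> [[p [<- <-]]|]; first by rewrite -(nak_path_len p) leq_addr.
move: {2}(s - t)%N (erefl (s - t)%N) => d; elim: d s => [|d IH] s Ed le.
  have -> : s = t by apply: val_inj => /=; lia.
  exact: pathto_refl.
have lts : (s.-1 < n)%N by have := ltn_ord s; lia.
have H : (s : nat) == (Ordinal lts).+1 :> nat by rewrite /=; lia.
pose a : arrow Q := @Sub _ _ {xy : 'I_n * 'I_n | xy.1 == xy.2.+1 :> nat} (s, Ordinal lts) H.
apply: (@pathto_trans Q s (Ordinal lts) t); first exact: (pathto_arrow a).
by apply: IH => /=; lia.
Qed.

(** The ideal is spanned by paths of length at least r, since a product of paths is at
    least as long as each factor; the length of a path from s to t is s - t. *)
Lemma nak_path_count_ideal (s t : 'I_n) x : (s < t + r)%N -> x \in @bq_ideal k N ->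
  @path_count k Q s t x = 0.
Proof.
move=> lts /bq_idealP Ix.
have H (a b : 'I_n) y : (a < b)%N -> @path_count k Q a b y = 0.
  by move=> ltab; apply: path_count_nopath => /nak_pathto; rewrite leqNgt ltab.
apply: (Ix (fun x => forall s t : 'I_n, (s < t + r)%N ->
  @path_count k Q s t x = 0)) lts => {s t x Ix}.
  split=> [s t _|x y Hx Hy s t lt|a x Hx s t lt|a x Hx s t lt].
  - exact: path_count0.
  - by rewrite path_countD Hx ?Hy ?addr0.
  - rewrite path_countM big1 // => w _; have [ltw|lew] := ltnP w t; first by rewrite H ?mul0r.
    by rewrite Hx ?mulr0 // (leq_trans lt) // leq_add2r.
  - rewrite path_countM big1 // => w _; have [ltw|lew] := ltnP s w;
    first by rewrite [X in _ * X]H ?mulr0.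
    by rewrite Hx ?mul0r // (leq_ltn_trans lew).
move=> _ [p Lp ->] s t lt; rewrite path_count_elt; case: eqP => //= Es; case: eqP => //= Et.
by move: lt; rewrite -Es -Et -(nak_path_len p) Lp ltnn.
Qed.

Lemma nak_class_neq0 (s t : 'I_n) : (t <= s)%N -> (s < t + r)%N -> @path_class k N s t != 0.
Proof.
move=> le lt; apply/eqP => E0; have /nak_pathto[p [Es Et]] := le.
have : @path_count k Q s t (pelt k p) = @path_count k Q s t 0.
  apply: (@path_count_bqpi k N); first by move=> z; apply: nak_path_count_ideal.
  by rewrite bqpi0 -(path_classE nak_par) Es Et.
by rewrite path_count_elt path_count0 Es Et !eqxx => /eqP; rewrite oner_eq0.
Qed.

(** A path of length at least r factors through one of length exactly r. *)
Lemma nak_class_eq0 (s t : 'I_n) : (t + r <= s)%N -> @path_class k N s t = 0.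
Proof.
move=> le; have ltw : (t + r < n)%N by apply: leq_ltn_trans le (ltn_ord s).
pose w : 'I_n := Ordinal ltw.
rewrite -(@path_class_mul _ _ nak_par s w t); last 2 first.
- exact/nak_pathto.
- by apply/nak_pathto; rewrite /= leq_addr.
have /nak_pathto[p [Es Et]] : (t <= w)%N by rewrite /= leq_addr.
suff -> : @path_class k N w t = 0 by rewrite mul0r.
rewrite -Es -Et path_classE; last exact: nak_par.
rewrite -bqpi0; apply/bqpi_eq; rewrite subr0; apply/bq_idealP => J HJ; apply; exists p => //.
by apply/eqP; have /eqP := nak_path_len p; rewrite Es Et /= eqn_add2l.
Qed.

(** The path class spanning e_a A e_b, for vertices numbered from 1; the sums range over
    at most one index each and give 0 when a or b is not a vertex. *)
Definition nak_basis (a b : nat) : B :=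
  \sum_(i < n | i.+1 == a) \sum_(j < n | j.+1 == b) @path_class k N j i.

Lemma nak_basisE (i j : 'I_n) : nak_basis i.+1 j.+1 = @path_class k N j i.
Proof.
rewrite /nak_basis (big_pred1 i) => [|i']; last by rewrite eqSS.
by rewrite (big_pred1 j) => [|j'] //; rewrite eqSS.
Qed.

Lemma nak_basis_out a b : ~~ ((1 <= a) && (a <= b) && (b <= n) && (b < a + r))%N ->
  nak_basis a b = 0.
Proof.
move=> H; rewrite /nak_basis big1 // => i /eqP Ei; rewrite big1 // => j /eqP Ej.
have [le|gt] := leqP i j.
  by apply: nak_class_eq0; have := ltn_ord j; lia.
by apply: path_class_nopath => /nak_pathto; lia.
Qed.

Lemma nak_vertex a : (1 <= a <= n)%N -> exists i : 'I_n, a = i.+1.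
Proof. by case: a => //= a lt; exists (Ordinal lt). Qed.

Lemma nak_basis_neq0 a b : ((1 <= a) && (a <= b) && (b <= n) && (b < a + r))%N ->
  nak_basis a b != 0.
Proof.
move=> H; have [|i Ei] := @nak_vertex a; first by lia.
have [|j Ej] := @nak_vertex b; first by lia.
by rewrite Ei Ej nak_basisE; apply: nak_class_neq0; lia.
Qed.

Lemma nak_basis_mul a b c : (a <= b <= c)%N -> nak_basis a b * nak_basis b c = nak_basis a c.
Proof.
move=> /andP[leab lebc].
have [H|H] := boolP ((1 <= a) && (c <= n))%N; last first.
  rewrite [RHS]nak_basis_out; last by lia.
  have [?|?] := boolP (1 <= a)%N; first by rewrite (@nak_basis_out b) ?mulr0 //; lia.
  by rewrite nak_basis_out ?mul0r //; lia.
have [|i Ei] := @nak_vertex a; first by lia.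
have [|j Ej] := @nak_vertex b; first by lia.
have [|l El] := @nak_vertex c; first by lia.
by rewrite Ei Ej El !nak_basisE; apply: path_class_mul; [apply: nak_par | apply/nak_pathto;
  lia..].
Qed.

Lemma nak_basis_orth a b : a != b -> nak_basis a a * nak_basis b b = 0.
Proof.
move=> nab; rewrite /nak_basis mulr_suml big1 // => i /eqP Ei;
  rewrite mulr_sumr big1 // => j /eqP Ej.
rewrite mulr_suml big1 // => i' /eqP Ei'; rewrite mulr_sumr big1 // => j' /eqP Ej'.
by apply: path_class_mul0; [apply: nak_par | apply: contraNneq nab => Ew; rewrite -Ei' -Ej Ew].
Qed.

Lemma nak_basis_sum1 : \sum_(i < n) nak_basis i.+1 i.+1 = 1.
Proof.
rewrite -(@path_class_sum1 k N nak_par); apply: eq_bigr => i _; exact: nak_basisE.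
Qed.

Lemma nak_basis_sandwich a b x : exists c : k, nak_basis a a * x * nak_basis b b =
  c *: nak_basis a b.
Proof.
have [H|H] := boolP ((1 <= a <= n) && (1 <= b <= n))%N; last first.
  exists 0; rewrite scale0r; have [?|?] := boolP (1 <= a <= n)%N.
    by rewrite (@nak_basis_out b) ?mulr0 //; lia.
  by rewrite nak_basis_out ?mul0r //; lia.
have [|i Ei] := @nak_vertex a; first by lia.
have [|j Ej] := @nak_vertex b; first by lia.
exists (@path_count k Q j i (repr x)); rewrite Ei Ej !nak_basisE -[x in LHS]bqpiK.
exact: (path_class_sandwich nak_par).
Qed.

Lemma nak_idemE a : nak_idem k n_gt0 r_gt0 a = nak_basis a a.
Proof.
rewrite /nak_idem /nak_basis; apply: eq_bigr => i /eqP <-.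
by rewrite (big_pred1 i) => [|j] //; rewrite (path_class_triv nak_par).
Qed.

Lemma nak_fin_dim : fin_dim B.
Proof. exact: path_class_fin_dim nak_par. Qed.

End NakayamaPaths.

(** What is used of N(n, r).  The idempotents e, equal to the z a a, are those that
    define the injective modules. *)
Record interval_basis (k : fieldType) (A : algType k) (n r : nat) (z : nat -> nat -> A)
  (e : nat -> A) : Prop := IntervalBasis {
  z_n_gt0 : (0 < n)%N;
  z_r_gt0 : (0 < r)%N;
  z_out : forall a b, ~~ ((1 <= a) && (a <= b) && (b <= n) && (b < a + r))%N -> z a b = 0;
  z_neq0 : forall a b, ((1 <= a) && (a <= b) && (b <= n) && (b < a + r))%N -> z a b != 0;
  z_mul : forall a b c, (a <= b <= c)%N -> z a b * z b c = z a c;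
  z_orth : forall a b, a != b -> z a a * z b b = 0;
  z_sum1 : \sum_(i < n) z i.+1 i.+1 = 1;
  z_sandwich : forall a b x, exists c : k, z a a * x * z b b = c *: z a b;
  z_fin_dim : fin_dim A;
  z_idem : forall a, e a = z a a }.

(** * Maps between the injective modules *)
Section DualModules.
Variables (k : fieldType) (A : algType k) (n r : nat) (z : nat -> nat -> A) (e : nat -> A).
Hypothesis zB : interval_basis n r z e.

Let n_gt0 := z_n_gt0 zB.
Let r_gt0 := z_r_gt0 zB.
Let z_out := z_out zB.
Let z_neq0 := z_neq0 zB.
Let z_mul := z_mul zB.
Let z_orth := z_orth zB.
Let z_sum1 := z_sum1 zB.
Let z_sandwich := z_sandwich zB.
Let Afd := z_fin_dim zB.
Let eE := z_idem zB.

Local Notation J a := (dual_mod (e a)).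

Lemma z_idl a b : z a a * z a b = z a b.
Proof.
have [le|gt] := leqP a b; first by rewrite z_mul ?leqnn.
by rewrite (@z_out a b) ?mulr0 //; lia.
Qed.

Lemma z_idr a b : z a b * z b b = z a b.
Proof.
have [le|gt] := leqP a b; first by rewrite z_mul ?leqnn ?andbT.
by rewrite (@z_out a b) ?mul0r //; lia.
Qed.

Lemma scale_dualE (a : nat) (x : A) (f : J a) y : (x *: f) y = f (y * x).
Proof. by []. Qed.

Lemma kscale_dualE (a : nat) (c : k) (f : J a) y : ((c%:A : A) *: f) y = c * f y.
Proof. by rewrite scale_dualE -scalerAr mulr1 dual_funZ. Qed.

Lemma dual_id (a : nat) (f : J a) y : f (z a a * y) = f y.
Proof. by rewrite -eE; have [_] := dual_modP f; apply. Qed.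

(** The functional sending x to the coefficient of z a b in e_a x e_b: these functionals
    form the basis of D(e_a A) dual to the z a b. *)
Lemma delta_ex a b : exists d : J a,
  [/\ forall x, z a a * x * z b b = d x *: z a b, z b b *: d = d,
      z a b = 0 -> d = 0 & z a b != 0 -> d (z a b) = 1].
Proof.
have [zab0|nz] := eqVneq (z a b) 0.
  exists 0; split=> [x|||] //; last by rewrite scaler0.
  by have [c ->] := z_sandwich a b x; rewrite zab0 !scaler0.
have inj c c' : c *: z a b = c' *: z a b -> c = c'.
  move=> /eqP; rewrite -subr_eq0 -scalerBl => /eqP E.
  apply/eqP; rewrite -subr_eq0; apply: contraNT nz => ncc.
  by rewrite -[z a b]scale1r -(mulVf ncc) -scalerA E scaler0.
have /choice[d Hd] : forall x, exists c : k, z a a * x * z b b = c *: z a b by apply: z_sandwich.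
have dual_d : is_dual (e a) d.
  apply/asboolP; split=> [c x y|y]; apply: inj; rewrite -Hd.
    by rewrite mulrDr mulrDl -scalerAr -scalerAl !Hd scalerA scalerDl.
  by rewrite eE mulrA z_idl Hd.
exists (DualMod dual_d); split=> [x||E|_]; first exact: Hd.
- apply: dual_mod_ext => x; apply: inj; rewrite -[dual_fun _ _]/(d (x * z b b)) -!Hd.
  by rewrite -!mulrA z_idr.
- by rewrite E eqxx in nz.
by apply: inj; rewrite -[dual_fun _ _]/(d _) -Hd z_idl z_idr scale1r.
Qed.

Definition delta a b : J a := sval (cid (delta_ex a b)).

Lemma deltaE a b x : z a a * x * z b b = delta a b x *: z a b.
Proof. by rewrite /delta; case: cid => d /= []. Qed.
Lemma delta_id a b : z b b *: delta a b = delta a b.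
Proof. by rewrite /delta; case: cid => d /= []. Qed.
Lemma delta0 a b : z a b = 0 -> delta a b = 0.
Proof. by rewrite /delta; case: cid => d /= []. Qed.
Lemma delta1 a b : z a b != 0 -> delta a b (z a b) = 1.
Proof. by rewrite /delta; case: cid => d /= []. Qed.

Lemma delta_span a (f : J a) :
  f = \sum_(i < n) ((f (z a i.+1))%:A : A) *: delta a i.+1.
Proof.
apply: dual_mod_ext => y.
have -> (s : seq 'I_n) (F : 'I_n -> J a) : (\sum_(i <- s) F i) y = \sum_(i <- s) F i y.
  exact: (big_morph (fun g : J a => g y)).
rewrite -dual_id.
have -> : z a a * y = \sum_(i < n) z a a * y * z i.+1 i.+1 by rewrite -mulr_sumr z_sum1 mulr1.
have -> (s : seq 'I_n) (F : 'I_n -> A) : f (\sum_(i <- s) F i) = \sum_(i <- s) f (F i).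
  by apply: (big_morph f); [apply: dual_funD | apply: dual_fun0].
by apply: eq_bigr => i _; rewrite deltaE dual_funZ kscale_dualE mulrC.
Qed.

Lemma dual_fg a : fin_gen (J a).
Proof.
exists n, (fun i => delta a i.+1) => f; exists (fun i => (f (z a i.+1))%:A).
exact: delta_span.
Qed.

Lemma dual_inj a : injective_mod (J a).
Proof. by apply: dual_injective => //; rewrite eE z_idl. Qed.

Section HomZ.
Variables a b : nat.
Lemma homz_dual (f : J a) : is_dual (e b) (fun y => f (z a b * y)).
Proof.
apply/asboolP; split=> [c x y|y]; last by rewrite (eE b) mulrA z_idr.
by rewrite mulrDr -scalerAr dual_funD dual_funZ.
Qed.
Lemma homz_linear : linear (fun f : J a => DualMod (homz_dual f)).
Proof.
move=> x f g; apply: dual_mod_ext => y.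
change (f (z a b * y * x) + g (z a b * y) = f (z a b * (y * x)) + g (z a b * y)).
by rewrite mulrA.
Qed.
Definition homz : {linear J a -> J b} := mk_linear homz_linear.
Lemma homzE f y : homz f y = f (z a b * y).
Proof. by []. Qed.
End HomZ.

Lemma homz_comp a b c (f : J a) : (a <= b <= c)%N -> homz b c (homz a b f) = homz a c f.
Proof. by move=> le; apply: dual_mod_ext => y; rewrite !homzE mulrA z_mul. Qed.

Lemma homz_id a (f : J a) : homz a a f = f.
Proof. by apply: dual_mod_ext => y; rewrite homzE dual_id. Qed.

Lemma homz_neq0 a b : ((1 <= a) && (a <= b) && (b <= n) && (b < a + r))%N ->
  homz a b (delta a b) != 0.
Proof.
move=> /z_neq0 nz; apply/eqP => /(congr1 (fun g : J b => g 1)).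
by rewrite homzE mulr1 delta1 //; apply/eqP; apply: oner_neq0.
Qed.

Lemma homz_out a b (f : J a) : ~~ ((1 <= a) && (a <= b) && (b <= n) && (b < a + r))%N ->
  homz a b f = 0.
Proof. by move=> /z_out z0; apply: dual_mod_ext => y; rewrite homzE z0 mul0r dual_fun0. Qed.

(** The value of h f at y is the value of h (e_b y f) at 1, and e_b D(e_a A) is spanned
    by delta a b; so h is determined by the value of h (delta a b) at 1. *)
Lemma hom_shape a b (h : {linear J a -> J b}) :
  exists c : k, forall f, h f = (c%:A : A) *: homz a b f.
Proof.
exists (h (delta a b) 1) => f; apply: dual_mod_ext => y.
rewrite kscale_dualE homzE -dual_id.
have -> : h f (z b b * y) =
  h ((z b b * y) *: f) 1 by rewrite linearZ -[RHS]/(h f (1 * (z b b * y))) mul1r.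
suff -> : (z b b * y) *: f = ((f (z a b * y))%:A : A) *: delta a b.
  by rewrite linear_kscale kscale_dualE mulrC.
apply: dual_mod_ext => x; rewrite [LHS]scale_dualE [RHS]kscale_dualE -[LHS]dual_id.
by rewrite !mulrA deltaE -scalerAl dual_funZ mulrC.
Qed.

(** The coefficient of z a a in e_a x e_a is multiplicative in x, because in
    e_a x y e_a = sum_c (e_a x e_c) (e_c y e_a) only c = a contributes. *)
Lemma char_ex a : exists c : achar A, forall y, z a a * y * z a a = c y *: z a a.
Proof.
suff H b : (1 <= b <= n)%N -> exists c : achar A, forall y, z b b * y * z b b = c y *: z b b.
  have [in_a|out_a] := boolP (1 <= a <= n)%N; first exact: H.
  have [|c _] := H 1%N; first by lia.
  by exists c => y; rewrite z_out ?scaler0 ?mulr0 //; lia.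
move=> in_b; have nz : z b b != 0 by apply: z_neq0; lia.
have inj c c' : c *: z b b = c' *: z b b -> c = c'.
  move=> /eqP; rewrite -subr_eq0 -scalerBl => /eqP E.
  apply/eqP; rewrite -subr_eq0; apply: contraNT nz => ncc.
  by rewrite -[z b b]scale1r -(mulVf ncc) -scalerA E scaler0.
have lin c x y : delta b b (c *: x + y) = c * delta b b x + delta b b y.
  by rewrite dual_funD dual_funZ.
have one : delta b b 1 = 1.
  by rewrite -dual_id mulr1 delta1.
have mul x y : delta b b (x * y) = delta b b x * delta b b y.
  apply: inj; rewrite -deltaE.
  have -> : z b b * (x * y) * z b b =
      \sum_(i < n) (z b b * x * z i.+1 i.+1) * (z i.+1 i.+1 * y * z b b).
    transitivity (z b b * x * (\sum_(i < n) z i.+1 i.+1) * (y * z b b)).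
      by rewrite z_sum1 mulr1 !mulrA.
    rewrite mulr_sumr mulr_suml; apply: eq_bigr => i _.
    by rewrite -[in LHS](z_idl i.+1 i.+1) !mulrA.
  have lt : (b.-1 < n)%N by lia.
  have Eb : b.-1.+1 = b by lia.
  rewrite (bigD1 (Ordinal lt)) //= big1 ?addr0 => [|i ni].
    by rewrite Eb !deltaE -scalerAr -scalerAl z_idl scalerA mulrC.
  have nib : i.+1 != b by apply: contraNneq ni => E; apply/eqP/val_inj => /=; lia.
  rewrite !deltaE; have [lt1|ge1] := ltnP i.+1 b.
    by rewrite (z_out (a := b)) ?scaler0 ?mul0r //; lia.
  by rewrite (z_out (b := b)) ?scaler0 ?mulr0 //; lia.
exists (AChar lin mul one); exact: deltaE.
Qed.

Definition zchar a : achar A := sval (cid (char_ex a)).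
Lemma zcharE a y : z a a * y * z a a = zchar a y *: z a a.
Proof. by rewrite /zchar; case: cid. Qed.

Lemma delta_diag a : (1 <= a <= n)%N -> delta a a =1 zchar a.
Proof.
move=> in_a y; have nz : z a a != 0 by apply: z_neq0; lia.
have /eqP : delta a a y *: z a a = zchar a y *: z a a by rewrite -deltaE zcharE.
rewrite -subr_eq0 -scalerBl => /eqP E.
apply/eqP; rewrite -subr_eq0; apply: contraNT nz => ncc.
by rewrite -[z a a]scale1r -(mulVf ncc) -scalerA E scaler0.
Qed.

Section Generation.
Variables (P : cx A -> Prop).
Hypotheses (thP : thick P) (PJ : forall a, (1 <= a <= n)%N -> P (cx_stalk (J a))).

Let vert_idem a := z a.+1 a.+1.
Let chr a := zchar a.+1.

Lemma vert_idemM a b : vert_idem a * vert_idem b = if a == b then vert_idem a else 0.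
Proof.
by rewrite /vert_idem; case: eqP => [->|/eqP ne]; [rewrite z_idl | rewrite z_orth // eqSS].
Qed.

Lemma vert_idem_tri a b y : (b < a)%N -> vert_idem a * y * vert_idem b = 0.
Proof. by move=> lt; rewrite /vert_idem deltaE (@z_out a.+1) ?scaler0 //; lia. Qed.

(** Downward induction on the vertex: delta a a spans the socle of I_a, which is the
    simple module at a, and the delta a b with b > a span the quotient. *)
Lemma thick_zchar a : (a < n)%N -> P (cx_stalk (charmod (chr a))).
Proof.
move: {2}(n - a)%N (leqnn (n - a)) => d; elim: d a => [|d IH] a led lta; first by lia.
have nz : z a.+1 a.+1 != 0 by apply: z_neq0; lia.
have in_a : (1 <= a.+1 <= n)%N by lia.
pose v := delta a.+1 a.+1.
have vE y : y *: v = ((chr a y)%:A : A) *: v.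
  apply: dual_mod_ext => x; rewrite [LHS]scale_dualE [RHS]kscale_dualE !delta_diag //.
  by rewrite achM mulrC.
have nv : v != 0.
  by apply/eqP => E; have := delta1 nz; rewrite -/v E => /eqP; rewrite eq_sym oner_eq0.
pose L := iota a.+1 (n - a.+1).
apply: (@thick_char _ _ chr P thP a (J a.+1) v vE (map id L) nv (dual_fg _) (PJ in_a));
  last first.
  move=> b; rewrite map_id mem_iota => /andP[ltab ltb].
  by apply: IH; lia.
apply: (@homogeneous_filtered _ _ chr vert_idem n vert_idemM z_sum1 vert_idem_tri (fun a y =>
  zcharE a.+1 y) nat L id _
  (fun b => quot_map (line_sub vE) (delta a.+1 b.+1))).
- by move=> b; rewrite -linearZ delta_id.
- move=> y; have [f <-] := quot_map_surj y.
  exists (fun b => f (z a.+1 b.+1)); rewrite {1}(delta_span f) linear_sum.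
  rewrite -(big_mkord xpredT (fun b => quot_map (line_sub vE)
     (((f (z a.+1 b.+1))%:A : A) *: delta a.+1 b.+1))).
  rewrite (big_cat_nat (n := a.+1)) //= big_nat big1 ?add0r => [|b /andP[_ leb]].
    rewrite /index_iota; apply: eq_bigr => b _; exact: (linear_kscale (quot_map (line_sub vE))).
  have [->|nba] := eqVneq b a; first by apply/quot_line_eq0; exists (f (z a.+1 a.+1)).
  have -> : delta a.+1 b.+1 = 0 by apply: delta0; apply: z_out; lia.
  by rewrite scaler0; apply: (raddf0 (quot_map (line_sub vE))).
- by rewrite map_id; apply: iota_sorted.
Qed.

Lemma thick_inj X : is_Db X -> P X.
Proof.
exact: (@thick_all _ _ chr P thP vert_idem n vert_idemM z_sum1 vert_idem_tri (fun a y =>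
  zcharE a.+1 y) Afd thick_zchar).
Qed.
End Generation.
End DualModules.

(** * The complexes C(a, b) *)
Section ThreeTerm.
Variables (k : fieldType) (A : algType k) (n r u : nat) (z : nat -> nat -> A) (e : nat -> A).
Hypotheses (u_gt0 : (0 < u)%N) (len : (u <= n)%N) (lur : (u < r)%N) (lnr : (n < u + r)%N).
Hypothesis zB : interval_basis n r z e.

Local Notation J a := (dual_mod (e a)).
Local Notation homz := (homz zB).
Local Notation "c %:: x" := ((c%:A : A) *: x) (at level 40, left associativity).

(** The index 0 marks an absent term; with it the poset order and the existence of maps
    are treated uniformly, as in [left_lift] and [left_gt]. *)
Inductive left_term : nat -> forall M : lmodType A, {linear M -> J u} -> Prop :=
| left_none : left_term 0 (\0 : {linear mod0 A -> J u})
| left_some a (f : {linear J a -> J u}) : (1 <= a < u)%N -> (exists x, f x != 0) ->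
    left_term a f.

(** The index n + 1 marks an absent term. *)
Inductive right_term : nat -> forall M : lmodType A, {linear J u -> M} -> Prop :=
| right_none : right_term n.+1 (\0 : {linear J u -> mod0 A})
| right_some b (f : {linear J u -> J b}) : (u < b <= n)%N -> (exists x, f x != 0) ->
    right_term b f.

Lemma hom_zero a b (h : {linear J a -> J b}) x : (b < a)%N -> h x = 0.
Proof.
move=> lt; have [c ->] := hom_shape zB h; rewrite homz_out ?scaler0 //; lia.
Qed.

Lemma hom_scalar a b (f : {linear J a -> J b}) : (exists x, f x != 0) ->
  exists2 c : k, c != 0 & forall x, f x = c %:: homz a b x.
Proof.
move=> [x fx0]; have [c Hc] := hom_shape zB f; exists c => //.
by apply: contraNneq fx0 => c0; rewrite Hc c0 kscale0.
Qed.

Lemma hom_multiple a b (f g : {linear J a -> J b}) : (exists x, f x != 0) ->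
  exists c : k, forall x, g x = c %:: f x.
Proof.
move=> /hom_scalar[c nc Hc]; have [d Hd] := hom_shape zB g.
by exists (d / c) => x; rewrite Hc Hd kscaleA divfK.
Qed.

Lemma hom_comp_neq0 a b c (f : {linear J a -> J b}) (g : {linear J b -> J c}) :
  ((1 <= a) && (a <= b) && (b <= c) && (c <= n) && (c < a + r))%N ->
  (exists x, f x != 0) -> (exists x, g x != 0) -> exists x, g (f x) != 0.
Proof.
move=> H /hom_scalar[d nd Hd] /hom_scalar[d' nd' Hd'].
exists (delta zB a c); rewrite Hd' Hd linear_kscale homz_comp; last by lia.
have nz := @homz_neq0 _ _ _ _ _ _ zB a c.
by rewrite kscaleA; apply: contraNneq (nz _) => [/(kscale_eq0 (mulf_neq0 nd' nd)) -> //|]; lia.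
Qed.

Lemma hom_ex a b : ((1 <= a) && (a <= b) && (b <= n) && (b < a + r))%N ->
  exists x, homz a b x != 0.
Proof. by move=> H; exists (delta zB a b); apply: homz_neq0. Qed.

Section Left.
Variables (a a' : nat) (M M' : lmodType A) (f : {linear M -> J u}) (f' : {linear M' -> J u}).
Hypotheses (lf : left_term a f) (lf' : left_term a' f').

Lemma left_from (h : {linear J u -> M}) x : h x = 0.
Proof.
by case: lf h => [h|b g /andP[_ lt] _ h]; [apply: mod0_zero | apply: hom_zero].
Qed.

Lemma left_multiple (s : {linear M -> J u}) : exists c : k, forall x, s x = c %:: f x.
Proof.
case: lf s => [s|b g _ ng s]; last exact: hom_multiple.
by exists 0 => x; rewrite [x]mod0_zero !raddf0 ?scaler0.
Qed.

Lemma left_lift : (a <= a')%N -> exists m : {linear M -> M'}, forall x, f' (m x) = f x.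
Proof.
case: lf => [_|b g lb ng]; first by exists \0 => x; rewrite raddf0.
case: lf' => [|b' g' lb' ng' le]; first by lia.
have [|c Hc] := @hom_multiple _ _ (g' \o homz b b') g.
  by apply: hom_comp_neq0 => //; [|apply: hom_ex]; lia.
by exists (khom c (homz b b')) => x; rewrite khomE linear_kscale Hc.
Qed.

Lemma left_cancel (m : {linear M -> M'}) : (forall x, f' (m x) = 0) -> forall x, m x = 0.
Proof.
case: lf m => [m _ x|b g lb ng]; first by rewrite [x]mod0_zero raddf0.
case: lf' => [m _ x|b' g' lb' ng' m H x]; first exact: mod0_zero.
apply/eqP; apply: contraTT isT => nx.
have [lt|le] := ltnP b' b; first by rewrite hom_zero ?eqxx in nx.
have [||y] := @hom_comp_neq0 _ _ _ m g' _ _ ng'; [lia | by exists x |].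
by rewrite H eqxx.
Qed.

Lemma left_gt : (a' < a)%N ->
  (forall (m : {linear M -> M'}) x, m x = 0) /\ exists x, f x != 0.
Proof.
case: lf => [//|b g lb ng]; case: lf' => [|b' g' lb' ng'] lt; split=> // m x.
  exact: mod0_zero.
exact: hom_zero.
Qed.
End Left.

Section Right.
Variables (b b' : nat) (M M' : lmodType A) (f : {linear J u -> M}) (f' : {linear J u -> M'}).
Hypotheses (rf : right_term b f) (rf' : right_term b' f').

Lemma right_to (h : {linear M -> J u}) x : h x = 0.
Proof.
case: rf h x => [h x|c g /andP[lt _] _ h x]; last exact: hom_zero.
by rewrite [x]mod0_zero raddf0.
Qed.

Lemma right_multiple (s : {linear J u -> M}) : exists c : k, forall x, s x = c %:: f x.
Proof.
case: rf s => [s|c g _ ng s]; last exact: hom_multiple.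
by exists 0 => x; rewrite [LHS]mod0_zero [RHS]mod0_zero.
Qed.

Lemma right_lift : (b <= b')%N -> exists m : {linear M -> M'}, forall x, m (f x) = f' x.
Proof.
case: rf' => [_|c' g' lc' ng']; first by exists \0.
case: rf => [|c g lc ng le]; first by lia.
have [|d Hd] := @hom_multiple _ _ (homz c c' \o g) g'.
  by apply: hom_comp_neq0 => //; [|apply: hom_ex]; lia.
by exists (khom d (homz c c')) => x; rewrite khomE Hd.
Qed.

Lemma right_cancel (m : {linear M -> M'}) : (forall x, m (f x) = 0) -> forall x, m x = 0.
Proof.
case: rf m => [m _ x|c g lc ng]; first by rewrite [x]mod0_zero raddf0.
case: rf' => [m _ x|c' g' lc' ng' m H x]; first exact: mod0_zero.
apply/eqP; apply: contraTT isT => nx.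
have [lt|le] := ltnP c' c; first by rewrite hom_zero ?eqxx in nx.
have [||y] := @hom_comp_neq0 _ _ _ g m _ ng; [lia | by exists x |].
by rewrite H eqxx.
Qed.

Lemma right_gt : (b' < b)%N ->
  (forall (m : {linear M -> M'}) x, m x = 0) /\ exists x, f' x != 0.
Proof.
case: rf => [|c g lc ng]; case: rf' => [|c' g' lc' ng'] lt; try by lia.
  by split=> // m x; rewrite [x]mod0_zero raddf0.
by split=> // m x; apply: hom_zero.
Qed.
End Right.

Section LeftRight.
Variables (a a' b : nat) (M N : lmodType A) (f : {linear M -> J u}) (g : {linear J u -> N}).
Hypotheses (lf : left_term a f) (rg : right_term b g).

Lemma right_left (h : {linear N -> M}) x : h x = 0.
Proof.
case: rg h x => [h x|c g' lc _ h x]; first by rewrite [x]mod0_zero raddf0.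
by case: lf h => [h|c' f' lc' _ h]; [apply: mod0_zero | apply: hom_zero; lia].
Qed.

Lemma left_right_multiple (s : {linear M -> N}) : exists c : k, forall x, s x = c %:: g (f x).
Proof.
case: lf s => [s|c f' lc nf]; first by exists 0 => x; rewrite [x]mod0_zero !raddf0 ?scaler0.
case: rg => [s|c' g' lc' ng s]; first by exists 0 => x; rewrite [LHS]mod0_zero [RHS]mod0_zero.
have [lt|le] := ltnP c' (c + r).
  apply: (@hom_multiple _ _ (g' \o f')); apply: hom_comp_neq0 => //; lia.
exists 0 => x; have [d ->] := hom_shape zB s; rewrite homz_out ?scaler0 ?kscale0 //; lia.
Qed.

(** The hypothesis holds for the summands of T; the conclusion is what [tri_shift1]
    needs. *)
Lemma left_right_cases : [\/ (a <= a')%N, b = n.+1 | (b < a + r)%N] ->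
  [\/ (a <= a')%N, forall y : N, y = 0 | exists x, g (f x) != 0].
Proof.
case: lf => [_|c f' lc nf]; first by constructor 1.
case: rg => [_|c' g' lc' ng]; first by constructor 2; apply: mod0_zero.
case=> [le|E|lt]; [by constructor 1 | by lia | constructor 3].
by apply: hom_comp_neq0 => //; lia.
Qed.
End LeftRight.

Record triple := Triple {
  tri_l : nat; tri_r : nat; tri_M : lmodType A; tri_P : lmodType A;
  tri_f : {linear tri_M -> J u}; tri_g : {linear J u -> tri_P};
  tri_lf : left_term tri_l tri_f; tri_rg : right_term tri_r tri_g;
  tri_gf0 : forall x, tri_g (tri_f x) = 0 }.

Definition tri_cx (x : triple) : cx A := cx3 (@tri_gf0 x).

Definition tri_le (x y : triple) := ((tri_l x <= tri_l y) && (tri_r x <= tri_r y))%N.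

Lemma tri_Db x : is_Db (tri_cx x).
Proof.
have f0 : fin_gen (mod0 A) by apply: fin_gen_zero => y; apply: mod0_zero.
have fM : fin_gen (tri_M x).
  by case: (tri_lf x) => [|b f _ _]; [apply: f0 | apply: (dual_fg zB)].
have fP : fin_gen (tri_P x).
  by case: (tri_rg x) => [|b f _ _]; [apply: f0 | apply: (dual_fg zB)].
by apply: cx3_Db => //; apply: (dual_fg zB).
Qed.

Lemma mod0_injective : injective_mod (mod0 A).
Proof. by apply: zero_injective => y; apply: mod0_zero. Qed.

Lemma tri_injective x i : injective_mod (tri_cx x i).
Proof.
have iJ := dual_inj zB; have i0 := mod0_injective.
have iM : injective_mod (tri_M x).
  by case: (tri_lf x) => [|b f _ _]; [apply: i0 | apply: iJ].
have iP : injective_mod (tri_P x).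
  by case: (tri_rg x) => [|b f _ _]; [apply: i0 | apply: iJ].
by case: i => [[|[|i]]|[|i]] //=; apply: iJ.
Qed.

Section Maps.
Variables x y : triple.
Local Notation X := (tri_cx x).
Local Notation Y := (tri_cx y).

Lemma tri_map_scalar (p : cxmap X Y) :
  exists c : k, forall v, p (Posz 0) v = c %:: v :> J u.
Proof.
have [c Hc] := hom_shape zB (p (Posz 0) : {linear J u -> J u}).
by exists c => v; rewrite Hc homz_id.
Qed.

Lemma tri_map_eq0 (p : cxmap X Y) : (forall v, p (Posz 0) v = 0) -> forall i v, p i v = 0.
Proof.
move=> p0; case=> [[|[|i]]|[|i]] v; try exact: mod0_zero.
- exact: p0.
- apply: (right_cancel (tri_rg x) (tri_rg y)) v => v.
  by have := @cxmap_d _ _ _ _ p (Posz 0) v; rewrite /= => ->; rewrite p0 raddf0.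
- apply: (left_cancel (tri_lf x) (tri_lf y)) v => v.
  by have := @cxmap_d _ _ _ _ p (Negz 0) v; rewrite /= => <-.
Qed.

(** If a' < a then M -> M' vanishes although M -> J u does not, which forces the scalar
    on J u to be 0; the case b' < b is dual. *)
Lemma tri_map_nle (p : cxmap X Y) : ~~ tri_le x y -> forall i v, p i v = 0.
Proof.
move=> nle; apply: tri_map_eq0 => v; have [c Hc] := tri_map_scalar p.
rewrite Hc; suff -> : c = 0 by rewrite kscale0.
apply: contraNeq nle => nc; rewrite /tri_le.
have [le1|gt1] := leqP (tri_l x) (tri_l y); last first.
  have [m0 [w /eqP nw]] := left_gt (tri_lf x) (tri_lf y) gt1; case: nw.
  apply: (kscale_eq0 nc); have := @cxmap_d _ _ _ _ p (Negz 0) w; rewrite /= -Hc => ->.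
  by rewrite (m0 (p (Negz 0))) raddf0.
have [//|gt2] := leqP (tri_r x) (tri_r y).
have [m0 [w /eqP nw]] := right_gt (tri_rg x) (tri_rg y) gt2; case: nw.
apply: (kscale_eq0 nc); have := @cxmap_d _ _ _ _ p (Posz 0) w; rewrite /= Hc linear_kscale => <-.
exact: (m0 (p (Posz 1))).
Qed.

Lemma tri_map_ex : tri_le x y ->
  exists p : cxmap X Y, forall v, p (Posz 0) v = v :> J u.
Proof.
case/andP=> le1 le2; have [m Hm] := left_lift (tri_lf x) (tri_lf y) le1.
have [m' Hm'] := right_lift (tri_rg x) (tri_rg y) le2.
have H1 v : (idfun : {linear J u -> Y (Posz 0)}) (tri_f x v) = cx_d Y (Negz 0) (m v).
  by rewrite /= Hm.
have H2 v : m' (tri_g x v) = cx_d Y (Posz 0) ((idfun : {linear J u -> Y (Posz 0)}) v).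
  by rewrite Hm'.
by exists (@cx3_out _ _ _ _ _ _ _ (@tri_gf0 x) Y m idfun m' H1 H2 (fun=> erefl)).
Qed.

(** There are no nonzero maps from J u to a left term or from a right term to J u, hence
    no homotopies. *)
Lemma tri_null (p : cxmap X Y) : null_homotopic p -> forall i v, p i v = 0.
Proof.
case=> h Hh; apply: tri_map_eq0 => v; have := Hh (Negz 0) v; rewrite /= => ->.
rewrite (left_from (tri_lf y) (h (Negz 0))) raddf0 add0r.
exact: (right_to (tri_rg x) (h (Posz 0))).
Qed.

(** A chain map to the shift by 1 is given by multiples c f and d g' of structure maps
    of the source and of the target.  The homotopy -d on J u removes d g' and changes c
    into c + d.  If a <= a' the rest is removed by a homotopy between the left terms.  If
    g' f is not zero, the chain map condition gives c + d = 0.  If the right term of the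
    target is zero, the homotopy c on J u removes c f directly. *)
Lemma tri_shift1 (p : cxmap X (cx_shift Y 1)) :
  [\/ (tri_l x <= tri_l y)%N, tri_r y = n.+1 | (tri_r y < tri_l x + r)%N] -> null_homotopic p.
Proof.
move=> C.
have [c Hc] := left_multiple (tri_lf x) (p (Negz 0)).
have [d Hd] := right_multiple (tri_rg y) (p (Posz 0)).
have Ep v : tri_g y (((c + d)%:A : A) *: tri_f x v) = 0.
  have := @cxmap_d _ _ _ _ p (Negz 0) v; rewrite shift1_d /= Hd Hc => E.
  by rewrite kscaleDl raddfD /= 2!linear_kscale E linear_kscale addrN.
suff [m [b [Hm Hb]]] : exists (m : {linear tri_M x -> tri_M y}) (b : k),
    (forall v, p (Negz 0) v = - tri_f y (m v) + b %:: tri_f x v) /\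
    (forall v, p (Posz 0) v = - tri_g y (b %:: v)).
  (* The component h i starts in degree i + 1, and Negz 1 is the degree -2. *)
  pose h (i : int) : {linear X (i + 1) -> cx_shift Y 1 i} :=
    match i return {linear X (i + 1) -> Y (i + 1)} with
    | Negz 1 => m | Negz 0 => khom b idfun | _ => \0 end.
  exists h; case=> [[|[|i]]|[|[|i]]] v; try exact: etrans (mod0_zero _) (esym (mod0_zero _)).
  - by rewrite shift1_d; apply: etrans (Hb v) _; rewrite /= addr0.
  - by rewrite shift1_d; apply: etrans (Hm v) _.
  - rewrite shift1_d; have -> : v = 0 by apply: mod0_zero.
    by rewrite (raddf0 (p _)) (raddf0 (h _)) !(raddf0 (cx_d _ _)) (raddf0 (h _)) oppr0 addr0.
have [le|P0|[w nw]] := left_right_cases (tri_lf x) (tri_rg y) C.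
- have [m Hm] := left_lift (tri_lf x) (tri_lf y) le.
  exists (khom (- (c + d)) m), (- d); split=> v.
    by rewrite /= linear_kscale Hm Hc !kscaleNl opprK kscaleDl addrK.
  by rewrite Hd linear_kscale kscaleNl opprK.
- exists \0, c; split=> v; first by rewrite Hc /= raddf0 oppr0 add0r.
  by rewrite [LHS]P0 [RHS]P0.
- exists \0, c; split=> v; first by rewrite Hc /= raddf0 oppr0 add0r.
  have /eqP : c + d = 0.
    apply: contraNeq nw => ncd; apply/eqP; apply: (kscale_eq0 ncd).
    by rewrite -linear_kscale Ep.
  by rewrite Hd addrC addr_eq0 => /eqP ->; rewrite linear_kscale kscaleNl.
Qed.

(** The only component is a multiple of g' f, the boundary of the same multiple of f. *)
Lemma tri_shift2 (p : cxmap X (cx_shift Y 2)) : null_homotopic p.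
Proof.
have [c Hc] := left_right_multiple (tri_lf x) (tri_rg y) (p (Negz 0)).
pose h (i : int) : {linear X (i + 1) -> cx_shift Y 2 i} :=
  match i return {linear X (i + 1) -> Y (i + 2)} with
  | Negz 1 => khom c (tri_f x) | _ => \0 end.
exists h; case=> [[|[|i]]|[|[|i]]] v; try exact: etrans (mod0_zero _) (esym (mod0_zero _)).
- apply: etrans (Hc v) _;
  change (c %:: tri_g y (tri_f x v) = cx_d (cx_shift Y 2) (Negz 1) (c %:: tri_f x v) + 0).
  rewrite addr0 /=; symmetry; apply: etrans (@cx_tr_id _ _ Y (Posz 1) _ _) _.
  by rewrite exprD !expr1 mulrNN mulr1 scale1r linear_kscale.
- have -> : v = 0 by apply: mod0_zero.
  by rewrite (raddf0 (p _)) (raddf0 (h _)) !(raddf0 (cx_d _ _)) (raddf0 (h _)) addr0.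
Qed.

Lemma tri_shift_null (i : int) (p : cxmap X (cx_shift Y i)) : i != 0 ->
  [\/ (tri_l x <= tri_l y)%N, tri_r y = n.+1 | (tri_r y < tri_l x + r)%N] -> null_homotopic p.
Proof.
have i0 j (q : cxmap X (cx_shift Y j)) : (forall v, q (Negz 0) v = 0) ->
    (forall v, q (Posz 0) v = 0) -> (forall v, q (Posz 1) v = 0) -> null_homotopic q.
  move=> H1 H2 H3; apply: null_zero; case=> [[|[|l]]|[|l]] v //.
    by have -> : v = 0 by [apply: mod0_zero]; rewrite raddf0.
  by have -> : v = 0 by [apply: mod0_zero]; rewrite raddf0.
case: i p => [[|[|[|i]]]|[|[|i]]] p // _ C.
- exact: tri_shift1.
- exact: tri_shift2.
- by apply: i0 => v; apply: mod0_zero.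
- apply: i0 => v; first exact: mod0_zero.
    exact: (left_from (tri_lf y) (p (Posz 0))).
  exact: (right_to (tri_rg x) (p (Posz 1))).
- apply: i0 => v; try exact: mod0_zero.
  exact: (right_left (tri_lf y) (tri_rg x) (p (Posz 1))).
- by apply: i0 => v; apply: mod0_zero.
Qed.
End Maps.
End ThreeTerm.

(** * The one-branch extension algebra *)
Section Branch.
Variables (k : fieldType) (u v : nat) (u_gt0 : (0 < u)%N).
Local Notation V := (branch_vert u v).
Local Notation Q := (branch_quiver u v).
Local Notation BQ := (one_branch k v u_gt0).
Local Notation B := (bqalg BQ).

(** The keys of a vertex are the indices (a, b) of the corresponding summand C(a, b). *)
Definition left_key (x : V) : nat :=
  match x with inl (inl i) => i | inl (inr i) => i | inr _ => 0 end.
Definition right_key (x : V) : nat :=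
  match x with inl (inl i) => u + v + 1 + i | inl (inr _) => (2 * u + v).+1
  | inr i => u.+1 + i end.
Definition key_le (x y : V) : bool :=
  ((left_key x <= left_key y) && (right_key x <= right_key y))%N.

(** Strictly increasing along arrows, which makes it the measure for inductions along
    paths. *)
Definition key_sum (x : V) : nat := left_key x + right_key x.

Lemma key_le_refl x : key_le x x.
Proof. by rewrite /key_le !leqnn. Qed.

Lemma key_le_trans x y z : key_le x y -> key_le y z -> key_le x z.
Proof. by rewrite /key_le; lia. Qed.

Lemma branch_arrow_key_le x y : branch_arrow x y -> key_le x y && (key_sum x < key_sum y)%N.
Proof.
case: x y => [[i|i]|i] [[j|j]|j] //=; rewrite /key_le /key_sum /=;
  have := ltn_ord i; have := ltn_ord j; try by lia.
by move=> _ lt /eqP <-; lia.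
Qed.

Lemma is_qpath_key_le (x : vert Q) (s : seq (arrow Q)) : is_qpath x s ->
  key_le x (last x (map (@tgt Q) s)) && ((s != [::]) ==> (key_sum x < key_sum (last x (map
    (@tgt Q) s)))%N).
Proof.
elim: s x => [|a s IH] x; first by rewrite /= key_le_refl.
case/andP=> /eqP <- /IH /andP[le _].
have /andP[lea lta] : key_le (src a) (tgt a) && (key_sum (src a) < key_sum (tgt a))%N.
  exact: branch_arrow_key_le (valP a).
move: le; rewrite [map _ _]/= [last (src a) _]/=; set y := last _ _ => le.
rewrite (key_le_trans lea le) -[_ && _]/(key_sum (src a) < key_sum y)%N.
by move: le lta; rewrite /key_le /key_sum; lia.
Qed.

Lemma path_key_le (p : qpath Q) : key_le (psrc p) (ptgt p).
Proof. by case: p => [[x s] H]; have /andP[] := is_qpath_key_le H. Qed.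

Lemma branch_step x y : key_le x y -> x != y -> exists2 z, branch_arrow x z & key_le z y.
Proof.
case: x y => [[i|i]|i] [[j|j]|j]; rewrite /key_le /= => le ne.
- have lt : (i < j)%N.
    by rewrite ltn_neqAle; apply/andP; split; [apply: contraNneq ne => /val_inj -> | lia].
  have lt' : (i.+1 < u)%N by have := ltn_ord j; lia.
  by exists (vt v (Ordinal lt')); rewrite /=; lia.
- have [E|ne'] := eqVneq i j.
    by exists (vb v i); rewrite /= ?E //; lia.
  have lt : (i < j)%N.
    by rewrite ltn_neqAle; apply/andP; split; [apply: contraNneq ne' => /val_inj -> | lia].
  have lt' : (i.+1 < u)%N by have := ltn_ord j; lia.
  by exists (vt v (Ordinal lt')); rewrite /=; lia.
- by have := ltn_ord j; lia.
- by have := ltn_ord j; lia.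
- have lt : (i < j)%N.
    by rewrite ltn_neqAle; apply/andP; split; [apply: contraNneq ne => /val_inj -> | lia].
  have lt' : (i.+1 < u)%N by have := ltn_ord j; lia.
  by exists (vb v (Ordinal lt')); rewrite /=; lia.
- by have := ltn_ord j; lia.
- have [lt|ge] := ltnP i.+1 v; first by exists (vc u (Ordinal lt)); rewrite /=; lia.
  by have := ltn_ord i; exists (vt v (Ordinal u_gt0)); rewrite /= /key_le /=; lia.
- have [lt|ge] := ltnP i.+1 v; first by exists (vc u (Ordinal lt)); rewrite /=; lia.
  by have := ltn_ord i; exists (vt v (Ordinal u_gt0)); rewrite /= /key_le /=; lia.
- have lt : (i < j)%N.
    by rewrite ltn_neqAle; apply/andP; split; [apply: contraNneq ne => /val_inj -> | lia].
  have lt' : (i.+1 < v)%N by have := ltn_ord j; lia.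
  by exists (vc u (Ordinal lt')); rewrite /=; lia.
Qed.

Lemma branch_pathto x y : @pathto Q x y <-> key_le x y.
Proof.
split=> [[p [<- <-]]|]; first exact: path_key_le.
move: {2}(key_sum y - key_sum x)%N (leqnn (key_sum y - key_sum x)) => d;
  elim: d x => [|d IH] x led le.
  have [->|ne] := eqVneq x y; first exact: pathto_refl.
  have [w /branch_arrow_key_le/andP[_ lt] lew] := branch_step le ne.
  by move: lew led lt; rewrite /key_le /key_sum; lia.
have [->|ne] := eqVneq x y; first exact: pathto_refl.
have [w aw lew] := branch_step le ne.
pose a : arrow Q := @Sub _ _ {xy : V * V | branch_arrow xy.1 xy.2} (x, w) aw.
apply: (@pathto_trans Q x w y); first exact: (pathto_arrow a).
apply: IH => //; have /andP[_ lt] := branch_arrow_key_le aw.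
by move: led lt; lia.
Qed.

Definition apath (a : arrow Q) : qpath Q.
Proof. by refine (@QPath Q (src a, [:: a]) _); rewrite /= eqxx. Defined.

Local Notation cl p := (@bqpi k BQ (@pelt k Q p)).

Lemma comp_path (p q : qpath Q) : ptgt q = psrc p ->
  exists r : qpath Q, [/\ val r = (psrc q, parrows q ++ parrows p), psrc r = psrc q,
    ptgt r = ptgt p & cl r = cl p * cl q].
Proof.
move=> E; have [r Er Vr] := pcompT E; exists r; split=> //; first by rewrite /psrc Vr.
  by rewrite (ptgt_cat Vr) E.
by rewrite -bqpiMr -[_ * _]/(pmul _ _) pmulUU /pbasis Er.
Qed.

Lemma path_cons (p : qpath Q) : psrc p != ptgt p -> exists (a : arrow Q) (q : qpath Q),
  [/\ src a = psrc p, psrc q = tgt a, ptgt q = ptgt p & cl p = cl q * cl (apath a)].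
Proof.
case: p => [[x [|a s]] H]; first by rewrite eqxx.
move=> _; have /= /andP[/eqP Ea Hs] := H; exists a, (@QPath Q (tgt a, s) Hs); split=> //.
rewrite -bqpiMr -[_ * _]/(pmul _ _) pmulUU /pbasis.
have [r -> Vr] := @pcompT Q (@QPath Q (tgt a, s) Hs) (apath a) erefl.
by congr (bqpi (pelt k _)); apply: val_inj; rewrite Vr; congr (_, _); exact: esym Ea.
Qed.

Lemma closed_path (p : qpath Q) : psrc p = ptgt p -> p = ptriv (psrc p).
Proof.
case: p => [[x [|a s]] H] E; first exact: val_inj.
by have /andP[_ /=] := is_qpath_key_le H; rewrite -[last _ _]/(ptgt (QPath H)) -E ltnn.
Qed.

Lemma arrow_inj (a b : arrow Q) : src a = src b -> tgt a = tgt b -> a = b.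
Proof.
move=> Es Et; apply: val_inj.
by rewrite [val a]surjective_pairing [val b]surjective_pairing; congr (_, _).
Qed.

Lemma square_comm (i j : 'I_u) (a b c d : arrow Q) : j = i.+1 :> nat ->
  val a = (vt v i, vt v j) -> val b = (vt v j, vb v j) ->
  val c = (vt v i, vb v i) -> val d = (vb v i, vb v j) ->
  cl (apath b) * cl (apath a) = cl (apath d) * cl (apath c).
Proof.
move=> Eij Ea Eb Ec Ed.
have tr (w : arrow Q) x y : val w = (x, y) -> src w = x /\ tgt w = y.
  by move=> E; rewrite /src /tgt /= E.
have [[sa ta] [sb tb]] := (tr _ _ _ Ea, tr _ _ _ Eb).
have [[sc tc] [sd td]] := (tr _ _ _ Ec, tr _ _ _ Ed).
have [|p [Vp _ _ <-]] := @comp_path (apath b) (apath a).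
  by rewrite -[ptgt _]/(tgt a) -[psrc _]/(src b) ta sb.
have [|q [Vq _ _ <-]] := @comp_path (apath d) (apath c).
  by rewrite -[ptgt _]/(tgt c) -[psrc _]/(src d) tc sd.
apply/bqpi_eq/bq_idealP => J HJ; apply; exists i, j, p, q; split=> //.
  have -> : ptrace p = [:: src a; tgt a; tgt b] by rewrite /ptrace /psrc /parrows Vp.
  by rewrite sa ta tb.
have -> : ptrace q = [:: src c; tgt c; tgt d] by rewrite /ptrace /psrc /parrows Vq.
by rewrite sc tc td.
Qed.

Definition mk_arrow (x y : V) (H : branch_arrow x y) : arrow Q :=
  @Sub _ _ {xy : V * V | branch_arrow xy.1 xy.2} (x, y) H.

(** Two parallel paths start with the same arrow, or with the two arrows of a square
    leaving t_i.  In the second case both rests can be replaced, by induction, by paths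
    through b_(i+1), and then the commutativity relation of that square applies. *)
Lemma branch_par (p q : qpath Q) : psrc p = psrc q -> ptgt p = ptgt q -> cl p = cl q.
Proof.
have [d] := ubnP (key_sum (ptgt p) - key_sum (psrc p))%N.
elim: d p q => // d IH p q ltd Es Et.
have [E|ne] := eqVneq (psrc p) (ptgt p).
  by rewrite (closed_path E) (@closed_path q) ?Es // -Es E.
have [a [p' [sa sp' tp' ->]]] := path_cons ne.
have [|b [q' [sb sq' tq' ->]]] := @path_cons q; first by rewrite -Es -Et.
(* The induction hypothesis applies after one arrow. *)
have up (c : arrow Q) : src c = psrc p -> key_le (tgt c) (ptgt p) ->
    (key_sum (ptgt p) - key_sum (tgt c) < d)%N.
  move=> sc; have /andP[lec ltc] : key_le (src c) (tgt c) && (key_sum (src c) < key_sum (tgt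
    c))%N.
    exact: branch_arrow_key_le (valP c).
  by move: ltc ltd; rewrite sc /key_le /key_sum; lia.
have lea : key_le (tgt a) (ptgt p) by rewrite -sp' -tp'; apply: path_key_le.
have leb : key_le (tgt b) (ptgt p) by rewrite -sq' Et -tq'; apply: path_key_le.
have [Eab|nab] := eqVneq (tgt a) (tgt b).
  have <- : a = b by apply: arrow_inj; rewrite // sa sb.
  congr (_ * _); apply: IH; rewrite ?tp' ?sp' ?up // ?sq' ?tq' //.
have cross (a0 b0 : arrow Q) (p0 q0 : qpath Q) (i : 'I_u) (j : 'I_u) : j = i.+1 :> nat ->
    src a0 = psrc p -> src b0 = psrc p -> psrc p0 = tgt a0 -> ptgt p0 = ptgt p ->
    psrc q0 = tgt b0 -> ptgt q0 = ptgt p ->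
    val a0 = (vt v i, vt v j) -> val b0 = (vt v i, vb v i) -> key_le (vb v j) (ptgt p) ->
    cl p0 * cl (apath a0) = cl q0 * cl (apath b0).
  move=> Eij sa0 sb0 sp0 tp0 sq0 tq0 Ea Eb lew.
  have Hb' : branch_arrow (vt v j) (vb v j) by rewrite /=.
  have Hd' : branch_arrow (vb v i) (vb v j) by rewrite /= Eij.
  have ta : tgt a0 = vt v j by rewrite /tgt /= Ea.
  have tb : tgt b0 = vb v i by rewrite /tgt /= Eb.
  have /branch_pathto[w [sw tw]] := lew.
  have [|r1 [_ sr1 tr1 Er1]] := @comp_path w (apath (mk_arrow Hb')); first by rewrite sw.
  have [|r2 [_ sr2 tr2 Er2]] := @comp_path w (apath (mk_arrow Hd')); first by rewrite sw.
  have -> : cl p0 = cl r1.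
    apply: IH; rewrite ?tp0 ?sp0 ?sr1 ?tr1 ?tw ?ta //.
    by rewrite -ta up // ta; move: lew; rewrite /key_le /=; have := ltn_ord j; lia.
  have -> : cl q0 = cl r2.
    apply: IH; rewrite ?tq0 ?sq0 ?sr2 ?tr2 ?tw ?tb //.
    by rewrite -tb up // tb; move: lew; rewrite /key_le /=; lia.
  by rewrite Er1 Er2 -!mulrA (@square_comm i j a0 (mk_arrow Hb') b0 (mk_arrow Hd') Eij Ea erefl
    Eb erefl).
have tqp : ptgt q' = ptgt p by rewrite tq' Et.
have sbp : src b = psrc p by rewrite sb Es.
have Ha : branch_arrow (psrc p) (tgt a) by rewrite -sa; apply: (valP a).
have Hb : branch_arrow (psrc p) (tgt b) by rewrite Es -sb; apply: (valP b).
have va : val a = (psrc p, tgt a) by rewrite -sa [LHS]surjective_pairing.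
have vb' : val b = (psrc p, tgt b) by rewrite Es -sb [LHS]surjective_pairing.
case: (psrc p) (tgt a) (tgt b) Ha Hb va vb' lea leb nab
  => [[i|i]|i] [[j|j]|j] [[l|l]|l] //= Ha Hb va vb' lea leb nab.
- by case/eqP: nab; congr (inl (inl _)); apply: val_inj; rewrite /= (eqP Ha) (eqP Hb).
- move/eqP in Hb; rewrite -Hb in vb'.
  apply: (cross a b p' q' i j) => //; first exact/eqP.
  by move: lea leb; rewrite /key_le /=; have := ltn_ord j; lia.
- move/eqP in Ha; rewrite -Ha in va.
  apply/esym; apply: (cross b a q' p' i l) => //; first exact/eqP.
  by move: lea leb; rewrite /key_le /=; have := ltn_ord l; lia.
- by case/eqP: nab; rewrite -(eqP Ha) -(eqP Hb).
- by case/eqP: nab; congr (inl (inr _)); apply: val_inj; rewrite /= (eqP Ha) (eqP Hb).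
- by case/eqP: nab; congr (inl (inl _)); apply: val_inj;
  move: Ha Hb => /= /andP[_ /eqP->] /andP[_ /eqP->].
- by move: Ha Hb; have := ltn_ord l; lia.
- by move: Ha Hb; have := ltn_ord j; lia.
- by case/eqP: nab; congr (inr _); apply: val_inj; rewrite /= (eqP Ha) (eqP Hb).
Qed.

(** The relations are differences of parallel paths, so they have zero counts;
    conversely, a class is the combination of path classes given by its counts. *)
Lemma branch_ideal_path_count x : (x \in @bq_ideal k BQ) <-> forall s t, @path_count k Q s t x
  = 0.
Proof.
split=> [/bq_idealP Ix|H]; last first.
  have -> : x = x - 0 by rewrite subr0.
  apply/(@bqpi_eq k BQ); rewrite bqpi0 (@bqpi_path_class k BQ branch_par).
  by rewrite big1 // => s _; rewrite big1 // => t _; rewrite (H s t) scale0r.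
apply: (Ix (fun x => forall s t, @path_count k Q s t x = 0)).
  split=> [s t|y y' Hy Hy' s t|a y Hy s t|a y Hy s t].
  - exact: path_count0.
  - by rewrite path_countD Hy Hy' addr0.
  - by rewrite path_countM big1 // => w _; rewrite Hy mulr0.
  - by rewrite path_countM big1 // => w _; rewrite Hy mul0r.
move=> _ [i [j [p [q [_ Tp Tq ->]]]]] s t; rewrite path_countD path_countN !path_count_elt.
have E (r : qpath Q) : psrc r = head (psrc r) (ptrace r) /\ ptgt r = last (psrc r) (ptrace r).
  by [].
have [[-> ->] [-> ->]] := (E p, E q).
by rewrite Tp Tq subrr.
Qed.

Definition branch_count (s t : V) (a : B) : k := @path_count k Q s t (repr a).

Lemma branch_count_bqpi s t x : branch_count s t (bqpi x) = @path_count k Q s t x.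
Proof.
apply: (@path_count_bqpi k BQ); last exact: bqpiK.
by move=> y /branch_ideal_path_count.
Qed.

Lemma branch_countD s t a b : branch_count s t (a + b) = branch_count s t a + branch_count s t b.
Proof. by rewrite -{1}[a]bqpiK -{1}[b]bqpiK -bqpiD branch_count_bqpi path_countD. Qed.

Lemma branch_countZ s t c a : branch_count s t (c *: a) = c * branch_count s t a.
Proof. by rewrite -{1}[a]bqpiK -bqpiZr branch_count_bqpi path_countZ. Qed.

Lemma branch_countM s t a b : branch_count s t (a * b) =
  \sum_w branch_count w t a * branch_count s w b.
Proof. by rewrite -{1}[a]bqpiK -{1}[b]bqpiK -bqpiMr branch_count_bqpi path_countM. Qed.

Lemma branch_count1 s t : branch_count s t 1 = (s == t)%:R.
Proof. by rewrite -bqpi1 branch_count_bqpi path_count1. Qed.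

Lemma branch_count_nle s t a : ~~ key_le s t -> branch_count s t a = 0.
Proof. by move=> nle; apply: path_count_nopath => /branch_pathto; apply/negP. Qed.

Lemma branch_count_inj a b : (forall s t, branch_count s t a = branch_count s t b) -> a = b.
Proof.
move=> E; rewrite -[a]bqpiK -[b]bqpiK; apply/bqpi_eq/branch_ideal_path_count => s t.
by rewrite path_countD path_countN [X in X - _]E subrr.
Qed.

Lemma branch_count_surj (c : V -> V -> k) : (forall s t, ~~ key_le s t -> c s t = 0) ->
  exists a, forall s t, branch_count s t a = c s t.
Proof.
move=> c0; have /choice[P HP] : forall q : V * V, exists p : qpath Q,
    key_le q.1 q.2 -> psrc p = q.1 /\ ptgt p = q.2.
  move=> [s t]; have [|nle] := boolP (key_le s t); last by exists (ptriv (s : vert Q)).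
  by move=> /branch_pathto[p Hp]; exists p.
exists (bqpi (\sum_(q : V * V) c q.1 q.2 *: pelt k (P q) : pathalg k BQ)) => s t.
rewrite branch_count_bqpi path_count_sum (bigD1 (s, t)) //= big1 ?addr0 => [|[s' t'] ne].
  rewrite path_countZ; have [le|nle] := boolP (key_le s t); last by rewrite c0 // mul0r.
  by rewrite path_count_elt; have [-> ->] := HP (s, t) le; rewrite !eqxx mulr1.
rewrite path_countZ; have [le|nle] := boolP (key_le s' t'); last by rewrite c0 // mul0r.
rewrite path_count_elt; have [-> ->] := HP (s', t') le.
by move: ne; rewrite xpair_eqE /= => /negPf->; rewrite mulr0.
Qed.
End Branch.

(** * Finite direct sums of complexes *)
Section Decompositions.
Variables (k : fieldType) (A : algType k).
Local Notation cx := (cx A).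
Implicit Types X Y Z T : cx.

Lemma sum_cxmapE X Y (I : Type) (s : seq I) (F : I -> cxmap X Y) i x :
  (\big[@cxmap_add _ _ X Y/cxmap_zero X Y]_(j <- s) F j) i x = \sum_(j <- s) F j i x.
Proof. by elim: s => [|j s IH]; rewrite ?big_nil // !big_cons /= IH. Qed.

Lemma null_sum X Y (I : Type) (s : seq I) (F : I -> cxmap X Y) :
  (forall j, null_homotopic (F j)) ->
    null_homotopic (\big[@cxmap_add _ _ X Y/cxmap_zero X Y]_(j <- s) F j).
Proof.
move=> H; elim: s => [|j s IH]; first by rewrite big_nil; apply: null_zero.
by rewrite big_cons; apply: null_add.
Qed.

Section BiprodMaps.
Variables X Y : cx.

Definition bi_inl : cxmap X (cx_biprod X Y).
Proof.
refine (@CxMap _ _ X (cx_biprod X Y) (fun i => lin_inl (X i) (Y i)) _).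
by move=> i x /=; congr (_, _) => /=; rewrite raddf0.
Defined.
Definition bi_inr : cxmap Y (cx_biprod X Y).
Proof.
refine (@CxMap _ _ Y (cx_biprod X Y) (fun i => lin_inr (X i) (Y i)) _).
by move=> i x /=; congr (_, _) => /=; rewrite raddf0.
Defined.
Definition bi_fst : cxmap (cx_biprod X Y) X.
Proof.
by refine (@CxMap _ _ (cx_biprod X Y) X (fun i => lin_fst (X i) (Y i)) _) => i x.
Defined.
Definition bi_snd : cxmap (cx_biprod X Y) Y.
Proof.
by refine (@CxMap _ _ (cx_biprod X Y) Y (fun i => lin_snd (X i) (Y i)) _) => i x.
Defined.

Lemma biprod_Db : is_Db X -> is_Db Y -> is_Db (cx_biprod X Y).
Proof.
move=> [[N HN] fX] [[M HM] fY]; split=> [|i]; last exact: fin_gen_prod.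
exists (maxn N M) => i; rewrite gtn_max => /andP[ltN ltM] [x y].
by congr (_, _); [apply: HN | apply: HM].
Qed.
End BiprodMaps.

Section Thick.
Variables (P : cx -> Prop) (thP : thick P).

Lemma thick_biprod_r X Y : is_Db X -> is_Db Y -> P (cx_biprod X Y) -> P Y.
Proof.
move=> DX DY PXY; apply: (thick_summand thP DY DX).
pose f i : {linear cx_biprod X Y i -> cx_biprod Y X i} :=
  (lin_inl _ _ \o lin_snd _ _) \+ (lin_inr _ _ \o lin_fst _ _).
have fd i x : f (i + 1) (cx_d (cx_biprod X Y) i x) = cx_d (cx_biprod Y X) i (f i x).
  by case: x => x y; rewrite /f /=; congr (_, _) => /=; rewrite ?addr0 ?add0r.
apply/(thick_iso thP (f := CxMap fd)) => //; try exact: biprod_Db.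
  move=> i [x y] [x' y'] /= [].
  by rewrite !addr0 !add0r => -> ->.
by move=> i [x y]; exists (y, x); rewrite /f /=; congr (_, _) => /=; rewrite ?addr0 ?add0r.
Qed.

Lemma thick_big (I : eqType) (s : seq I) (C : I -> cx) :
  (forall i, i \in s -> is_Db (C i)) ->
  is_Db (\big[@cx_biprod _ _/cx_zero A]_(i <- s) C i) /\
  (P (\big[@cx_biprod _ _/cx_zero A]_(i <- s) C i) -> forall i, i \in s -> P (C i)).
Proof.
elim: s => [|j s IH] DC.
  by rewrite big_nil; split=> //; apply: (thick_Db thP); apply: thick_zero.
have [|Ds Hs] := IH; first by move=> i Hi; apply: DC; rewrite inE Hi orbT.
have Dj : is_Db (C j) by apply: DC; rewrite mem_head.
rewrite big_cons; split=> [|PT i]; first exact: biprod_Db.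
rewrite inE => /orP[/eqP->|]; first exact: (thick_summand thP Dj Ds).
by apply: Hs; apply: thick_biprod_r PT.
Qed.
End Thick.

Section Decomp.
Variables (I : eqType) (C : I -> cx).

(** Inclusions and projections are given for all indices, not only for those in s, so
    that lists can be concatenated without a subtype of indices. *)
Definition decomp (T : cx) (s : seq I) (inc : forall i, cxmap (C i) T)
    (prj : forall i, cxmap T (C i)) : Prop :=
  [/\ forall i, i \in s -> forall l x, prj i l (inc i l x) = x,
      forall i j, i != j -> forall l x, prj i l (inc j l x) = 0
    & forall l x, x = \sum_(i <- s) inc i l (prj i l x)].

Lemma decomp_nil : exists inc prj, @decomp (cx_zero A) [::] inc prj.
Proof.
exists (fun i => cxmap_zero _ _), (fun i => cxmap_zero _ _); split=> // l x.
by rewrite big_nil; case: l x => [[|[|l]]|[|l]] x; apply: mod0_zero.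
Qed.

Lemma decomp_cons i s (T : cx) : i \notin s ->
  (exists inc prj, @decomp T s inc prj) ->
  exists inc prj, @decomp (cx_biprod (C i) T) (i :: s) inc prj.
Proof.
move=> nis [inc [prj [H1 H2 H3]]].
pose cast j (e : j = i) : cxmap (C j) (C i) :=
  match e in _ = i' return cxmap (C j) (C i') with erefl => cxmap_id _ end.
pose cast' j (e : j = i) : cxmap (C i) (C j) :=
  match e in _ = i' return cxmap (C i') (C j) with erefl => cxmap_id _ end.
pose inc' j : cxmap (C j) (cx_biprod (C i) T) :=
  match pselect (j = i) with
  | left e => cxmap_comp (bi_inl _ _) (cast j e)
  | right _ => cxmap_comp (bi_inr _ _) (inc j) end.
pose prj' j : cxmap (cx_biprod (C i) T) (C j) :=
  match pselect (j = i) with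
  | left e => cxmap_comp (cast' j e) (bi_fst _ _)
  | right _ => cxmap_comp (prj j) (bi_snd _ _) end.
have nid j : j \in s -> j <> i by move=> js ji; move: nis; rewrite -ji js.
exists inc', prj'; split=> [j|j j' ne l x|l [a b]].
- rewrite inE => /orP[/eqP->|js] l x; rewrite /inc' /prj'; case: pselect => // e.
  + by rewrite (Prop_irrelevance e erefl).
  + by case: (nid j js).
  + exact: H1.
- rewrite /inc' /prj'; case: pselect => e; case: pselect => e' //=.
  + by rewrite e e' eqxx in ne.
  + by rewrite raddf0.
  + by rewrite raddf0.
  + exact: H2.
- have inc'i : inc' i l (prj' i l (a, b)) = (a, 0).
    rewrite /inc' /prj'; case: pselect => // e.
    by rewrite (Prop_irrelevance e erefl).
  rewrite big_cons {}inc'i {1}(H3 l b).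
  have -> : (a, \sum_(j <- s) inc j l (prj j l b)) =
      (a, 0) + \sum_(j <- s) (lin_inr (C i l) (T l) (inc j l (prj j l b))) :> (C i l * T l)%type.
    by rewrite -linear_sum /=; congr (_, _) => /=; rewrite ?addr0 ?add0r.
  congr (_ + _); rewrite 2!big_seq; apply: eq_bigr => j /nid nji.
  by rewrite /inc' /prj'; case: pselect.
Qed.

Lemma decomp_big (s : seq I) : uniq s ->
  exists inc prj, @decomp (\big[@cx_biprod _ _/cx_zero A]_(i <- s) C i) s inc prj.
Proof.
elim: s => [_|i s IH] /=; first by rewrite big_nil; apply: decomp_nil.
by case/andP=> nis us; rewrite big_cons; apply: decomp_cons => //; apply: IH.
Qed.

Lemma decomp_biprod s s' (T T' : cx) : (forall i, i \in s -> i \notin s') ->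
  (exists inc prj, @decomp T s inc prj) -> (exists inc prj, @decomp T' s' inc prj) ->
  exists inc prj, @decomp (cx_biprod T T') (s ++ s') inc prj.
Proof.
move=> dis [inc [prj [H1 H2 H3]]] [inc2 [prj2 [H1' H2' H3']]].
pose inc' j : cxmap (C j) (cx_biprod T T') := if j \in s
  then cxmap_comp (bi_inl _ _) (inc j) else cxmap_comp (bi_inr _ _) (inc2 j).
pose prj' j : cxmap (cx_biprod T T') (C j) := if j \in s
  then cxmap_comp (prj j) (bi_fst _ _) else cxmap_comp (prj2 j) (bi_snd _ _).
exists inc', prj'; split=> [j|j j' ne l x|l [a b]].
- rewrite mem_cat /inc' /prj'; case: ifP => [js _|_ /= js'] l x; first exact: H1.
  exact: H1'.
- rewrite /inc' /prj'; case: ifP => _; case: ifP => _ /=.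
  + exact: H2.
  + by rewrite raddf0.
  + by rewrite raddf0.
  + exact: H2'.
- rewrite big_cat /= {1}(H3 l a) {1}(H3' l b).
  transitivity (lin_inl (T l) (T' l) (\sum_(j <- s) inc j l (prj j l a)) +
                lin_inr (T l) (T' l) (\sum_(j <- s') inc2 j l (prj2 j l b))).
    by congr (_, _) => /=; rewrite ?addr0 ?add0r.
  rewrite !linear_sum; congr (_ + _); rewrite 2!big_seq; apply: eq_bigr => j js.
    by rewrite /inc' /prj' js.
  have /negPf njs : j \notin s by apply: contraL js; apply: dis.
  by rewrite /inc' /prj' njs.
Qed.
End Decomp.

Section Shift.
Variables (X Y : cx) (f : cxmap X Y) (n : int).
Definition shift_map : cxmap (cx_shift X n) (cx_shift Y n).
Proof.
refine (@CxMap _ _ (cx_shift X n) (cx_shift Y n) (fun i => f (i + n)) _).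
move=> i x /=.
have E (a b : int) (e : a = b) (y : X a) : f b (cx_tr X e y) = cx_tr Y e (f a y).
  by case: _ / e.
by rewrite E linearZ /= cxmap_d.
Defined.
End Shift.

Section OverFintype.
Variables (V : finType) (C : V -> cx) (T : cx).
Variables (inc : forall i, cxmap (C i) T) (prj : forall i, cxmap T (C i)).
Hypothesis H : decomp (index_enum V) inc prj.

Lemma prj_inc i l x : prj i l (inc i l x) = x.
Proof. by have [H1 _ _] := H; apply: H1; rewrite mem_index_enum. Qed.

Lemma decomp_null_homotopic n : (forall i j (p : cxmap (C i) (cx_shift (C j) n)),
  null_homotopic p) ->
  forall p : cxmap T (cx_shift T n), null_homotopic p.
Proof.
have [_ _ H3] := H => N p.
pose F (q : V * V) := cxmap_comp (cxmap_comp (shift_map (inc q.2) n)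
  (cxmap_comp (shift_map (prj q.2) n) (cxmap_comp p (inc q.1)))) (prj q.1).
apply: (@null_eq _ _ _ _ (\big[@cxmap_add _ _ _ _/cxmap_zero _ _]_(q : V * V) F q)).
  move=> i x; rewrite sum_cxmapE /F /=.
  rewrite -(pair_bigA _ (fun s t =>
    inc t (i + n) (prj t (i + n) (p i (inc s i (prj s i x)))))) /=.
  under eq_bigr => s _ do rewrite -H3.
  by rewrite -linear_sum -H3.
apply: null_sum => q; apply/null_compr/null_compl; exact: N.
Qed.

Lemma decomp_injective : (forall i l, injective_mod (C i l)) -> forall l, injective_mod (T l).
Proof.
have [_ _ H3] := H => iC l M N f g fN fg.
have Hex i : exists h : {linear N -> C i l}, forall x, h (f x) = prj i l (g x).
  apply: (iC i l M N f (prj i l \o g) fN) => x /fg /= ->.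
  by rewrite raddf0.
pose h i := sval (cid (Hex i)); have Hh i : forall x, h i (f x) = prj i l (g x).
  exact: svalP (cid (Hex i)).
have lin : linear (fun x => \sum_i inc i l (h i x)).
  move=> a x y; rewrite scaler_sumr -big_split; apply: eq_bigr => i _ /=.
  by rewrite !linearP.
exists (mk_linear lin) => x /=; rewrite [RHS]H3; apply: eq_bigr => i _.
by rewrite Hh.
Qed.

Lemma decomp_ext (f g : cxmap T T) :
  (forall i j l x, prj j l (f l (inc i l x)) = prj j l (g l (inc i l x))) -> cxmap_eq f g.
Proof.
have [_ _ H3] := H => E l x; rewrite [f l x]H3 [RHS]H3; apply: eq_bigr => j _.
congr (inc j l _); rewrite (H3 l x) !linear_sum; apply: eq_bigr => i _; exact: E.
Qed.
End OverFintype.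
End Decompositions.

(** * The endomorphism algebra *)
Section EndAlgebra.
Variables (k : fieldType) (u v : nat) (u_gt0 : (0 < u)%N) (v_gt0 : (0 < v)%N).
Local Notation n := (2 * u + v)%N.
Local Notation r := (u + v + 1)%N.
Variables (A : algType k) (z : nat -> nat -> A) (e : nat -> A).
Hypothesis zB : interval_basis n r z e.
Local Notation V := (branch_vert u v).
Local Notation B := (bqalg (one_branch k v u_gt0)).
Local Notation "c %:: x" := ((c%:A : A) *: x) (at level 40, left associativity).
Local Notation Ju := (dual_mod (e u)).

Lemma u_le_n : (u <= n)%N. Proof. by lia. Qed.
Lemma u_lt_r : (u < r)%N. Proof. by lia. Qed.
Lemma n_lt_ur : (n < u + r)%N. Proof. by lia. Qed.

Variable tri : V -> triple n u e.
Hypotheses (tri_left_key : forall x, tri_l (tri x) =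
  left_key x) (tri_right_key : forall x, tri_r (tri x) = right_key x).
Local Notation C := (fun x => tri_cx (tri x)).
Variables (T : cx A) (inc : forall x, cxmap (C x) T) (prj : forall x, cxmap T (C x)).
Hypotheses (dT : decomp (index_enum V) inc prj) (DT : is_Db T).

Lemma tri_leE x y : tri_le (tri x) (tri y) = key_le x y.
Proof. by rewrite /tri_le /key_le !tri_left_key !tri_right_key. Qed.

Lemma T_bdd_below_inj : bdd_below_inj T.
Proof.
split; first by apply: (decomp_injective dT) => x l; apply: (tri_injective zB).
have [[N HN] _] := DT; exists (- (N.+1)%:Z) => i lei; apply: HN; lia.
Qed.

(** The condition of [tri_shift1] on C(a, b) and C(a', b'): if a' < a and b' <= n, then
    b' is at most u + v or equal to u + v + 1 + a', so b' < a + (u + v + 1). *)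
Lemma T_shift_null (i : int) : i != 0 -> forall p : cxmap T (cx_shift T i), null_homotopic p.
Proof.
move=> ni; apply: (decomp_null_homotopic dT) => x y p.
apply: (tri_shift_null u_gt0 u_le_n u_lt_r n_lt_ur zB p ni).
rewrite tri_left_key !tri_right_key tri_left_key;
  have [le|gt] := leqP (left_key x) (left_key y); first by constructor 1.
case: y x gt {p} => [[j|j]|j] x gt /=; [constructor 3 | by constructor 2 | constructor 3].
  by move: gt => /=; lia.
by have := ltn_ord j; lia.
Qed.

Lemma Ju_neq0 : exists w : Ju, w != 0.
Proof.
exists (delta zB u u).
by have := @homz_neq0 _ _ _ _ _ _ zB u u; rewrite homz_id; apply; lia.
Qed.

Definition key_map x y : cxmap (C x) (C y) :=
  match pselect (tri_le (tri x) (tri y)) with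
  | left H => sval (cid (tri_map_ex u_gt0 u_le_n u_lt_r n_lt_ur zB H))
  | right _ => cxmap_zero _ _ end.

Lemma key_mapE x y (w : Ju) : key_le x y -> key_map x y (Posz 0) w = w.
Proof.
rewrite -tri_leE /key_map => le; case: pselect => // H.
exact: (svalP (cid (tri_map_ex u_gt0 u_le_n u_lt_r n_lt_ur zB H))).
Qed.

(** The action on T of the incidence algebra of the poset of keys. *)
Definition incidence_map (a : B) : cxmap T T :=
  \big[@cxmap_add _ _ T T/cxmap_zero T T]_(q : V * V)
    cxmap_scale (branch_count q.1 q.2 a) (cxmap_comp (inc q.2) (cxmap_comp (key_map q.1 q.2)
      (prj q.1))).

Lemma prj0_inc x y (w : Ju) : prj y (Posz 0) (inc x (Posz 0) w) = if x == y then w else 0 :> Ju.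
Proof.
have [_ H2 _] := dT; case: eqP => [<-|/eqP ne]; first exact: (prj_inc dT).
by apply: H2; rewrite eq_sym.
Qed.

Lemma incidence_map0 a t w : prj t (Posz 0) (incidence_map a (Posz 0) w) =
  \sum_s (branch_count s t a) %:: (prj s (Posz 0) w : Ju) :> Ju.
Proof.
rewrite /incidence_map sum_cxmapE linear_sum.
rewrite -(pair_bigA _ (fun s y => prj t (Posz 0) (cxmap_scale (branch_count s y a)
   (cxmap_comp (inc y) (cxmap_comp (key_map s y) (prj s))) (Posz 0) w))) /=.
apply: eq_bigr => s _; rewrite (bigD1 t) //= big1 ?addr0 => [|y ne].
  rewrite linear_kscale; have [le|nle] := boolP (key_le s t);
    last by rewrite branch_count_nle // !kscale0.
  by congr (_ *: _); apply: etrans (prj0_inc t t _) _; rewrite eqxx; apply: key_mapE.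
rewrite linear_kscale.
have -> : prj t (Posz 0) (inc y (Posz 0) (key_map s y (Posz 0) (prj s (Posz 0) w))) = 0.
  by apply: etrans (prj0_inc y t _) _; rewrite (negPf ne).
by rewrite scaler0.
Qed.

(** A chain map between two summands that vanishes in degree 0 is zero. *)
Lemma End_ext (f g : cxmap T T) :
  (forall t w, prj t (Posz 0) (f (Posz 0) w) = prj t (Posz 0) (g (Posz 0) w)) -> cxmap_eq f g.
Proof.
move=> E; apply: (decomp_ext dT) => x y l w.
pose d := cxmap_comp (prj y) (cxmap_comp (cxmap_add f (cxmap_scale (-1) g)) (inc x)).
have d0 : forall l w, d l w = 0.
  apply: (tri_map_eq0 u_gt0 u_le_n u_lt_r n_lt_ur zB) => w0.
  by rewrite /d /= kscaleNl kscale1 raddfB /= E subrr.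
have := d0 l w; rewrite /d /= kscaleNl kscale1 raddfB /= => /eqP.
by rewrite subr_eq0 => /eqP.
Qed.

Lemma End_branch : End_isomorphic B T.
Proof.
apply: (@End_isomorphicP _ _ B T incidence_map DT T_bdd_below_inj).
- move=> a b; apply: End_ext => t w; rewrite /= raddfD /= !incidence_map0 -big_split.
  by apply: eq_bigr => s _ /=; rewrite branch_countD kscaleDl.
- move=> c a; apply: End_ext => t w; rewrite /= linear_kscale !incidence_map0 scaler_sumr.
  by apply: eq_bigr => s _ /=; rewrite branch_countZ kscaleA.
- apply: End_ext => t w; rewrite incidence_map0 /= (bigD1 t) //= big1 ?addr0 => [|s ne].
    by rewrite branch_count1 eqxx kscale1.
  by rewrite branch_count1 (negPf ne) kscale0.
- move=> a b; apply: End_ext => t w; rewrite /= !incidence_map0.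
  under [RHS]eq_bigr => s _ do rewrite incidence_map0 scaler_sumr.
  rewrite exchange_big; apply: eq_bigr => s _ /=; rewrite branch_countM.
  by rewrite !scaler_suml; apply: eq_bigr => s' _; rewrite kscaleA.
- move=> a b N; apply: branch_count_inj => s t; have [w nw] := Ju_neq0.
  have N' := null_compl (prj t) (null_compr (inc s) N).
  have /eqP := tri_null u_gt0 u_le_n u_lt_r n_lt_ur zB N' (i := Posz 0) w.
  rewrite /= kscaleNl kscale1 raddfB /= !incidence_map0.
  have E c : \sum_s' (branch_count s' t c) %:: (prj s' (Posz 0) (inc s (Posz 0) w) : Ju) =
    (branch_count s t c) %:: w.
    rewrite (bigD1 s) //= big1 ?addr0 => [|s' ne]; rewrite prj0_inc ?eqxx //.
    by rewrite eq_sym (negPf ne) scaler0.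
  rewrite !E -kscaleNl -kscaleDl => /eqP E0; apply/eqP; rewrite -subr_eq0.
  by apply: contraNT nw => ncc; apply/eqP; apply: kscale_eq0 ncc E0.
move=> g.
have Hc s t : exists c : k, (~~ key_le s t -> c = 0) /\
    forall w : Ju, prj t (Posz 0) (g (Posz 0) (inc s (Posz 0) w)) = c %:: w.
  pose q := cxmap_comp (prj t) (cxmap_comp g (inc s)).
  have [le|nle] := boolP (key_le s t); last first.
    exists 0; split=> // w; rewrite kscale0.
    by apply: (tri_map_nle u_gt0 u_le_n u_lt_r n_lt_ur zB q); rewrite tri_leE.
  have [c Hc] := tri_map_scalar zB q; exists c; split=> //.
pose c s t := sval (cid (Hc s t)).
have [a Ha] := @branch_count_surj k u v u_gt0 c (fun s t => (svalP (cid (Hc s t))).1).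
exists a; apply: End_ext => t w; rewrite incidence_map0.
have [_ _ H3] := dT; rewrite [w in RHS](H3 (Posz 0)) !linear_sum; apply: eq_bigr => s _.
rewrite Ha; apply/esym; exact: (svalP (cid (Hc s t))).2.
Qed.
End EndAlgebra.

(** * Generation by T *)
Section ThickThreeTerm.
Variables (k : fieldType) (A : algType k) (P : cx A -> Prop) (thP : thick P).
Variables (M N R : lmodType A) (f : {linear M -> N}) (g : {linear N -> R}).
Hypothesis gf0 : forall x, g (f x) = 0.
Hypotheses (fM : fin_gen M) (fN : fin_gen N) (fR : fin_gen R).

Definition low_part : cx A := @cx3 _ _ M (mod0 A) (mod0 A) \0 \0 (fun=> erefl).
Definition high_part : cx A := @cx3 _ _ (mod0 A) (mod0 A) R \0 \0 (fun=> erefl).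
Local Notation right := (cx_right g).

Let eq_mod0 (x y : mod0 A) : x = y.
Proof. by rewrite [x]mod0_zero [y]mod0_zero. Qed.

Let f0 : fin_gen (mod0 A).
Proof. by apply: fin_gen_zero => x; apply: mod0_zero. Qed.

Lemma low_iso : P low_part <-> P (cx_stalk M).
Proof.
have @p : cxmap low_part (cx_shift (cx_stalk M) 1).
  refine (@cx3_out _ _ M (mod0 A) (mod0 A) \0 \0 _ (cx_shift (cx_stalk M) 1)
    (idfun : {linear M -> M}) \0 \0 _ _ _) => x; try exact: eq_mod0.
have Dl : is_Db low_part by apply: cx3_Db.
have DM : is_Db (cx_stalk M) by apply: stalk_Db.
have E : P low_part <-> P (cx_shift (cx_stalk M) 1).
  apply: (thick_iso thP (f := p)) => //; last exact: shift_Db.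
    by move=> [[|[|i]]|[|i]] x y //= _; apply: eq_mod0.
  move=> [[|[|i]]|[|[|i]]] y; try by exists 0; apply: eq_mod0.
  by exists y.
split=> [/E|PM]; first exact: thick_unshift.
by apply/E; apply: thick_shift.
Qed.

Lemma high_iso : P high_part <-> P (cx_stalk R).
Proof.
have @p : cxmap high_part (cx_shift (cx_stalk R) (-1)).
  refine (@cx3_out _ _ (mod0 A) (mod0 A) R \0 \0 _ (cx_shift (cx_stalk R) (-1))
    \0 \0 (idfun : {linear R -> R}) _ _ _) => x; try exact: eq_mod0.
  by symmetry; apply: (raddf0 (cx_d (cx_shift (cx_stalk R) (-1)) (Posz 0))).
have Dl : is_Db high_part by apply: cx3_Db.
have DM : is_Db (cx_stalk R) by apply: stalk_Db.
have E : P high_part <-> P (cx_shift (cx_stalk R) (-1)).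
  apply: (thick_iso thP (f := p)) => //; last exact: shift_Db.
    by move=> [[|[|i]]|[|i]] x y //= _; apply: eq_mod0.
  move=> [[|[|[|i]]]|[|[|i]]] y; try by exists 0; apply: eq_mod0.
  by exists y.
split=> [/E|PM]; first exact: thick_unshift.
by apply/E; apply: thick_shift.
Qed.

Definition right_in : cxmap right (cx3 gf0).
Proof.
refine (@cx3_out _ _ (mod0 A) N R \0 g _ (cx3 gf0) \0 idfun idfun _ _ _) => x //=.
by rewrite raddf0.
Defined.

Definition low_out : cxmap (cx3 gf0) low_part.
Proof.
by refine (@cx3_out _ _ M N R f g _ low_part idfun \0 \0 _ _ _) => x; apply: eq_mod0.
Defined.

Lemma right_low_exact : short_exact right_in low_out.
Proof.
split=> [] [[|[|i]]|[|i]] //=; try by move=> *; apply: eq_mod0.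
all: try by move=> y; exists y.
all: try by move=> y; exists 0; apply: eq_mod0.
all: try by move=> y _; exists y.
all: try by move=> y; exists 0.
Qed.

Definition high_in : cxmap high_part right.
Proof.
refine (@cx3_out _ _ (mod0 A) (mod0 A) R \0 \0 _ right \0 \0 idfun _ _ _) => x //=.
by rewrite raddf0.
Defined.

Definition stalk_out : cxmap right (cx_stalk N).
Proof.
by refine (@cx3_out _ _ (mod0 A) N R \0 g _ (cx_stalk N) \0 idfun \0 _ _ _) => x //=.
Defined.

Lemma high_right_exact : short_exact high_in stalk_out.
Proof.
split=> [] [[|[|i]]|[|i]] //=; try by move=> *; apply: eq_mod0.
all: try by move=> y; exists y.
all: try by move=> y; exists 0; apply: eq_mod0.
all: try by move=> y _; exists y.
all: try by move=> y; exists 0.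
Qed.

Hypotheses (PX : P (cx3 gf0)) (PN : P (cx_stalk N)).

(** Truncations give short exact sequences relating the complex to its middle term and
    to the shifts of its outer terms. *)
Lemma thick_cx3_l : P (cx_stalk R) -> P (cx_stalk M).
Proof.
move=> /high_iso PR; apply/low_iso; apply: (thick_quot thP right_low_exact) => //.
  exact: cx3_Db.
by apply: (thick_mid thP high_right_exact) => //; apply: cx3_Db.
Qed.

Lemma thick_cx3_r : P (cx_stalk M) -> P (cx_stalk R).
Proof.
move=> /low_iso PM; apply/high_iso; apply: (thick_sub thP high_right_exact) => //.
  exact: cx3_Db.
by apply: (thick_sub thP right_low_exact) => //; apply: cx3_Db.
Qed.
End ThickThreeTerm.

Lemma nak_interval_basis (k : fieldType) (n r : nat) (n_gt0 : (0 < n)%N) (r_gt0 : (0 < r)%N) :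
  interval_basis n r (nak_basis k n_gt0 r_gt0) (nak_idem k n_gt0 r_gt0).
Proof.
split=> //.
- exact: nak_basis_out.
- exact: nak_basis_neq0.
- exact: nak_basis_mul.
- exact: nak_basis_orth.
- exact: nak_basis_sum1.
- exact: nak_basis_sandwich.
- exact: nak_fin_dim.
- exact: nak_idemE.
Qed.

(** * The tilting complex *)
Section Assembly.
Variables (k : fieldType) (u v : nat) (u_gt0 : (0 < u)%N) (v_gt0 : (0 < v)%N).
Local Notation n := (2 * u + v)%N.
Local Notation r := (u + v + 1)%N.
Local Notation I := (InjI k u v_gt0).
Local Notation A := (bqalg (nakB k u v_gt0)).
Local Notation idem := (nak_idem k (nak_n_gt0 u v_gt0) (nak_r_gt0 u v)).
Variables
    (e : forall i : nat, {linear I i -> I u})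
    (f : forall j : nat, {linear I u -> I j})
    (g : forall l : nat, {linear I l -> I u})
    (h : forall l : nat, {linear I u -> I (u + v + 1 + l)}).
Hypotheses
    (e_neq0 : forall i, (1 <= i <= u - 1)%N -> exists x, e i x != 0)
    (f_neq0 : forall j, (u + 1 <= j <= u + v + 1)%N -> exists x, f j x != 0)
    (g_neq0 : forall l, (1 <= l <= u - 1)%N -> exists x, g l x != 0)
    (h_neq0 : forall l, (1 <= l <= u - 1)%N -> exists x, h l x != 0).
Local Notation V := (branch_vert u v).
Local Notation T := (vT e f g h).

Let zB : interval_basis n r (nak_basis k (nak_n_gt0 u v_gt0) (nak_r_gt0 u v)) idem :=
  nak_interval_basis k (nak_n_gt0 u v_gt0) (nak_r_gt0 u v).

Definition tri_S : triple n u idem :=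
  @Triple _ _ n u idem 0 n.+1 (mod0 A) (mod0 A) \0 \0 (left_none u idem) (right_none n u idem)
    (@lin0_comp _ _ (mod0 A) (I u) (mod0 A) \0).

Lemma e_left i : (i.+1 < u)%N -> left_term (A := A) (u := u) (e := idem) i.+1 (e i.+1).
Proof. by move=> lt; apply: left_some; [lia | apply: e_neq0; lia]. Qed.

Definition tri_E i (lt : (i.+1 < u)%N) : triple n u idem :=
  @Triple _ _ n u idem i.+1 n.+1 (I i.+1) (mod0 A) (e i.+1) \0 (e_left lt) (right_none n u idem)
    (@lin0_comp _ _ (I i.+1) (I u) (mod0 A) (e i.+1)).

Lemma f_right j : (u < j <= r)%N -> right_term (A := A) n (u := u) (e := idem) j (f j).
Proof. by move=> lt; apply: right_some; [lia | apply: f_neq0; lia]. Qed.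

Definition tri_F j (lt : (u < j <= r)%N) : triple n u idem :=
  @Triple _ _ n u idem 0 j (mod0 A) (I j) \0 (f j) (left_none u idem) (f_right lt)
    (@lin_comp0 _ _ (mod0 A) (I u) (I j) (f j)).

Lemma g_left i : (i.+1 < u)%N -> left_term (A := A) (u := u) (e := idem) i.+1 (g i.+1).
Proof. by move=> lt; apply: left_some; [lia | apply: g_neq0; lia]. Qed.

Lemma h_right i : (i.+1 < u)%N ->
  right_term (A := A) n (u := u) (e := idem) (r + i.+1) (h i.+1).
Proof. by move=> lt; apply: right_some; [lia | apply: h_neq0; lia]. Qed.

Definition tri_G i (lt : (i.+1 < u)%N) : triple n u idem :=
  @Triple _ _ n u idem i.+1 (r + i.+1) (I i.+1) (I (r + i.+1)) (g i.+1) (h i.+1)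
    (g_left lt) (h_right lt) (@InjI_comp_eq0 k u v v_gt0 i.+1 (g i.+1) (h i.+1)).

Lemma r_range : (u < r <= r)%N. Proof. by lia. Qed.
Lemma c_range (i : 'I_v) : (u < u.+1 + i <= r)%N.
Proof. by have := ltn_ord i; lia. Qed.

Definition tri (x : V) : triple n u idem :=
  match x with
  | inl (inl i) => (match nat_of_ord i as m return (m < u)%N -> triple n u idem with
      | 0%N => fun _ => tri_F r_range | l.+1 => fun lt => tri_G lt end) (ltn_ord i)
  | inl (inr i) => (match nat_of_ord i as m return (m < u)%N -> triple n u idem with
      | 0%N => fun _ => tri_S | l.+1 => fun lt => tri_E lt end) (ltn_ord i)
  | inr i => tri_F (c_range i) end.

Lemma tri_left_key x : tri_l (tri x) = left_key x.
Proof. by case: x => [[[[|i] lt]|[[|i] lt]]|i]. Qed.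

Lemma tri_right_key x : tri_r (tri x) = right_key x.
Proof. by case: x => [[[[|i] lt]|[[|i] lt]]|i] //=; rewrite addn0. Qed.

Local Notation C := (fun x => tri_cx (tri x)).

Let ord_first : 'I_u := Ordinal u_gt0.
Let xE (i : nat) : V := vb v (insubd ord_first i).
Let xG (i : nat) : V := vt v (insubd ord_first i).
(* The last of the F'_j is the summand at t_1, not at some c_i. *)
Let xF (j : nat) : V :=
  if insub (j - u.+1)%N is Some i then vc u (i : 'I_v) else vt v ord_first.

Lemma insubd_ord i (lt : (i < u)%N) : insubd ord_first i = Ordinal lt.
Proof. by apply: val_inj; rewrite val_insubd lt. Qed.

Lemma C_E i : (1 <= i < u)%N -> C (xE i) = cxE e i.
Proof. by case: i => // i /= lt; rewrite /xE insubd_ord. Qed.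

Lemma C_G i : (1 <= i < u)%N -> C (xG i) = cxG g h i.
Proof. by case: i => // i /= lt; rewrite /xG insubd_ord. Qed.

Lemma C_F j : (u.+1 <= j < u + v + 2)%N -> C (xF j) = cxF f j.
Proof.
move=> /andP[le lt]; rewrite /xF; case: insubP => [i _ Ei|].
  have -> : j = (u.+1 + i)%N by rewrite Ei subnKC.
  by [].
rewrite -leqNgt => le'; have -> : j = r by lia.
by [].
Qed.

Lemma C_S : C (vb v ord_first) = cx_stalk (I u).
Proof. by []. Qed.

Let summands : seq V := vb v ord_first ::
  (map xE (index_iota 1 u) ++ (map xF (index_iota u.+1 (u + v + 2)) ++ map xG (index_iota 1 u))).

Lemma vT_big : T = cx_biprod (C (vb v ord_first))
  (cx_biprod (\big[@cx_biprod _ _/cx_zero A]_(x <- map xE (index_iota 1 u)) C x)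
  (cx_biprod (\big[@cx_biprod _ _/cx_zero A]_(x <- map xF (index_iota u.+1 (u + v + 2))) C x)
             (\big[@cx_biprod _ _/cx_zero A]_(x <- map xG (index_iota 1 u)) C x))).
Proof.
rewrite !big_map /vT; congr cx_biprod; congr cx_biprod; last congr cx_biprod.
- by apply: eq_big_nat => i /C_E ->.
- by apply: eq_big_nat => i /C_F ->.
- by apply: eq_big_nat => i /C_G ->.
Qed.

Lemma summands_cover x : x \in summands.
Proof.
rewrite inE !mem_cat; case: x => [[i|i]|i].
- have [i0|i1] := posnP i.
    apply/orP; right; apply/orP; right; apply/orP; left.
    apply/mapP; exists r; first by rewrite mem_index_iota; lia.
    rewrite /xF; case: insubP => [j /= _ Ej|_]; first by have := ltn_ord j; lia.
    by congr (inl (inl _)); apply: val_inj.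
  apply/orP; right; apply/orP; right; apply/orP; right.
  apply/mapP; exists (nat_of_ord i); first by rewrite mem_index_iota i1 ltn_ord.
  by rewrite /xG valKd.
- have [i0|i1] := posnP i.
    by apply/orP; left; apply/eqP; congr (inl (inr _)); apply: val_inj.
  apply/orP; right; apply/orP; left.
  apply/mapP; exists (nat_of_ord i); first by rewrite mem_index_iota i1 ltn_ord.
  by rewrite /xE valKd.
- apply/orP; right; apply/orP; right; apply/orP; left.
  apply/mapP; exists (u.+1 + i)%N; first by rewrite mem_index_iota; have := ltn_ord i; lia.
  by rewrite /xF addKn valK.
Qed.

Lemma summands_perm : perm_eq summands (index_enum V).
Proof.
have sub : {subset index_enum V <= summands} by move=> x _; apply: summands_cover.
have sz : (size summands <= size (index_enum V))%N.
  have -> : size (index_enum V) = (u + u + v)%N.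
    transitivity #|{: 'I_u + 'I_u + 'I_v}|; first by rewrite -sum1_size -sum1_card;
      apply: eq_bigl.
    by rewrite !card_sum !card_ord.
  rewrite /summands [size (_ :: _)]/= !size_cat !size_map !size_iota; lia.
have us := leq_size_uniq (index_enum_uniq V) sub sz.
by apply: uniq_perm => //; [apply: index_enum_uniq | move=> x;
  rewrite summands_cover mem_index_enum].
Qed.

Lemma vT_decomp : exists inc prj, @decomp k A V C T (index_enum V) inc prj.
Proof.
have : uniq summands by rewrite (perm_uniq summands_perm) index_enum_uniq.
rewrite /summands cons_uniq cat_uniq cat_uniq => /and4P[n0 uE dE /and3P[uF dF uG]].
have [inc [prj [H1 H2 H3]]] : exists inc prj, @decomp k A V C T summands inc prj.
  rewrite vT_big; apply: decomp_cons => //; apply: decomp_biprod.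
  - by move=> x xE'; apply: contra dE => H; apply/hasP; exists x.
  - exact: decomp_big.
  apply: decomp_biprod; [| exact: decomp_big | exact: decomp_big].
  by move=> x xF'; apply: contra dF => H; apply/hasP; exists x.
exists inc, prj; split=> // [i _|l x]; first by apply: H1; apply: summands_cover.
by rewrite {1}(H3 l x); apply: perm_big; apply: summands_perm.
Qed.

Lemma I_fg a : fin_gen (I a).
Proof. exact: (dual_fg zB). Qed.

Lemma C_Db x : is_Db (C x).
Proof. exact: (tri_Db zB). Qed.

Lemma big_Db (s : seq V) : is_Db (\big[@cx_biprod _ _/cx_zero A]_(x <- s) C x).
Proof.
have D0 : is_Db (cx_zero A).
  by apply: stalk_Db; apply: fin_gen_zero => x; apply: mod0_zero.
by elim: s => [|x s IH]; rewrite ?big_nil // big_cons; apply: biprod_Db => //; apply: C_Db.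
Qed.

Lemma vT_Db : is_Db T.
Proof.
rewrite vT_big; apply: biprod_Db; first exact: C_Db.
apply: biprod_Db; first exact: big_Db.
by apply: biprod_Db; apply: big_Db.
Qed.

Section Generation.
Variables (P : cx A -> Prop) (thP : thick P) (PT : P T).

Lemma thick_C x : P (C x).
Proof.
move: PT; rewrite vT_big => PT'.
have DE := big_Db (map xE (index_iota 1 u)).
have DF := big_Db (map xF (index_iota u.+1 (u + v + 2))).
have DG := big_Db (map xG (index_iota 1 u)).
have DFG := biprod_Db DF DG.
have DEFG := biprod_Db DE DFG.
have D0 := C_Db (vb v ord_first).
have PEFG := thick_biprod_r thP D0 DEFG PT'.
have PFG := thick_biprod_r thP DE DFG PEFG.
have PG := thick_biprod_r thP DF DG PFG.
have PF := thick_summand thP DF DG PFG.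
have PE := thick_summand thP DE DFG PEFG.
have D (s : seq V) : forall y, y \in s -> is_Db (C y) by move=> y _; apply: C_Db.
have := summands_cover x; rewrite inE !mem_cat => /or4P[/eqP->|xE'|xF'|xG'].
- exact: (thick_summand thP D0 DEFG PT').
- exact: ((@thick_big _ _ P thP V _ C (D _)).2 PE x xE').
- exact: ((@thick_big _ _ P thP V _ C (D _)).2 PF x xF').
- exact: ((@thick_big _ _ P thP V _ C (D _)).2 PG x xG').
Qed.

(** I_a comes from E'_a for a < u, from F'_a for u < a <= u + v + 1, and from G'_l and
    I_l for a = u + v + 1 + l. *)
Lemma thick_I a : (1 <= a <= n)%N -> P (cx_stalk (I a)).
Proof.
have P0 : P (cx_stalk (mod0 A)) by apply: (thick_zero thP).
have PN : P (cx_stalk (I u)) by rewrite -C_S; apply: thick_C.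
have f0 : fin_gen (mod0 A) by apply: fin_gen_zero => x; apply: mod0_zero.
have PL b : (1 <= b < u)%N -> P (cx_stalk (I b)).
  move=> rb; have := thick_C (xE b); rewrite (C_E rb) => PX.
  exact: (thick_cx3_l thP (I_fg b) (I_fg u) f0 PX PN P0).
move=> ra; have [ltu|geu] := ltnP a u; first by apply: PL; lia.
have [->//|neu] := eqVneq a u.
have [ler|gtr] := leqP a r.
  have ra' : (u.+1 <= a < u + v + 2)%N by lia.
  have := thick_C (xF a); rewrite (C_F ra') => PX.
  exact: (thick_cx3_r thP f0 (I_fg u) (I_fg a) PX PN P0).
have rl : (1 <= a - r < u)%N by lia.
have := thick_C (xG (a - r)); rewrite (C_G rl) => PX.
have -> : a = (r + (a - r))%N by lia.
exact: (thick_cx3_r thP (I_fg _) (I_fg u) (I_fg _) PX PN (PL _ rl)).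
Qed.
End Generation.

Lemma vT_tilting : tilting T.
Proof.
have [inc [prj dT]] := vT_decomp.
split; first exact: vT_Db.
  move=> i ni p; apply: roof_zero;
    [exact: vT_Db | | exact: (T_shift_null u_gt0 v_gt0 zB tri_left_key tri_right_key dT ni)].
  have [iT [lo Hlo]] := T_bdd_below_inj u_gt0 v_gt0 zB dT vT_Db.
  split=> [j|]; first exact: iT.
  by exists (lo - i) => j le; apply: Hlo; rewrite -lerBrDr.
move=> P thP PT X; apply: (thick_inj zB thP) => a ra.
exact: (thick_I thP PT ra).
Qed.

Lemma vT_End : End_isomorphic (bqalg (one_branch k v u_gt0)) T.
Proof.
have [inc [prj dT]] := vT_decomp.
exact: (End_branch u_gt0 v_gt0 zB tri_left_key tri_right_key dT vT_Db).
Qed.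
End Assembly.

Theorem proposition5p7 (k : closedFieldType) (u v : nat)
    (u_gt0 : (0 < u)%N) (v_gt0 : (0 < v)%N)
    (e : forall i : nat, {linear InjI k u v_gt0 i -> InjI k u v_gt0 u})
    (f : forall j : nat, {linear InjI k u v_gt0 u -> InjI k u v_gt0 j})
    (g : forall l : nat, {linear InjI k u v_gt0 l -> InjI k u v_gt0 u})
    (h : forall l : nat, {linear InjI k u v_gt0 u -> InjI k u v_gt0 (u + v + 1 + l)})
    (e_neq0 : forall i, (1 <= i <= u - 1)%N -> exists x, e i x != 0)
    (f_neq0 : forall j, (u + 1 <= j <= u + v + 1)%N -> exists x, f j x != 0)
    (g_neq0 : forall l, (1 <= l <= u - 1)%N -> exists x, g l x != 0)
    (h_neq0 : forall l, (1 <= l <= u - 1)%N -> exists x, h l x != 0) :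
  tilting (vT e f g h)
  /\ End_isomorphic (bqalg (one_branch k v u_gt0)) (vT e f g h).
Proof. by split; [apply: vT_tilting | apply: vT_End]. Qed.
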